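(* For $\gamma\in(0,2)$ and $m>0$ let $$c_\gamma(m):=\frac1\pi\left\{\mathbb{E}\left[\int_0^\infty \mathcal{I}\big(e^{\gamma(B_t-mt)}\big)dt\right]+\mathbb{E}\left[\int_0^\infty\mathcal{I}\big(e^{\gamma\mathcal{B}^m_t}\big)dt\right]\right\},\qquad \mathcal{I}(x):=xe^{-x},$$ where $(B_t)_{t\ge0}$ is a standard one-dimensional Brownian motion and $(\mathcal{B}^m_t)_{t\ge0}$ is a Brownian motion with drift $m$ started from $0$ and conditioned to be non-negative at all times. Then for every $\gamma\in(0,2)$ and $m>0$, $$c_\gamma(m)=\frac{1}{\pi\gamma m}.$$ In particular, with $Q=\frac\gamma2+\frac2\gamma$ and $c_\gamma:=c_\gamma(Q-\gamma)$, $$c_\gamma=\frac{1}{\pi(2-\gamma^2/2)}.$$ Moreover $\lim_{\gamma\to0^+}c_\gamma=c_0:=\frac{1}{2\pi}$ and $c_\gamma>c_0$ for all $\gamma\in(0,2)$.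
   Context: The process $\mathcal{B}^m$ is understood in the usual sense, as the limit in law as $\epsilon\to0^+$ of a Brownian motion with drift $m$ started at $\epsilon$ and conditioned on the (positive probability) event of staying non-negative forever. *)

(* Defs.v *)
From mathcomp Require Import all_boot all_order all_algebra.
From mathcomp Require Import all_classical all_reals all_analysis.

Set Implicit Arguments.
Unset Strict Implicit.
Unset Printing Implicit Defensive.

Import Order.TTheory GRing.Theory Num.Theory.
Import numFieldNormedType.Exports.

Local Open Scope classical_set_scope.
Local Open Scope ring_scope.

(* Time is a real number, but only the values at times t >= 0 are ever used. *)
Record process (R : realType) := Process {
  process_display : measure_display;
  process_space : measurableType process_display;
  process_prob : probability process_space R;
  process_at :> R -> {RV process_prob >-> R} }.

Section Processes.
Variable R : realType.

Definition sample_path (X : process R) (w : process_space X) : R -> R :=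
  fun t => X t w.
Arguments sample_path : clear implicits.

Definition continuous_on_time (f : R -> R) : Prop :=
  {within `[0, +oo[, continuous f}.

Definition increment (X : process R) (s t : R) : process_space X -> R :=
  X t \- X s.
Arguments increment : clear implicits.

(* Testing with arbitrary Borel sets A i, possibly setT, the product formula
   over i < n is the mutual independence of the n increments. *)
Definition independent_increments (X : process R) : Prop :=
  forall (n : nat) (t : nat -> R) (A : nat -> set R),
    0 <= t 0%N -> (forall i, t i <= t i.+1) -> (forall i, measurable (A i)) ->
    process_prob X
      (\bigcap_(i in `I_n) (increment X (t i) (t i.+1) @^-1` A i)) =
    (\prod_(i < n) process_prob X (increment X (t i) (t i.+1) @^-1` A i))%E.

(* The second parameter of normal_prob is the standard deviation. *)
Definition gaussian_increments (X : process R) : Prop :=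
  forall (s t : R) (A : set R), 0 <= s -> s < t -> measurable A ->
    process_prob X (increment X s t @^-1` A) = normal_prob 0 (Num.sqrt (t - s)) A.

Definition standard_brownian_motion (X : process R) : Prop :=
  [/\ forall w, X 0 w = 0,
      forall w, continuous_on_time (sample_path X w),
      independent_increments X &
      gaussian_increments X].

(* The restriction to [0, +oo[ identifies continuous_paths, as a subspace of
   path_space, with C([0, +oo[) under uniform convergence on compact sets
   (functions that agree on [0, +oo[ are topologically indistinguishable). *)
Definition compact_times (K : set R) : Prop :=
  compact K /\ K `<=` `[0, +oo[.
Notation path_space := {family compact_times, R -> R}.

Definition continuous_paths : set path_space :=
  [set f | continuous_on_time f].

Definition bounded_continuous_functional (F : path_space -> R) : Prop :=
  {within continuous_paths, continuous F} /\
  exists M : R, forall f, continuous_paths f -> `|F f| <= M.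

Definition drifted_path (m x : R) (W : process R) (w : process_space W) :
    R -> R :=
  fun t => x + (W t w + m * t).
Arguments drifted_path : clear implicits.

Definition stays_nonnegative (m x : R) (W : process R) :
  set (process_space W) :=
  [set w | forall t, 0 <= t -> 0 <= drifted_path m x W w t].
Arguments stays_nonnegative : clear implicits.

(* Expectation of f under the conditional probability P( . | A). *)
Definition conditional_expectation d (T : measurableType d)
    (P : probability T R) (A : set T) (f : T -> R) : R :=
  (\int[P]_(w in A) f w) / fine (P A).

(* For m > 0: the law of X on C([0, +oo[) is the weak limit, as e -> 0+, of the
   law of t |-> e + W_t + m t conditioned on staying non-negative forever, an
   event of positive probability. This does not depend on the choice of W. *)
Definition conditioned_brownian_motion (m : R) (X : process R) : Prop :=
  (forall w, continuous_on_time (sample_path X w)) /\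
  exists2 W : process R, standard_brownian_motion W &
    forall F : path_space -> R, bounded_continuous_functional F ->
      conditional_expectation (process_prob W) (stays_nonnegative m e W)
          (fun w => F (drifted_path m e W w)) @[e --> 0^'+] -->
      \int[process_prob X]_w F (sample_path X w).

Definition I_fun (x : R) : R := x * expR (- x).

(* c_gamma(m), computed from realisations B of Brownian motion and X of the
   conditioned process; the integrands are non-negative, so the integrals are
   taken in the extended reals. *)
Definition c_gamma_m (B X : process R) (gamma m : R) : \bar R :=
  ((pi^-1)%:E *
   (\int[process_prob B]_w
      \int[lebesgue_measure]_(t in `[0%R, +oo[)
        (I_fun (expR (gamma * (B t w - m * t))))%:E +
    \int[process_prob X]_w
      \int[lebesgue_measure]_(t in `[0%R, +oo[)
        (I_fun (expR (gamma * X t w)))%:E))%E.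

Definition Q_of (gamma : R) : R := gamma / 2 + 2 / gamma.

(* c_gamma = c_gamma(Q - gamma), for a family X of conditioned processes
   indexed by the drift. *)
Definition c_gamma (B : process R) (X : R -> process R) (gamma : R) : \bar R :=
  c_gamma_m B (X (Q_of gamma - gamma)) gamma (Q_of gamma - gamma).

Definition c_zero : R := (2 * pi)^-1.

End Processes.

Arguments sample_path {R} X w _.
Arguments increment {R} X s t _.
Arguments drifted_path {R} m x W w _.
Arguments stays_nonnegative {R} m x W _.

(* Main.v *)
From HB Require Import structures.
Require Import Defs.
From mathcomp Require Import all_boot all_order all_algebra.
From mathcomp Require Import all_classical all_reals all_analysis.
From mathcomp Require Import measurable_realfun lra ring.

Set Implicit Arguments.
Unset Strict Implicit.
Unset Printing Implicit Defensive.

Import Order.TTheory GRing.Theory Num.Theory.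
Import numFieldNormedType.Exports.

Local Open Scope classical_set_scope.
Local Open Scope ring_scope.

(** Put [f y = I_fun (expR (gamma * y))]. Both expectations in [c_gamma_m] are
occupation integrals, of the form [\int f z * G z dz], and the reason for the simple
value is that the two occupation densities [G] add up to the constant [m^-1]
([total_occupation]). Brownian motion with drift [- m] started at [0] has density
[m^-1 * min 1 (exp (- 2 m z))]; the conditioned process has density
[m^-1 * (1 - exp (- 2 m z))] for [z >= 0], and [0] for [z < 0]. The constant is
therefore [(pi * m)^-1 * \int f z dz], and [f] is the derivative of
[- gamma^-1 * exp (- exp (gamma z))], so that its integral is [gamma^-1]
([integral_profile]). The statements about [c_gamma] follow from
[gamma * (Q - gamma) = 2 - gamma ^ 2 / 2].

The density of a drifted Brownian motion is the Gaussian kernel integrated over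
time. More generally, the discount rate [lam = (k ^ 2 - m ^ 2) / 2] turns the kernel
of drift [m] into a multiple of the kernel of drift [k], and the resolvent has the
density [green m k z = k^-1 * exp (m z - k |z|)] ([resolventE]); drift [- m] without
discount is the case of [green (- m) m] ([drifted_occupation]).

The conditioned process is only known as a weak limit. The discounted occupation
[\int exp (- lam t) * f (p t) dt] is a bounded continuous functional of the path [p]
when [lam > 0] ([discounted_functional]), so that its expectation is the limit, as
[x] decreases to [0], of its expectation for the drifted Brownian motion [Y] started
at [x] and restricted to survival, divided by the survival probability [h x]. To
compute the former, let [T] be the hitting time of the negative half-line.
- By the Markov property at a fixed time [t], the event of survival may be replaced
  with the factor [h (Y t)] on the event [t < T] ([future_markov]).
- By the strong Markov property at [T], where [Y] vanishes, the restriction to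
  [t < T] subtracts [v 0 * E (exp (- lam T))] from [v x], where [v] is the potential
  of the function [f * h] on the positive half-line ([hitting_resolvent]).
- A test function that lives on the negative half-line gives
  [E (exp (- lam T)) = exp (- (m + k) x)] ([hitting_theta]), and without discount
  [h x = 1 - exp (- 2 m x)] ([survival_prob]).
The difference [v x - v 0 * exp (- (m + k) x)] divided by [h x] tends to
[m^-1 * \int_(z >= 0) f z * h z * exp ((m - k) z) dz] ([limit_occupation]), and
letting [k] decrease to [m] gives the occupation density of the conditioned process
([conditioned_occupation]).

Both Markov properties come from the independence of finitely many increments
([markov]). The events about the whole path are reached as limits along dyadic
grids, and the first negative time of a grid replaces [T] ([cvg_first_neg_hit]). *)

(** * Translation invariance of Lebesgue measure *)

Section LebesgueShift.
Variable R : realType.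
Local Notation mu := (@lebesgue_measure R).

Lemma measurable_shift (a : R) : measurable_fun [set: measurableTypeR R]
  (fun x : measurableTypeR R => (x + a : measurableTypeR R)%R).
Proof. exact: measurable_funD. Qed.

Lemma lebesgue_measure_shift (a : R) (A : set R) : measurable A ->
  pushforward mu (fun x : R => x + a : measurableTypeR R) A = mu A.
Proof.
move=> mA; apply/esym/lebesgue_measure_unique => //=; first exact: measurable_shift.
move=> ? _ [[x y]] _ <-; rewrite /pushforward.
rewrite (_ : _ @^-1` _ = `]x - a, y - a]%classic).
  rewrite !lebesgue_measure_itv/= !lte_fin ltrD2r.
  by case: ifPn => // _; rewrite -!EFinB opprB addrA subrK.
by apply/seteqP; split => z/=; rewrite !in_itv/= ltrBlDr lerBrDr.
Qed.

Lemma ge0_integral_shift (a : R) (D : set R) (f : R -> \bar R) :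
  measurable D -> measurable_fun [set: R] f -> (forall x, (0 <= f x)%E) ->
  (\int[mu]_(x in [set x | D (x + a)%R]) f (x + a)%R = \int[mu]_(x in D) f x)%E.
Proof.
move=> mD mf f0.
transitivity (\int[pushforward mu (fun x : R => x + a : measurableTypeR R)%R]_(x in D) f x)%E.
  rewrite ge0_integral_pushforward//; [exact: measurable_shift| exact: measurable_funS mf].
apply: eq_measure_integral => //=; first exact: measurable_shift.
by move=> ? A mA _; exact: lebesgue_measure_shift.
Qed.

End LebesgueShift.

(** * The drifted Gaussian kernel integrated over time *)

Section StdCdf.
Variable R : realType.
Local Notation mu := (@lebesgue_measure R).
Local Notation npdf := (normal_pdf (0 : R) 1).

Definition std_cdf (x : R) : R := \int[mu]_(u in `]-oo, x]) npdf u.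

Lemma is_derive_std_cdf (x : R) : is_derive x 1 std_cdf (npdf x).
Proof.
have [|||| d e] := @continuous_FTC1 R npdf -oo%O x (x + 1).
- by rewrite ltrDl.
- apply: integrableS (integrable_normal_pdf 0 1) => //.
- by rewrite ltNyr.
- by apply: continuous_normal_pdf; rewrite oner_eq0.
by rewrite -e derive1E; exact: derivableP.
Qed.

Lemma std_cdf_cvg : (std_cdf x @[x --> +oo%R] --> (1 : R)) /\
  (std_cdf x @[x --> -oo%R] --> (0 : R)).
Proof.
have mid : measurable_fun setT (idfun : measurableTypeR R -> R) by exact: measurable_id.
pose X : {mfun measurableTypeR R >-> R} := HB.pack (idfun : measurableTypeR R -> R)
  (isMeasurableFun.Build _ _ _ _ _ mid).
have XE : cdf (X : {RV (normal_prob 0 1) >-> R}) = EFin \o std_cdf.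
  apply/funext => x.
  rewrite /cdf /distribution /pushforward /std_cdf /Rintegral/= fineK//.
  apply: integrable_fin_num => //.
  exact: integrableS (integrable_normal_pdf 0 1).
have fc (F : set_system R) (FF : Filter F) l :
    (EFin \o std_cdf) x @[x --> F] --> l%:E -> std_cdf x @[x --> F] --> l.
  by move/fine_cvgP => [].
by split; apply: fc; rewrite -XE; [exact: cvg_cdfy1|exact: cvg_cdfNy0].
Qed.

Lemma continuous_std_cdf : continuous std_cdf.
Proof.
move=> x; apply: differentiable_continuous; apply/derivable1_diffP.
by have [] := is_derive_std_cdf x.
Qed.

End StdCdf.

Section GreenIntegral.
Variable R : realType.
Local Notation mu := (@lebesgue_measure R).
Local Notation npdf := (normal_pdf (0 : R) 1).

Lemma normal_pdf_sqrt (t a z : R) : 0 < t ->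
  normal_pdf a (Num.sqrt t) z = (Num.sqrt t)^-1 * npdf ((z - a) / Num.sqrt t).
Proof.
move=> t0; have st0 : 0 < Num.sqrt t by rewrite sqrtr_gt0.
rewrite !normal_pdfE ?oner_eq0 ?gt_eqF// /normal_peak /normal_fun mulrA.
congr (_ * _).
  rewrite expr1n mul1r sqr_sqrtr ?ltW// -mulrnAr sqrtrM ?ltW// invfM; congr (_ * _).
congr expR; rewrite subr0 expr1n exprMn -[in RHS]mulNr exprVn -mulrA -invfM.
by congr (_ / _); rewrite mulrnAr mulr1.
Qed.

Lemma npdfE (u : R) : npdf u = normal_peak 1 * expR (- u ^+ 2 / 2).
Proof.
by rewrite normal_pdfE ?oner_eq0// /normal_fun subr0 expr1n.
Qed.

Variables (k z : R).
Hypothesis k0 : 0 < k.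

Let a (t : R) : R := (k * t - z) / Num.sqrt t.
Let b (t : R) : R := - (k * t + z) / Num.sqrt t.
(* The factor of the second term makes both derivatives multiples of [npdf (a t)];
in the difference the parts that involve [z] cancel. *)
Let F (t : R) : R := std_cdf (a t) - expR (2 * k * z) * std_cdf (b t).
Let f (t : R) : R := k * ((Num.sqrt t)^-1 * npdf (a t)).

Let is_derive_F (t : R) : 0 < t -> is_derive t 1 F (f t).
Proof.
move=> t0; have st0 : 0 < Num.sqrt t by rewrite sqrtr_gt0.
have stt : Num.sqrt t ^+ 2 = t by rewrite sqr_sqrtr// ltW.
have dsq := is_derive1_sqrt t0.
have dinv : is_derive t 1 (fun s : R => (Num.sqrt s)^-1)
    (- (Num.sqrt t) ^- 2 * (2 * Num.sqrt t)^-1).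
  have stn : Num.sqrt t != 0 by rewrite gt_eqF.
  exact: (is_deriveV stn dsq).
have da : is_derive t 1 a (k * (Num.sqrt t)^-1 +
    (k * t - z) * (- (Num.sqrt t) ^- 2 * (2 * Num.sqrt t)^-1)).
  have dl : is_derive t 1 (fun s : R => k * s - z) k.
    by apply: is_derive_eq; rewrite /GRing.scale/= subr0 mulr1.
  by apply: is_derive_eq; rewrite /GRing.scale/= addrC [in X in X + _]mulrC.
have db : is_derive t 1 b (- k * (Num.sqrt t)^-1 -
    (k * t + z) * (- (Num.sqrt t) ^- 2 * (2 * Num.sqrt t)^-1)).
  have dl : is_derive t 1 (fun s : R => - (k * s + z)) (- k).
    by apply: is_derive_eq; rewrite /GRing.scale/= addr0 mulr1.
  by apply: is_derive_eq; rewrite /GRing.scale/= addrC mulNr [in X in X - _]mulrC.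
have dPa := is_derive1_comp (is_derive_std_cdf (a t)) da.
have dPb := is_derive1_comp (is_derive_std_cdf (b t)) db.
have E : expR (2 * k * z) * npdf (b t) = npdf (a t).
  rewrite !npdfE mulrCA -expRD; congr (_ * expR _).
  by rewrite /a /b !expr_div_n stt; field; rewrite gt_eqF.
have -> : F = (@std_cdf R \o a) - (expR (2 * k * z) \*: (@std_cdf R \o b)).
  by apply/funext.
apply: is_derive_eq; rewrite /GRing.scale/= mulrCA [X in _ - X]mulrA.
rewrite [expR _ * _]E /f.
move: (npdf (a t)) => N; move: (Num.sqrt t) st0 stt => s s0 <-.
by field; rewrite gt_eqF.
Qed.

Let drift_cvgy (y : R) : (k * t - y) / Num.sqrt t @[t --> +oo%R] --> +oo%R.
Proof.
apply/cvgryPge => A; near=> t.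
have t1 : 1 <= t by near: t; apply: nbhs_pinfty_ge; rewrite num_real.
have s1 : 1 <= Num.sqrt t by rewrite -sqrtr1 ler_wsqrtr.
have tA : ((`|A| + `|y|) / k) ^+ 2 <= t.
  by near: t; apply: nbhs_pinfty_ge; rewrite num_real.
have sA : (`|A| + `|y|) / k <= Num.sqrt t.
  apply: le_trans (ler_norm _) _; rewrite -sqrtr_sqr; exact: ler_wsqrtr.
rewrite ler_pdivlMr ?(lt_le_trans ltr01)//.
rewrite -[in leRHS](@sqr_sqrtr _ t) ?(le_trans ler01)//.
move: sA; rewrite ler_pdivrMr// => sA.
set s := Num.sqrt t in s1 sA *.
have := ler_wpM2r (le_trans ler01 s1) sA.
have := ler_wpM2r (le_trans ler01 s1) (ler_norm A).
have := ler_wpM2l (normr_ge0 y) s1; have := ler_norm y; rewrite mulr1.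
by rewrite expr2 mulrDl; lra.
Unshelve. all: by end_near. Qed.

Let drift_cvg0 (y : R) : 0 < y ->
  (k * t - y) / Num.sqrt t @[t --> (0:R)^'+] --> -oo%R.
Proof.
move=> y0; apply/cvgrNyPle => A.
have kA : 0 < k + `|A| by rewrite ltr_pwDl.
near=> t.
have t0 : 0 < t by near: t; exact: nbhs_right_gt.
have t1 : t <= 1 by near: t; apply: nbhs_right_le.
have s0 : 0 < Num.sqrt t by rewrite sqrtr_gt0.
have s1 : Num.sqrt t <= 1 by rewrite -sqrtr1 ler_wsqrtr.
have tA : t <= (y / (k + `|A|)) ^+ 2.
  by near: t; apply: nbhs_right_le; apply: exprn_gt0; exact: divr_gt0.
have sA : Num.sqrt t <= y / (k + `|A|).
  rewrite -[leRHS]ger0_norm; last by rewrite divr_ge0// ltW.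
  by rewrite -sqrtr_sqr ler_wsqrtr.
rewrite ler_pdivrMr//.
rewrite -[in leLHS](@sqr_sqrtr _ t) ?(ltW t0)//.
move: sA; rewrite ler_pdivlMr// => sA.
set s := Num.sqrt t in s0 s1 sA *.
have := ler_wpM2r (ltW s0) (ler_norm (- A)); rewrite normrN => hA.
have ks := ler_wpM2l (mulr_ge0 (ltW k0) (ltW s0)) s1; rewrite mulr1 in ks.
by rewrite expr2 mulrA; lra.
Unshelve. all: by end_near. Qed.

Let drift_cvg0' (y : R) : y < 0 ->
  (k * t - y) / Num.sqrt t @[t --> (0:R)^'+] --> +oo%R.
Proof.
move=> y0; apply/cvgryPge => A; near=> t.
have t0 : 0 < t by near: t; exact: nbhs_right_gt.
have s0 : 0 < Num.sqrt t by rewrite sqrtr_gt0.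
have A1 : 0 < 1 + `|A| by rewrite ltr_pwDl.
have tA : t <= (- y / (1 + `|A|)) ^+ 2.
  by near: t; apply: nbhs_right_le; apply: exprn_gt0; rewrite divr_gt0// oppr_gt0.
have sA : Num.sqrt t <= - y / (1 + `|A|).
  rewrite -[leRHS]ger0_norm; last by rewrite divr_ge0 ?oppr_ge0// ltW.
  by rewrite -sqrtr_sqr ler_wsqrtr.
rewrite ler_pdivlMr//.
move: sA; rewrite ler_pdivlMr// => sA.
have := ler_norm A; have := mulr_gt0 k0 t0; nra.
Unshelve. all: by end_near. Qed.

Let drift_cvg00 : k * t / Num.sqrt t @[t --> (0:R)^'+] --> (0 : R).
Proof.
have -> : (fun t => k * t / Num.sqrt t) = (fun t => k * Num.sqrt t).
  apply/funext => t; rewrite -mulrA; congr (_ * _).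
  have [t0|t0] := ltP 0 t; last by rewrite ler0_sqrtr// invr0 mulr0.
  rewrite -[X in X / _](@sqr_sqrtr _ t) ?ltW// expr2 mulrK//.
  by rewrite unitfE gt_eqF ?sqrtr_gt0.
have e : k * Num.sqrt 0 = 0 :> R by rewrite sqrtr0 mulr0.
apply: cvg_at_right_filter; rewrite -[X in _ --> X]e.
by apply: cvgM; [exact: cvg_cst|exact: sqrt_continuous].
Qed.

Let bE : b = fun t => - ((k * t - (- z)) / Num.sqrt t).
Proof. by apply/funext => t; rewrite /b opprK mulNr. Qed.

Let F_cvgy : F t @[t --> +oo%R] --> (1 : R).
Proof.
have [cy cNy] := @std_cdf_cvg R.
rewrite -[X in _ --> X]subr0 -[X in _ --> _ - X](mulr0 (expR (2 * k * z))).
apply: cvgB.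
  by apply: (cvg_comp a (@std_cdf R)) cy; exact: drift_cvgy.
apply: cvgM; first exact: cvg_cst.
apply: (cvg_comp b (@std_cdf R)) cNy; rewrite bE.
by apply/cvgNry; rewrite opprK; exact: drift_cvgy.
Qed.

Let F_cvg0 : F t @[t --> (0:R)^'+] --> (1 - Num.min 1 (expR (2 * k * z)) : R).
Proof.
have [cy cNy] := @std_cdf_cvg R.
have [z0|z0|z0] := ltgtP z 0.
- rewrite min_r; last by rewrite -expR0 ler_expR pmulr_rle0 ?mulr_gt0// ltW.
  rewrite -[X in _ --> _ - X](mulr1 (expR (2 * k * z))).
  apply: cvgB; first by apply: (cvg_comp a (@std_cdf R)) cy; exact: drift_cvg0'.
  apply: cvgM; first exact: cvg_cst.
  apply: (cvg_comp b (@std_cdf R)) cy; rewrite bE.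
  by apply/cvgNrNy; rewrite opprK; apply: drift_cvg0; rewrite oppr_gt0.
- rewrite min_l; last by rewrite -expR0 ler_expR mulr_ge0 ?mulr_ge0// ltW.
  rewrite subrr -[X in _ --> X]subr0 -[X in _ --> _ - X](mulr0 (expR (2 * k * z))).
  apply: cvgB; first by apply: (cvg_comp a (@std_cdf R)) cNy; exact: drift_cvg0.
  apply: cvgM; first exact: cvg_cst.
  apply: (cvg_comp b (@std_cdf R)) cNy; rewrite bE.
  by apply/cvgNry; rewrite opprK; apply: drift_cvg0'; rewrite oppr_lt0.
- rewrite z0 mulr0 expR0 minxx subrr -[X in _ --> X](subrr (std_cdf 0)).
  rewrite -[X in _ --> _ - X](mul1r (std_cdf 0)).
  rewrite /F z0 mulr0 expR0.
  apply: cvgB.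
    apply: (cvg_comp a (@std_cdf R)) (@continuous_std_cdf R 0).
    rewrite /a z0; under eq_fun do rewrite subr0.
    exact: drift_cvg00.
  apply: cvgM; first exact: cvg_cst.
  apply: (cvg_comp b (@std_cdf R)) (@continuous_std_cdf R 0).
  rewrite bE z0 oppr0; under eq_fun do rewrite subr0.
  by have h := cvgN drift_cvg00; rewrite oppr0 in h; apply: h.
Qed.

(** As a function of the time [t], the density at [z] of a Gaussian variable of
mean [k t] and variance [t] has the explicit primitive [k^-1 * F]; its limits at
[0] and at infinity give the integral. *)
Lemma green_integral :
  (\int[mu]_(t in `[0%R, +oo[) (normal_pdf (k * t) (Num.sqrt t) z)%:E =
   (k^-1 * Num.min 1 (expR (2 * k * z)))%:E)%E.
Proof.
have pE (t : R) : 0 < t -> normal_pdf (k * t) (Num.sqrt t) z = k^-1 * f t.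
  move=> t0; rewrite normal_pdf_sqrt// /f mulrA mulVf ?gt_eqF// mul1r !npdfE.
  have -> : (z - k * t) / Num.sqrt t = - a t by rewrite /a -[in RHS]mulNr opprB.
  by rewrite sqrrN.
have cf (t : R) : 0 < t -> {for t, continuous f}.
  move=> t0; rewrite /f /a; have st : Num.sqrt t != 0 by rewrite gt_eqF ?sqrtr_gt0.
  have ci : {for t, continuous (fun s : R => (Num.sqrt s)^-1)}.
    by apply: cvgV => //; exact: sqrt_continuous.
  apply: cvgM; first exact: cvg_cst.
  apply: cvgM; first exact: ci.
  apply: (cvg_comp _ npdf); last by apply: continuous_normal_pdf; rewrite oner_eq0.
  apply: cvgM; last exact: ci.
  by apply: cvgB; [apply: cvgM; [exact: cvg_cst|exact: cvg_id]|exact: cvg_cst].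
have mf : measurable_fun `](0 : R)%R, +oo[ f.
  by apply: open_continuous_measurable_fun => // t; rewrite inE/= in_itv/= andbT => /cf.
have f0 (t : R) : 0 < t -> 0 <= f t.
  move=> t0; rewrite /f mulr_ge0 ?(ltW k0)// mulr_ge0 ?invr_ge0 ?sqrtr_ge0//.
  exact: normal_pdf_ge0.
have ftc (e : R) : 0 < e ->
    (\int[mu]_(t in `[e, +oo[) (f t)%:E = 1%:E - (F e)%:E)%E.
  move=> e0; apply: ge0_continuous_FTC2y.
  - by move=> t et; apply: f0; exact: lt_le_trans et.
  - apply: continuous_in_subspaceT => t; rewrite inE/= in_itv/= andbT => et.
    by apply: cf; exact: lt_le_trans et.
  - exact: F_cvgy.
  - by move=> t et; have [] := is_derive_F (lt_trans e0 et).
  - apply: cvg_at_right_filter; apply: differentiable_continuous.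
    by apply/derivable1_diffP; have [] := is_derive_F e0.
  - move=> t; rewrite in_itv/= andbT => et; rewrite derive1E.
    exact: (@derive_val _ _ _ _ _ _ _ (is_derive_F (lt_trans e0 et))).
rewrite -integral_itv_obnd_cbnd; last first.
  apply/measurable_EFinP; apply: eq_measurable_fun (_ : measurable_fun _ (fun t => k^-1 * f t)).
    by move=> t; rewrite inE/= in_itv/= andbT => t0; rewrite pE.
  by apply: measurable_funM.
transitivity (\int[mu]_(t in `](0 : R)%R, +oo[) ((k^-1)%:E * (f t)%:E))%E.
  by apply: eq_integral => t; rewrite inE/= in_itv/= andbT => t0; rewrite pE.
rewrite ge0_integralZl//; last 3 first.
- exact/measurable_EFinP.
- by move=> t/=; rewrite in_itv/= andbT lee_fin => /f0.
- by rewrite lee_fin invr_ge0 ltW.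
rewrite EFinM; congr (_ * _)%E.
have UE : `](0 : R)%R, +oo[%classic = \bigcup_n `[(n.+1%:R^-1 : R)%R, +oo[%classic.
  apply/seteqP; split => t/=; last first.
    by move=> [n _]/=; rewrite !in_itv/= !andbT; apply: lt_le_trans.
  rewrite in_itv/= andbT => t0; exists (Num.truncn t^-1) => //=.
  rewrite in_itv/= andbT -[leRHS]invrK lef_pV2 ?posrE ?invr_gt0//.
  by apply/ltW; exact: truncnS_gt.
have cI : (fun n => \int[mu]_(t in `[(n.+1%:R^-1 : R)%R, +oo[) (f t)%:E)%E @ \oo -->
    (\int[mu]_(t in `](0 : R)%R, +oo[) (f t)%:E)%E.
  rewrite UE; apply: ge0_nondecreasing_set_cvg_integral => //.
  - by move=> m n mn; apply/subsetPset; apply: subset_itvr; rewrite bnd_simp lef_pV2 ?posrE// ler_nat.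
  - move=> n; apply/measurable_EFinP; apply: measurable_funS mf => //.
    by apply: subset_itvr; rewrite bnd_simp invr_gt0.
  - by move=> n t/=; rewrite in_itv/= andbT lee_fin => /(lt_le_trans _) nt; apply: f0; apply: nt.
apply/esym/(cvg_unique _ _ cI) => //.
have -> : (fun n => \int[mu]_(t in `[(n.+1%:R^-1 : R)%R, +oo[) (f t)%:E)%E =
   EFin \o (fun n => 1 - F (n.+1%:R^-1)).
  by apply/funext => n /=; rewrite ftc// EFinB.
apply: cvg_EFin; first exact: nearW.
rewrite -[X in _ --> X](subKr 1); apply: cvgB; first exact: cvg_cst.
move/cvg_at_rightP : F_cvg0; apply; split => //.
exact: cvg_harmonic.
Qed.

End GreenIntegral.

(** * Joint measurability of continuous processes *)

Section TonelliOn.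
Local Open Scope ereal_scope.
Context d1 d2 (T1 : measurableType d1) (T2 : measurableType d2) (R : realType).
Variables (m1 : {sigma_finite_measure set T1 -> \bar R})
          (m2 : {sigma_finite_measure set T2 -> \bar R}).
Variables (D : set T1) (mD : measurable D) (f : T1 * T2 -> \bar R).
Hypotheses (mf : measurable_fun [set: T1 * T2] f) (f0 : forall x, 0 <= f x).

Let g := f \_ (D `*` setT).

Let mg : measurable_fun [set: T1 * T2] g.
Proof.
apply/(measurable_restrictT f); first exact: measurableX.
exact: measurable_funS mf.
Qed.

Let g0 x : 0 <= g x.
Proof. by rewrite /g patchE; case: ifP. Qed.

Let gE x y : x \in D -> g (x, y) = f (x, y).
Proof. by move=> xD; rewrite /g patchE/= ifT// inE; split => //=; exact: set_mem. Qed.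

Let gE0 x y : x \notin D -> g (x, y) = 0.
Proof.
move=> xD; rewrite /g patchE ifF//; apply/negbTE; apply: contra xD.
by rewrite !inE => -[].
Qed.

Let inner2 x : \int[m2]_y g (x, y) = ((fun x => \int[m2]_y f (x, y)) \_ D) x.
Proof.
rewrite patchE; case: ifPn => xD.
  by apply: eq_integral => y _; rewrite gE.
by rewrite integral0_eq// => y _; rewrite gE0.
Qed.

Let inner1 y : \int[m1]_x g (x, y) = \int[m1]_(x in D) f (x, y).
Proof.
rewrite [RHS]integral_mkcond; apply: eq_integral => x _; rewrite patchE.
by case: ifPn => xD; [rewrite gE|rewrite gE0].
Qed.

Lemma tonelli_on :
  \int[m1]_(x in D) \int[m2]_y f (x, y) = \int[m2]_y \int[m1]_(x in D) f (x, y).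
Proof.
rewrite [LHS]integral_mkcond -[RHS](eq_integral _ _ (fun y _ => inner1 y)).
rewrite -(fubini_tonelli (m1 := m1) (m2 := m2) g)//.
by apply: eq_integral => x _; rewrite inner2.
Qed.

Lemma measurable_tonelli_on1 : measurable_fun D (fun x => \int[m2]_y f (x, y)).
Proof.
apply/(measurable_restrictT _ mD).
rewrite (_ : _ \_ D = fubini_F m2 g); first exact: measurable_fun_fubini_tonelli_F.
by apply/funext => x; rewrite -inner2.
Qed.

Lemma measurable_tonelli_on2 : measurable_fun setT (fun y => \int[m1]_(x in D) f (x, y)).
Proof.
rewrite (_ : (fun y => _) = fubini_G m1 g); first exact: measurable_fun_fubini_tonelli_G.
by apply/funext => y; rewrite -inner1.
Qed.

End TonelliOn.

Section DyadicFloor.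
Variable R : realType.

Definition dyadic_floor (n : nat) (t : R) : R := (Num.truncn (t * 2 ^+ n))%:R / 2 ^+ n.

Lemma dyadic_floor_ge0 n t : 0 <= dyadic_floor n t.
Proof. by rewrite divr_ge0// exprn_ge0. Qed.

Lemma dyadic_floor_le n t : 0 <= t -> dyadic_floor n t <= t.
Proof.
move=> t0; rewrite ler_pdivrMr ?exprn_gt0//.
by rewrite truncn_le// mulr_ge0// exprn_ge0.
Qed.

Lemma dyadic_floor_gt n t : t < dyadic_floor n t + 2 ^- n.
Proof.
rewrite -[X in _ + X]mul1r -mulrDl ltr_pdivlMr ?exprn_gt0// natr1.
exact: truncnS_gt.
Qed.

Lemma cvg_inv_pow2 : (fun n => 2 ^- n : R) @ \oo --> (0 : R).
Proof.
have := @cvg_expr R 2^-1; rewrite ger0_norm ?invr_ge0// invf_lt1// ltr1n => /(_ isT).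
by apply: cvg_trans; apply: near_eq_cvg; apply: nearW => n; rewrite exprVn.
Qed.

Lemma cvg_dyadic_floor t : dyadic_floor n t @[n --> \oo] --> Num.max 0 t.
Proof.
have [t0|t0] := leP 0 t.
  apply: (@squeeze_cvgr _ _ _ _ (fun n => t - 2 ^- n) (fun=> t)).
  - apply: nearW => n; rewrite dyadic_floor_le// andbT.
    by rewrite lerBlDr ltW// dyadic_floor_gt.
  - by rewrite -[X in _ --> X]subr0; apply: cvgB; [exact: cvg_cst|exact: cvg_inv_pow2].
  - exact: cvg_cst.
rewrite (_ : (fun n => _) = cst 0); first exact: cvg_cst.
apply/funext => n; rewrite /dyadic_floor (_ : Num.truncn _ = 0%N) ?mul0r//.
apply/truncn0Pn; rewrite -ltNge (lt_trans _ ltr01)//.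
by rewrite pmulr_llt0// exprn_gt0.
Qed.

Lemma continuous_on_time_cvg (f : R -> R) (u : nat -> R) (t : R) :
  continuous_on_time f -> (forall n, 0 <= u n) -> 0 <= t ->
  u @ \oo --> t -> f (u n) @[n --> \oo] --> f t.
Proof.
move=> cf u0 t0 ut.
have /subspace_continuousP h := cf.
have tA : `[(0 : R), +oo[%classic t by rewrite /= in_itv/= t0.
apply: (cvg_comp u f) (h t tA).
move=> B /= /ut [N _ NB]; exists N => // n Nn; apply: NB => //=.
by rewrite in_itv/= u0.
Qed.

End DyadicFloor.

Section JointMeasurability.
Context (R : realType) d (T : measurableType d).
Variable V : R -> T -> R.
Hypotheses (mV : forall t, measurable_fun [set: T] (V t))
  (cV : forall w, continuous_on_time (V^~ w)).

(** A path continuous at nonnegative times is the limit of its samples along the dyadic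
approximations of the time, which are jointly measurable because they involve
countably many times. The maximum with [0] makes the statement hold on the whole
line although nothing is known at negative times. *)
Lemma measurable_fun_process :
  measurable_fun [set: R * T] (fun p : R * T => V (Num.max 0 p.1) p.2).
Proof.
pose h n (p : R * T) := V (dyadic_floor n p.1) p.2.
apply: (@measurable_fun_cvg _ _ _ _ h) => //; last first.
  move=> p _; apply: (@continuous_on_time_cvg _ (V^~ p.2)) => //.
  - by move=> n; exact: dyadic_floor_ge0.
  - by rewrite le_max lexx.
  - exact: cvg_dyadic_floor.
move=> n _ B mB; rewrite setTI.
have -> : h n @^-1` B = \bigcup_k
    (((fun t => Num.truncn (t * 2 ^+ n)) @^-1` [set k]) `*`
     (V (k%:R / 2 ^+ n) @^-1` B)).
  apply/seteqP; split => [[t w] /= hB|[t w] /= [k _ [/= <-]]]//.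
  by exists (Num.truncn (t * 2 ^+ n)).
apply: bigcupT_measurable => k; apply: measurableX.
  have c0 : (0 : R) < 2 ^+ n by rewrite exprn_gt0.
  have [->|k0] := posnP k.
    rewrite (_ : _ @^-1` _ = `]-oo, (1 / 2 ^+ n : R)[%classic)//.
    apply/seteqP; split => t /=; rewrite in_itv/= ltr_pdivlMr// -(truncn_le_nat _ 0) leqn0.
      by move=> ->.
    by move/eqP.
  rewrite (_ : _ @^-1` _ = `[(k%:R / 2 ^+ n : R), (k.+1%:R / 2 ^+ n : R)[%classic)//.
  apply/seteqP; split => t /=; rewrite in_itv/= ltr_pdivlMr// ler_pdivrMr//
    -truncn_le_nat -[X in X%:R <= _](prednK k0) -truncn_gt_nat prednK// -eqn_leq.
    by move=> ->.
  by move/eqP.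
by rewrite -[X in measurable X]setTI; exact: mV.
Qed.

End JointMeasurability.

(** * The Markov property *)

Section BrownianIncrements.
Variables (R : realType) (W : process R).
Hypothesis hW : standard_brownian_motion W.
Local Notation P := (process_prob W).
Local Notation Omega := (process_space W).

Lemma brownian0 w : W 0 w = 0.
Proof. by have [] := hW. Qed.

Lemma brownian_continuous w : continuous_on_time (sample_path W w).
Proof. by have [] := hW. Qed.

Lemma measurable_increment (s t : R) : measurable_fun [set: Omega] (increment W s t).
Proof. by apply: measurable_funB => //; exact: measurable_funP. Qed.

Lemma brownian_law (t : R) (A : set R) : 0 < t -> measurable A ->
  P (W t @^-1` A) = normal_prob 0 (Num.sqrt t) A.
Proof.
move=> t0 mA; have [_ _ _ /(_ 0 t A (lexx _) t0 mA)] := hW; rewrite subr0 => <-.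
by congr (P _); apply/seteqP; split => w /=; rewrite /increment/= brownian0 subr0.
Qed.

Lemma stationary_increments (s t : R) (A : set R) : 0 <= s -> 0 <= t -> measurable A ->
  P (increment W s (s + t) @^-1` A) = P (W t @^-1` A).
Proof.
move=> s0; rewrite le_eqVlt => /predU1P[<-|t0] mA.
  congr (P _); apply/seteqP; split => w /=;
    by rewrite /increment/= addr0 subrr brownian0.
have st : s < s + t by rewrite ltrDl.
rewrite brownian_law//; have [_ _ _ g] := hW.
by rewrite (g _ _ _ s0 st mA) [X in Num.sqrt X]addrAC subrr add0r.
Qed.

Section Past.
Variables (t : nat -> R).
Hypotheses (t0 : t 0%N = 0) (tS : forall i, t i <= t i.+1).
Variable n : nat.

Let inc i := increment W (t i) (t i.+1).

Let t_ge0 i : 0 <= t i.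
Proof. by elim: i => [|i IH]; [rewrite t0|exact: le_trans (tS i)]. Qed.

(** A pi-system that generates the sigma-algebra of the path at the times
[t 0, ..., t n]. *)
Definition past_cylinders : set (set Omega) :=
  [set E | exists2 A : nat -> set R, (forall i, measurable (A i)) &
     E = \bigcap_(i in `I_n) (inc i @^-1` A i)].

Definition past := g_sigma_algebraType past_cylinders.

Let measurable_inc_preimage i (A : set R) : measurable A -> measurable (inc i @^-1` A).
Proof. by move=> mA; rewrite -[X in measurable X]setTI; exact: measurable_increment. Qed.

Let past_cylinders_measurable : past_cylinders `<=` measurable.
Proof.
move=> _ [A mA ->]; apply: fin_bigcap_measurable; first exact: finite_II.
by move=> i _; exact: measurable_inc_preimage.
Qed.

Let past_cylindersI : setI_closed past_cylinders.
Proof.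
move=> _ _ [A mA ->] [B mB ->]; exists (fun i => A i `&` B i).
  by move=> i; exact: measurableI.
by rewrite -bigcapI; apply: eq_bigcapr => i _; rewrite preimage_setI.
Qed.

Let past_cylindersT : past_cylinders setT.
Proof.
exists (fun=> setT) => //; rewrite bigcapT//.
Qed.

Lemma past_measurable (E : set Omega) : <<s past_cylinders >> E -> measurable E.
Proof. by apply: smallest_sub => //; exact: sigma_algebra_measurable. Qed.

(** The product formula for increments says that it holds on cylinders, and two
finite measures that agree on a pi-system agree on the sigma-algebra it
generates. *)
Lemma past_independent (E : set Omega) (B : set R) :
  <<s past_cylinders >> E -> measurable B ->
  P (E `&` inc n @^-1` B) = (P E * P (inc n @^-1` B))%E.
Proof.
move=> GE mB; have mD := measurable_inc_preimage n mB.
have fD : P (inc n @^-1` B) \is a fin_num by exact: fin_num_measure.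
pose r : {nonneg R} := NngNum (fine_ge0 (measure_ge0 P (inc n @^-1` B))).
have rE : (r%:num)%:E = P (inc n @^-1` B) by rewrite /= fineK.
transitivity (mscale r P E); last by rewrite /mscale/= fineK// muleC.
apply: (@g_sigma_algebra_measure_unique _ R _ past_cylinders past_cylinders_measurable
  (fun=> setT) _ _ (mrestr P mD) (mscale r P)) => //.
- by rewrite bigcup_const.
- move=> _ [A mA ->]; rewrite -[X in _ = X]/((r%:num)%:E * P _)%E rE /mrestr.
  have [_ _ ind _] := hW.
  pose A' i := if i == n then B else A i.
  have mA' i : measurable (A' i) by rewrite /A'; case: ifP.
  have AE i : (i < n)%N -> A' i = A i by rewrite /A'; case: eqP => // ->; rewrite ltnn.
  have := ind n.+1 t A'; rewrite t0 => /(_ (lexx _) tS mA').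
  have -> : \bigcap_(i in `I_n.+1) (inc i @^-1` A' i) =
      \bigcap_(i in `I_n) (inc i @^-1` A i) `&` (inc n @^-1` B).
    rewrite IIS bigcap_setU bigcap_set1 {2}/A' eqxx; congr (_ `&` _).
    by apply: eq_bigcapr => i /= /AE ->.
  move=> indE; apply: (etrans indE).
  rewrite big_ord_recr/= {2}/A' eqxx muleC; congr (_ * _)%E.
  have := ind n t A; rewrite t0 => /(_ (lexx _) tS mA) ->.
  by apply: eq_bigr => i _; rewrite AE.
- by move=> k; rewrite /= /mrestr setTI ltey_eq fD.
Qed.

Lemma measurable_past_increment i : (i < n)%N ->
  measurable_fun [set: past] (inc i : past -> R).
Proof.
move=> ilt _ B mB; rewrite setTI; apply: sub_sigma_algebra.
exists (fun j => if j == i then B else setT); first by move=> j; case: ifP.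
apply/seteqP; split => [w wB j /= _|w /(_ i ilt)]/=; last by rewrite eqxx.
by case: ifPn => // /eqP ->.
Qed.

Lemma measurable_past_brownian i : (i <= n)%N ->
  measurable_fun [set: past] (W (t i) : past -> R).
Proof.
elim: i => [_|i IH ilt].
  rewrite (_ : (W (t 0) : past -> R) = cst 0); first exact: measurable_cst.
  by apply/funext => w; rewrite t0 brownian0.
rewrite (_ : (W (t i.+1) : past -> R) = (W (t i) : past -> R) \+ inc i)%R.
  apply: measurable_funD; first by apply: IH; exact: ltnW.
  exact: measurable_past_increment.
by apply/funext => w; rewrite /inc /increment/= addrC subrK.
Qed.

Local Open Scope ereal_scope.

(** The next increment can be replaced by an independent copy of Brownian motion
at time [t n.+1 - t n]: the joint law of the past and of this increment is a
product measure, and increments are stationary. *)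
Lemma past_integral (Phi : past * R -> \bar R) :
  measurable_fun [set: past * R] Phi -> (forall z, 0 <= Phi z) ->
  \int[P]_w Phi (w : past, inc n w) =
  \int[P]_w \int[P]_w' Phi (w : past, W (t n.+1 - t n)%R w').
Proof.
move=> mPhi Phi0.
have mid : measurable_fun [set: Omega] (idfun : Omega -> past).
  by move=> _ E mE; rewrite setTI; exact: past_measurable.
pose X : {mfun Omega >-> past} := HB.pack (idfun : Omega -> past)
  (isMeasurableFun.Build _ _ _ _ _ mid).
pose m1 := distribution P X.
pose m2 := distribution P (W (t n.+1 - t n)%R).
have mpair : measurable_fun [set: Omega] (fun w => (w : past, inc n w)).
  by apply: measurable_fun_pair; [exact: mid|exact: measurable_increment].
pose XD : {mfun Omega >-> (past * R)%type} := HB.pack (fun w => (w : past, inc n w))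
  (isMeasurableFun.Build _ _ _ _ _ mpair).
pose m' := distribution P XD.
have m'E (A : set (past * R)) : measurable A -> (m1 \x m2) A = m' A.
  apply: product_measure_unique => {A}A B mA mB.
  transitivity (P ((A : set Omega) `&` inc n @^-1` B)); first by [].
  rewrite past_independent//; congr (_ * _).
  have d0 : (0 <= t n.+1 - t n)%R by rewrite subr_ge0.
  have := stationary_increments (t_ge0 n) d0 mB; rewrite subrKC => e.
  exact: e.
transitivity (\int[m']_z Phi z).
  by rewrite ge0_integral_distribution.
transitivity (\int[m1 \x m2]_z Phi z).
  by apply: eq_measure_integral => A mA _; exact/esym/m'E.
rewrite fubini_tonelli1// ge0_integral_distribution//; last 2 first.
- exact: measurable_fun_fubini_tonelli_F.
- by move=> y; apply: integral_ge0.
apply: eq_integral => w _ /=; rewrite /fubini_F ge0_integral_distribution//.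
by apply: measurableT_comp => //; exact: measurable_pair1.
Qed.

End Past.

Section Markov.
Variable m : R.

Local Notation path x w s := (drifted_path m x W w s).

(** The transition semigroup of Brownian motion with drift [m]. *)
Definition heat (s : R) (psi : R -> R) (y : R) : R :=
  \int[P]_w psi (path y w s).

(** The class of test functions: it is stable under products and under the
semigroup, and every integral against a probability is finite. *)
Definition unit_valued (psi : R -> R) :=
  measurable_fun [set: R] psi /\ forall y, 0 <= psi y <= 1.

Lemma measurable_path x s : measurable_fun [set: Omega] (fun w => path x w s).
Proof.
apply: measurable_funD => //; apply: measurable_funD => //; exact: measurable_funP.
Qed.

Lemma measurable_unit_path psi x s : unit_valued psi ->
  measurable_fun [set: Omega] (fun w => psi (path x w s)).
Proof. by move=> [mpsi _]; apply: measurableT_comp => //; exact: measurable_path. Qed.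

Lemma unit_integral_bound d (T : measurableType d) (Q : probability T R) (g : T -> R) :
  measurable_fun setT g -> (forall y, 0 <= g y <= 1) ->
  (0 <= \int[Q]_w (g w)%:E <= 1)%E.
Proof.
move=> mg g01; apply/andP; split.
  by apply: integral_ge0 => w _; rewrite lee_fin; case/andP: (g01 w).
rewrite -(probability_setT Q) -[leRHS]mul1e -integral_cst//.
apply: ge0_le_integral => //.
- by move=> w _; rewrite lee_fin; case/andP: (g01 w).
- exact/measurable_EFinP.
- by move=> w _; rewrite lee_fin; case/andP: (g01 w).
Qed.

Lemma heatE s psi y : unit_valued psi ->
  (heat s psi y)%:E = (\int[P]_w (psi (path y w s))%:E)%E.
Proof.
move=> upsi; rewrite /heat /Rintegral fineK//.
have [_ psi01] := upsi.
have /andP[h0 h1] := @unit_integral_bound _ _ P _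
  (measurable_unit_path y s upsi) (fun w => psi01 _).
by rewrite ge0_fin_numE// (le_lt_trans h1)// ltry.
Qed.

Lemma unit_heat s psi : unit_valued psi -> unit_valued (heat s psi).
Proof.
move=> upsi; have [mpsi psi01] := upsi; split; last first.
  move=> y; rewrite -2!lee_fin heatE//.
  exact: (@unit_integral_bound _ _ P _ (measurable_unit_path y s upsi) (fun w => psi01 _)).
apply/measurable_EFinP; rewrite (_ : _ \o _ = fun y => (\int[P]_w (psi (path y w s))%:E)%E).
  apply: (measurable_fun_fubini_tonelli_F (m2 := P) (fun z : R * Omega => (psi (path z.1 z.2 s))%:E)).
    apply/measurable_EFinP; apply: measurableT_comp => //.
    apply: measurable_funD => //; apply: measurable_funD => //.
    by apply: measurableT_comp => //; exact: measurable_funP.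
  by move=> z; rewrite lee_fin; case/andP: (psi01 (path z.1 z.2 s)).
by apply/funext => y /=; rewrite heatE.
Qed.

Variables (t : nat -> R).
Hypotheses (t0 : t 0%N = 0) (tS : forall i, t i <= t i.+1).

(** The Markov property along the times [t]. A product of functions of the values
at these times is the general form of an event about the signs of the path at
finitely many times. *)
Lemma markov (x : R) (phi : nat -> R -> R) (psi : R -> R) (n : nat) :
  (forall i, unit_valued (phi i)) -> unit_valued psi ->
  (\int[P]_w ((\prod_(i < n.+1) phi i (path x w (t i))) * psi (path x w (t n.+1)))%:E =
   \int[P]_w ((\prod_(i < n.+1) phi i (path x w (t i))) *
     heat (t n.+1 - t n) psi (path x w (t n)))%:E)%E.
Proof.
move=> uphi upsi; have [mpsi psi01] := upsi.
pose Z (w : past t n) := \prod_(i < n.+1) phi i (path x w (t i)).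
pose D := t n.+1 - t n.
pose Phi (z : past t n * R) := (Z z.1 * psi (x + (W (t n) z.1 + m * t n) + (z.2 + m * D)))%:E.
have mY i : (i <= n)%N -> measurable_fun [set: past t n] (fun w : past t n => path x w (t i)).
  move=> ilen; apply: measurable_funD => //; apply: measurable_funD => //.
  exact: measurable_past_brownian.
have mZ : measurable_fun [set: past t n] Z.
  apply: measurable_prod => i _; apply: measurableT_comp; first by have [] := uphi i.
  by apply: mY; rewrite -ltnS.
have Z0 w : 0 <= Z w by apply: prodr_ge0 => i _; have [_ /(_ (path x w (t i)))/andP[]] := uphi i.
have mPhi : measurable_fun [set: past t n * R] Phi.
  apply/measurable_EFinP; apply: measurable_funM; first exact: measurableT_comp.
  apply: measurableT_comp => //; apply: measurable_funD.
    by apply: measurableT_comp (mY n (leqnn n)) _ => //.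
  by apply: measurable_funD => //; exact: measurable_snd.
have Phi0 z : (0 <= Phi z)%E.
  by rewrite lee_fin mulr_ge0//; case/andP: (psi01 (x + (W (t n) z.1 + m * t n) + (z.2 + m * D))).
transitivity (\int[P]_w Phi (w : past t n, increment W (t n) (t n.+1) w))%E.
  apply: eq_integral => w _; rewrite /Phi /Z; congr ((_ * psi _)%:E).
  by rewrite /drifted_path /increment /D/=; ring.
rewrite (past_integral t0 tS mPhi Phi0); apply: eq_integral => w _.
rewrite EFinM heatE// -ge0_integralZl//.
- by apply/measurable_EFinP; apply: measurable_unit_path.
- by move=> w' _; rewrite lee_fin; case/andP: (psi01 (path (path x w (t n)) w' (t n.+1 - t n))).
- exact: Z0.
Qed.

End Markov.

End BrownianIncrements.

(** * The resolvent of drifted Brownian motion *)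

Section NormalDensity.
Variable R : realType.
Local Notation mu := (@lebesgue_measure R).
Local Open Scope ereal_scope.

Lemma integral_normal_prob (a s : R) (f : R -> \bar R) :
  measurable_fun [set: R] f -> \int[normal_prob a s]_x `|f x| < +oo ->
  \int[normal_prob a s]_x f x = \int[mu]_x (f x * (normal_pdf a s x)%:E).
Proof.
move=> mf finf; have dom := normal_prob_dominates a s.
rewrite -(Radon_Nikodym_change_of_variables dom)//=; last first.
  by apply/integrableP; split.
apply: ae_eq_integral => //.
- exact: emeasurable_funM.
- apply: emeasurable_funM => //.
  apply/measurable_EFinP.
  exact: measurable_normal_pdf.
- apply: ae_eqe_mul2l => /=.
  rewrite Radon_NikodymE//=; case: cid => /= h [h1 h2 h3].
  apply: integral_ae_eq => //=.
  + apply/measurable_EFinP; exact: measurable_normal_pdf.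
  + by move=> E E01 mE; rewrite -h3.
Qed.

Local Close Scope ereal_scope.

Lemma measurable_inv_sqrt : measurable_fun [set: R] (fun t : R => (Num.sqrt t)^-1).
Proof.
rewrite (_ : (fun t => _) = (fun t : R => (Num.sqrt t)^-1) \_ `]0, +oo[).
  apply/(measurable_restrictT (fun t : R => (Num.sqrt t)^-1)) => //.
  apply: open_continuous_measurable_fun; first exact: interval_open.
  move=> t; rewrite inE/= in_itv/= andbT => t0; apply: cvgV; first by rewrite gt_eqF ?sqrtr_gt0.
  exact: sqrt_continuous.
apply/funext => t; rewrite patchE; case: ifPn => //.
rewrite notin_setE/= in_itv/= andbT => /negP; rewrite -leNgt => t0.
by rewrite ler0_sqrtr// invr0.
Qed.

End NormalDensity.

Section Resolvent.
Variables (R : realType) (W : process R).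
Hypothesis hW : standard_brownian_motion W.
Local Notation P := (process_prob W).
Local Notation Omega := (process_space W).
Local Notation mu := (@lebesgue_measure R).
Local Notation npdf := (normal_pdf (0 : R) 1).

Lemma heat_density (m t : R) (psi : R -> R) (y : R) : 0 < t -> unit_valued psi ->
  (heat W m t psi y)%:E =
  (\int[mu]_z (psi z * normal_pdf 0 (Num.sqrt t) (z - (y + m * t)))%:E)%E.
Proof.
move=> t0 upsi; have [mpsi psi01] := upsi; rewrite heatE//.
pose g d := (psi (d + (y + m * t)))%:E.
have mgs : measurable_fun [set: R] (fun d => psi (d + (y + m * t))).
  by apply: measurableT_comp => //; exact: measurable_funD.
have mg : measurable_fun [set: R] g by exact/measurable_EFinP.
have g0 d : (0 <= g d)%E by rewrite lee_fin; case/andP: (psi01 (d + (y + m * t))).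
transitivity (\int[P]_w g (W t w))%E.
  by apply: eq_integral => w _; rewrite /g /drifted_path addrCA.
have mW : measurable_fun [set: Omega] (W t : Omega -> measurableTypeR R).
  exact: (measurable_funP (W t)).
pose V : {mfun Omega >-> measurableTypeR R} := HB.pack (W t : Omega -> measurableTypeR R)
  (isMeasurableFun.Build _ _ _ _ _ mW).
have -> : (\int[P]_w g (W t w) = \int[distribution P V]_d g d)%E.
  by rewrite ge0_integral_distribution.
have lawE (A : set R) : measurable A -> distribution P V A = normal_prob 0 (Num.sqrt t) A.
  by move=> mA; exact: brownian_law.
transitivity (\int[normal_prob 0 (Num.sqrt t)]_d g d)%E.
  by apply: eq_measure_integral => A mA _; exact: lawE.
have fing : (\int[normal_prob 0 (Num.sqrt t)]_d `|g d| < +oo)%E.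
  under eq_integral do rewrite gee0_abs//.
  have /andP[_ h] := @unit_integral_bound R _ _ (normal_prob (0 : R) (Num.sqrt t))
    _ mgs (fun d => psi01 _).
  by rewrite (le_lt_trans h)// ltry.
rewrite (integral_normal_prob mg fing).
pose F z := (psi z * normal_pdf 0 (Num.sqrt t) (z - (y + m * t)))%:E.
have mF : measurable_fun [set: R] F.
  apply/measurable_EFinP; apply: measurable_funM => //.
  by apply: measurableT_comp; [exact: measurable_normal_pdf|exact: measurable_funB].
have F0 z : (0 <= F z)%E.
  by rewrite lee_fin mulr_ge0 ?normal_pdf_ge0//; case/andP: (psi01 z).
have mT : measurable [set: R] by [].
apply: etrans (@ge0_integral_shift R (y + m * t) setT F mT mF F0).
by apply: eq_integral => d _; rewrite /F addrK /g -EFinM.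
Qed.

(** The resolvent density [k^-1 * exp (m z - k |z|)] of Brownian motion with drift
[m], at the discount rate [(k ^+ 2 - m ^+ 2) / 2]. *)
Definition green (m k z : R) : R :=
  k^-1 * (expR ((m - k) * z) * Num.min 1 (expR (2 * k * z))).

Definition resolvent (m lam : R) (psi : R -> R) (y : R) : \bar R :=
  (\int[mu]_(t in `[0%R, +oo[) (expR (- lam * t) * heat W m t psi y)%:E)%E.

(** Discounting at rate [(k ^+ 2 - m ^+ 2) / 2] changes the drift from [m] to [k],
up to a factor that does not depend on the time. *)
Lemma kernel_girsanov (m k v t : R) : 0 < t ->
  expR (- ((k ^+ 2 - m ^+ 2) / 2) * t) * normal_pdf 0 (Num.sqrt t) (v - m * t) =
  expR ((m - k) * v) * normal_pdf (k * t) (Num.sqrt t) v.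
Proof.
move=> t0; rewrite !normal_pdf_sqrt// subr0 !npdfE.
rewrite (mulrCA (expR _)) (mulrCA (expR ((m - k) * v))); congr (_ * _).
rewrite (mulrCA (expR _)) (mulrCA (expR ((m - k) * v))); congr (_ * _).
rewrite -!expRD; congr expR; rewrite !expr_div_n sqr_sqrtr ?ltW//.
by field; rewrite gt_eqF.
Qed.

(** By [kernel_girsanov] the discounted kernel of drift [m] is, up to the factor
[expR ((m - k) * z)], the kernel of drift [k], whose integral over time is
[green_integral]. *)
Lemma resolventE (m k : R) (psi : R -> R) (y : R) : 0 < k -> unit_valued psi ->
  resolvent m ((k ^+ 2 - m ^+ 2) / 2) psi y =
  (\int[mu]_z (psi z * green m k (z - y))%:E)%E.
Proof.
move=> k0 upsi; have [mpsi psi01] := upsi; set lam := (k ^+ 2 - m ^+ 2) / 2.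
pose q (p : R * R) := (expR (- lam * p.1) * (psi p.2 *
  ((Num.sqrt p.1)^-1 * npdf ((p.2 - (y + m * p.1)) * (Num.sqrt p.1)^-1))))%:E.
have mi : measurable_fun [set: R * R] (fun p : R * R => (Num.sqrt p.1)^-1).
  exact: (measurableT_comp (@measurable_inv_sqrt R) measurable_fst).
have mq : measurable_fun [set: R * R] q.
  apply/measurable_EFinP; apply: measurable_funM.
    apply: measurableT_comp; first exact: measurable_expR.
    by apply: measurable_funM => //; exact: measurable_fst.
  apply: measurable_funM; first by apply: measurableT_comp => //; exact: measurable_snd.
  apply: measurable_funM => //; apply: measurableT_comp; first exact: measurable_normal_pdf.
  apply: measurable_funM => //; apply: measurable_funB; first exact: measurable_snd.
  by apply: measurable_funD => //; apply: measurable_funM => //; exact: measurable_fst.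
have q0 p : (0 <= q p)%E.
  rewrite lee_fin mulr_ge0 ?expR_ge0// mulr_ge0//; first by case/andP: (psi01 p.2).
  by rewrite mulr_ge0 ?invr_ge0 ?sqrtr_ge0// normal_pdf_ge0.
have tE (t : R) : 0 < t -> (expR (- lam * t) * heat W m t psi y)%:E = (\int[mu]_z q (t, z))%E.
  move=> t0; rewrite EFinM heat_density// -ge0_integralZl//; last 2 first.
  - apply/measurable_EFinP; apply: measurable_funM => //.
    by apply: measurableT_comp; [exact: measurable_normal_pdf|exact: measurable_funB].
  - by move=> z _; rewrite lee_fin mulr_ge0 ?normal_pdf_ge0//; case/andP: (psi01 z).
  by apply: eq_integral => z _; rewrite /q/= -EFinM normal_pdf_sqrt// subr0.
have mD : measurable `](0 : R), +oo[%classic by [].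
have mt : measurable_fun `](0 : R)%R, +oo[ (fun t : R => (expR (- lam * t) * heat W m t psi y)%:E).
  apply: eq_measurable_fun; last first.
    exact: (measurable_tonelli_on1 mu mD mq q0).
  by move=> t; rewrite inE/= in_itv/= andbT => /tE.
rewrite /resolvent -integral_itv_obnd_cbnd//.
transitivity (\int[mu]_(t in `](0 : R)%R, +oo[) \int[mu]_z q (t, z))%E.
  by apply: eq_integral => t; rewrite inE/= in_itv/= andbT => /tE.
rewrite (tonelli_on mu mu mD mq q0).
apply: eq_integral => z _.
have mp : measurable_fun `](0 : R)%R, +oo[ (fun t : R => (normal_pdf (k * t) (Num.sqrt t) (z - y))%:E).
  apply: eq_measurable_fun (_ : measurable_fun _ (fun t : R => ((Num.sqrt t)^-1 * npdf ((z - y - k * t) / Num.sqrt t))%:E)).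
    by move=> t; rewrite inE/= in_itv/= andbT => t0; rewrite [in RHS]normal_pdf_sqrt.
  apply: measurable_funTS; apply/measurable_EFinP; apply: measurable_funM; first exact: measurable_inv_sqrt.
  apply: measurableT_comp; first exact: measurable_normal_pdf.
  by apply: measurable_funM; [apply: measurable_funB => //; exact: measurable_funM|exact: measurable_inv_sqrt].
transitivity (\int[mu]_(t in `](0 : R)%R, +oo[) ((psi z * expR ((m - k) * (z - y)))%:E *
   (normal_pdf (k * t) (Num.sqrt t) (z - y))%:E))%E.
  apply: eq_integral => t; rewrite inE/= in_itv/= andbT => t0; rewrite /q/= -EFinM.
  congr (_%:E); have := kernel_girsanov m k (z - y) t0.
  rewrite -/lam normal_pdf_sqrt// subr0 mulrCA -mulrA opprD addrA => <-.
  by ring.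
rewrite ge0_integralZl//; last 2 first.
- by move=> t _; rewrite lee_fin normal_pdf_ge0.
- by rewrite lee_fin mulr_ge0 ?expR_ge0//; case/andP: (psi01 z).
rewrite integral_itv_obnd_cbnd// green_integral// -EFinM; congr (_%:E).
by rewrite /green; ring.
Qed.

End Resolvent.

(** * Sampling a continuous path along dyadic grids *)

Section GridPaths.
Variable R : realType.

Definition nonneg_ind (u : R) : R := (0 <= u)%R%:R.
Definition neg_ind (u : R) : R := (u < 0)%R%:R.

Lemma nonneg_ind01 u : 0 <= nonneg_ind u <= 1.
Proof. by rewrite /nonneg_ind; case: (0 <= u) => /=; rewrite lexx ler01. Qed.

Definition grid (n k : nat) : R := k%:R / 2 ^+ n.

Lemma grid_ge0 n k : 0 <= grid n k.
Proof. by rewrite divr_ge0// exprn_ge0. Qed.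

Lemma le_grid n i j : (i <= j)%N -> grid n i <= grid n j.
Proof. by move=> ij; rewrite ler_pM2r ?ler_nat// invr_gt0 exprn_gt0. Qed.

Lemma gridS n k : grid n k.+1 = grid n k + 2 ^- n.
Proof. by rewrite /grid -natr1 mulrDl mul1r. Qed.

Lemma grid_double n k : grid n.+1 (2 * k) = grid n k.
Proof. by rewrite /grid exprS natrM invfM mulrACA divff ?mul1r// pnatr_eq0. Qed.

Lemma prod_nonneg_ind N (u : nat -> R) :
  \prod_(i < N) nonneg_ind (u i) = (`[< forall i, (i < N)%N -> 0 <= u i >])%:R.
Proof.
elim: N => [|N IH]; first by rewrite big_ord0 asboolT.
rewrite big_ord_recr/= IH /nonneg_ind -natrM mulnb; congr (nat_of_bool _)%:R.
apply/andP/asboolP => [[/asboolP h uN] i|h].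
  by rewrite ltnS leq_eqVlt => /predU1P[->//|]; exact: h.
by split; [apply/asboolP => i iN; apply/h/ltnW|exact: h].
Qed.

(** Sampling along finer and finer grids decides whether a continuous path
stays nonnegative on a set [J] of times. *)
Lemma cvg_prod_nonneg_ind (J : set R) (y : R -> R) (M : nat -> nat)
    (tau : nat -> nat -> R) :
  continuous_on_time y -> J `<=` `[0, +oo[ ->
  (forall n i, (i < M n)%N -> J (tau n i)) ->
  (forall s, J s -> exists i : nat -> nat, (\forall n \near \oo, (i n < M n)%N) /\
      (forall n, 0 <= tau n (i n)) /\ tau n (i n) @[n --> \oo] --> s) ->
  \prod_(i < M n) nonneg_ind (y (tau n i)) @[n --> \oo] -->
    ((`[< forall s, J s -> 0 <= y s >])%:R : R).
Proof.
move=> cy J0 JM dense; under eq_fun => n do rewrite (prod_nonneg_ind (M n) (fun i => y (tau n i))).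
have [pos|/existsNP[s /not_implyP[Js /negP]]] := pselect (forall s, J s -> 0 <= y s).
  rewrite asboolT//; apply: cvg_near_cst; apply: nearW => n; rewrite asboolT//.
  by move=> i /JM /pos.
rewrite -ltNge => ys0; rewrite asboolF; last by move/(_ s Js); rewrite leNgt ys0.
have [i [iM [tau0 taus]]] := dense _ Js.
have s0 : 0 <= s by have := J0 _ Js; rewrite /= in_itv/= andbT.
have cys := continuous_on_time_cvg cy tau0 s0 taus.
have yneg : \forall n \near \oo, y (tau n (i n)) < 0.
  exact: (cvgr_lt (y s)).
apply: cvg_near_cst; near=> n; rewrite asboolF//.
move=> /(_ (i n)); have -> : (i n < M n)%N by near: n.
by move=> /(_ isT); rewrite leNgt; apply/negP/negPn; near: n.
Unshelve. all: by end_near. Qed.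

Lemma grid_truncn n s : grid n (Num.truncn (s * 2 ^+ n)) = dyadic_floor n s.
Proof. by []. Qed.

Lemma near_truncn_grid (s : R) : \forall n \near \oo,
  (Num.truncn (s * 2 ^+ n) < 4 ^ n)%N.
Proof.
near=> n; have p0 : (0 : R) < 2 ^+ n by rewrite exprn_gt0.
have [s0|s0] := leP 0 s; last first.
  suff -> : Num.truncn (s * 2 ^+ n) = 0%N by rewrite expn_gt0.
  by apply/truncn0Pn; rewrite -ltNge (lt_trans _ ltr01)// pmulr_llt0.
rewrite truncn_lt_nat; last by rewrite mulr_ge0// ltW.
rewrite natrX (_ : 4%:R = 2 * 2 :> R) -?natrM// natrM exprMn ltr_pM2r//.
have /lt_trans : s < (Num.truncn s).+1%:R by exact: truncnS_gt.
apply; rewrite -natrX ltr_nat.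
have h : ((Num.truncn s).+1 <= n)%N by near: n; exists (Num.truncn s).+1.
exact: leq_ltn_trans h (ltn_expl _ _).
Unshelve. all: by end_near. Qed.

Definition first_neg (y : R -> R) (n k : nat) : R :=
  (\prod_(i < k) nonneg_ind (y (grid n i))) * neg_ind (y (grid n k)).

(** Telescoping: a path that leaves the half-line along the grid has exactly one
first negative grid time. *)
Lemma sum_first_neg (y : R -> R) n N :
  \sum_(k < N) first_neg y n k = 1 - \prod_(i < N) nonneg_ind (y (grid n i)).
Proof.
elim: N => [|N IH]; first by rewrite big_ord0 big_ord0 subrr.
rewrite big_ord_recr/= IH [in RHS]big_ord_recr/= /first_neg /neg_ind /nonneg_ind ltNge.
by case: (0 <= y _); rewrite /= ?mulr0 ?mulr1 ?addr0 ?subr0 ?subrK.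
Qed.

Variable y : R -> R.
Hypotheses (cy : continuous_on_time y) (y0 : 0 <= y 0).

Lemma first_negP n k : first_neg y n k =
  (`[< (forall i, (i < k)%N -> 0 <= y (grid n i)) /\ y (grid n k) < 0 >])%:R.
Proof.
rewrite /first_neg (prod_nonneg_ind k (fun i => y (grid n i))) /neg_ind -natrM mulnb; congr (nat_of_bool _)%:R.
by apply/andP/asboolP => [[/asboolP]|[]] h1 h2; split=> //; exact/asboolP.
Qed.

Lemma first_neg_sum_none n N (a : nat -> R) :
  (forall k, (k < N)%N -> a k != 0 -> 0 <= y (grid n k)) ->
  \sum_(k < N) first_neg y n k * a k = 0.
Proof.
move=> h; apply: big1 => k _; have [->|ak] := eqVneq (a k) 0; first by rewrite mulr0.
by rewrite /first_neg /neg_ind ltNge h// mulr0 mul0r.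
Qed.

Lemma first_neg_sum n j : y (grid n j) < 0 ->
  exists2 k, [/\ (0 < k)%N, (k <= j)%N, y (grid n k) < 0 & 0 <= y (grid n k.-1)] &
    (forall k', y (grid n k') < 0 -> (k <= k')%N) /\
    forall (N : nat) (a : nat -> R), (k < N)%N ->
    \sum_(k < N) first_neg y n k * a k = a k.
Proof.
move=> yj; have ex : exists k, y (grid n k) < 0 by exists j.
have [k yk kmin] := ex_minnP ex.
have k0 : (0 < k)%N.
  by case: k yk kmin => // + _; rewrite /grid mul0r ltNge y0.
have pos i : (i < k)%N -> 0 <= y (grid n i).
  by move=> ik; rewrite leNgt; apply/negP => /kmin; rewrite leqNgt ik.
exists k; first by split=> //; [exact: kmin|apply: pos; rewrite prednK].
split => // N a kN; rewrite (bigD1 (Ordinal kN))//= big1 => [|i ik].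
  by rewrite addr0 first_negP asboolT ?mul1r.
rewrite first_negP asboolF ?mul0r// => -[pi yi].
have ki := kmin _ yi; have [ik'|ki'] := ltnP k i.
  by have := pi _ ik'; rewrite leNgt yk.
by move/negP: ik; apply; apply/eqP/val_inj => /=; apply/eqP; rewrite eqn_leq ki ki'.
Qed.

Lemma cvg_first_neg_until (t : R) : 0 <= t ->
  \sum_(k < 4 ^ n) first_neg y n k * (grid n k <= t)%R%:R @[n --> \oo] -->
    (1 - (`[< forall s, 0 <= s <= t -> 0 <= y s >])%:R : R).
Proof.
move=> t0.
have [pos|/existsNP[s /not_implyP[/andP[s0 st] /negP]]] :=
    pselect (forall s, 0 <= s <= t -> 0 <= y s).
  rewrite asboolT// subrr; apply: cvg_near_cst; apply: nearW => n.
  apply: (first_neg_sum_none (a := fun k => (grid n k <= t)%R%:R)) => k _.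
  rewrite pnatr_eq0 eqb0 negbK => kt; apply: pos; rewrite kt grid_ge0//.
rewrite -ltNge => ys0; rewrite asboolF ?subr0; last first.
  by move/(_ s); rewrite s0 st leNgt ys0 => /(_ isT).
apply: cvg_near_cst; near=> n.
have kN : (Num.truncn (s * 2 ^+ n) < 4 ^ n)%N.
  by near: n; exact: near_truncn_grid.
have yk : y (grid n (Num.truncn (s * 2 ^+ n))) < 0.
  near: n; apply: (cvgr_lt (y s)) => //; apply: continuous_on_time_cvg => //.
    by move=> n; exact: grid_ge0.
  under eq_fun do rewrite grid_truncn.
  by have := @cvg_dyadic_floor R s; rewrite max_r.
have [k [_ kj _ _] [_ sumE]] := first_neg_sum yk.
rewrite (sumE _ (fun k => (grid n k <= t)%R%:R)); last exact: leq_ltn_trans kN.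
rewrite (le_trans (le_grid n kj))// (le_trans _ st)//.
exact: dyadic_floor_le.
Unshelve. all: by end_near. Qed.

(** Summed against the indicators of the first negative grid time, a function
of the time and of the value there converges to its value at the hitting time of
the negative half-line, where the path vanishes by continuity. *)
Lemma cvg_first_neg_hit (lam : R) : exists theta : R, forall v : R -> R,
  {for 0, continuous v} ->
  \sum_(k < 4 ^ n) first_neg y n k * (expR (- lam * grid n k) * v (y (grid n k)))
    @[n --> \oo] --> theta * v 0.
Proof.
have [[n0 [j yj]]|none] := pselect (exists n k, y (grid n k) < 0); last first.
  exists 0 => v _; rewrite mul0r; apply: cvg_near_cst; apply: nearW => n.
  apply: (first_neg_sum_none (a := fun k => expR (- lam * grid n k) * v (y (grid n k)))).
  move=> k _ _; rewrite leNgt; apply/negP => yk; apply: none.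
  by exists n, k.
have jn n : exists j', grid (n0 + n) j' = grid n0 j.
  elim: n => [|n [j' IH]]; first by exists j; rewrite addn0.
  by exists (2 * j')%N; rewrite addnS grid_double.
(* [K n] is the first negative index of the grid of order [n0 + n]; the grids are
nested, hence these times decrease. *)
have /choice[K KP] : forall n, exists k,
    [/\ (0 < k)%N, grid (n0 + n) k <= grid n0 j, y (grid (n0 + n) k) < 0 &
      0 <= y (grid (n0 + n) k.-1)] /\
    ((forall k', y (grid (n0 + n) k') < 0 -> (k <= k')%N) /\
    forall (N : nat) (a : nat -> R), (k < N)%N ->
    \sum_(k < N) first_neg y (n0 + n) k * a k = a k).
  move=> n; have [j' jE] := jn n.
  have yj' : y (grid (n0 + n) j') < 0 by rewrite jE.
  have [k [k0 kj yk yk1] h] := first_neg_sum yj'.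
  by exists k; split => //; split => //; rewrite -jE; exact: le_grid.
pose a n := grid (n0 + n) (K n).
have a0 n : 0 <= a n by exact: grid_ge0.
have nia : nonincreasing_seq a.
  apply/nonincreasing_seqP => n; have [[_ _ yn _] _] := KP n.
  have [_ [Kmin _]] := KP n.+1.
  rewrite /a -(grid_double (n0 + n) (K n)) -addnS; apply: le_grid; apply: Kmin.
  by rewrite addnS grid_double.
have [tau atau] : exists tau : R, a n @[n --> \oo] --> tau.
  exists (limn a); apply: nonincreasing_is_cvgn => //.
  by exists 0 => _ [n _ <-].
have lim_ge0 (u : nat -> R) l : (forall n, 0 <= u n) -> u n @[n --> \oo] --> l -> 0 <= l.
  move=> u0 ul; rewrite -(cvg_lim _ ul)//; apply: limr_ge; last exact: nearW.
  by apply/cvg_ex; exists l.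
have tau0 : 0 <= tau by exact: lim_ge0 a0 atau.
have ya : y (a n) @[n --> \oo] --> y tau by exact: continuous_on_time_cvg.
(* The path is negative at [a n] and nonnegative one grid step before. *)
have yt0 : y tau = 0.
  apply/eqP; rewrite eq_le; apply/andP; split.
    rewrite -oppr_ge0; apply: (lim_ge0 (fun n => - y (a n))); last exact: cvgN.
    by move=> n; rewrite oppr_ge0; have [[_ _ /ltW]] := KP n.
  pose b n := grid (n0 + n) (K n).-1.
  have btau : b @ \oo --> tau.
    rewrite -[tau]subr0 (_ : b = fun n => a n - 2 ^- (n0 + n)).
      apply: cvgB => //; under eq_fun do rewrite addnC.
      have h := @cvg_inv_pow2 R; rewrite -(cvg_shiftn n0) in h; exact: h.
    apply/funext => n; have [[k0 _ _ _] _] := KP n.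
    by rewrite /a -[in RHS](prednK k0) gridS addrK.
  have yb : y (b n) @[n --> \oo] --> y tau.
    by apply: continuous_on_time_cvg => // n; exact: grid_ge0.
  by apply: lim_ge0 yb => n; have [[_ _ _]] := KP n.
(* The number [tau] is the hitting time of the negative half-line. *)
exists (expR (- lam * tau)) => v cv.
have -> : v 0 = v (y tau) by rewrite yt0.
have {}cv : {for y tau, continuous v} by rewrite yt0.
rewrite -(cvg_shiftn n0).
have lim : (expR (- lam * a n) * v (y (a n))) @[n --> \oo] --> expR (- lam * tau) * v (y tau).
  apply: cvgM; last exact: (cvg_comp _ _ ya cv).
  apply: (cvg_comp (fun n => - lam * a n) expR); last exact: continuous_expR.
  by apply: cvgM => //; exact: cvg_cst.
apply: cvg_trans lim; apply: near_eq_cvg; near=> n; rewrite /= (addnC n n0).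
have [_ [_ sumE]] := KP n.
rewrite (sumE _ (fun k => expR (- lam * grid (n0 + n) k) * v (y (grid (n0 + n) k))))//.
have [[_ kj _ _] _] := KP n.
have h : (Num.truncn (grid n0 j * 2 ^+ (n0 + n)) < 4 ^ (n0 + n))%N.
  near: n; have [N _ NP] := near_truncn_grid (grid n0 j).
  by exists N => // n /= Nn; apply: NP => /=; rewrite (leq_trans Nn)// leq_addl.
apply: leq_ltn_trans h; rewrite truncn_ge_nat; last by rewrite mulr_ge0 ?grid_ge0// exprn_ge0.
by rewrite -ler_pdivrMr// exprn_gt0.
Unshelve. all: by end_near. Qed.

End GridPaths.

(** * Survival *)

Section BoundedConvergence.
Context d (T : measurableType d) (R : realType) (P : probability T R).

Lemma cvg_bounded_integral (C : R) (g : nat -> T -> R) (l : T -> R) :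
  (forall n, measurable_fun [set: T] (g n)) ->
  (forall n w, 0 <= g n w <= C) ->
  (forall w, g n w @[n --> \oo] --> l w) ->
  (\int[P]_w (g n w)%:E @[n --> \oo] --> \int[P]_w (l w)%:E)%E.
Proof.
move=> mg g01 gl.
have ml : measurable_fun [set: T] l by exact: measurable_fun_cvg mg _.
have [] // := @dominated_convergence _ _ R P setT measurableT
  (fun n w => (g n w)%:E) (fun w => (l w)%:E) (cst C%:E).
- by move=> n; exact/measurable_EFinP.
- exact/measurable_EFinP.
- by apply/aeW => w _; apply: cvg_EFin; [exact: nearW|exact: gl].
- exact: finite_measure_integrable_cst.
- apply/aeW => w n _ /=; have /andP[g0 gC] := g01 n w.
  by rewrite lee_fin ger0_norm.
Qed.

End BoundedConvergence.

Section GridLimits.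
Variables (R : realType) (y : R -> R).
Hypothesis cy : continuous_on_time y.

Lemma cvg_stay_forever :
  \prod_(i < (4 ^ n).+1) nonneg_ind (y (grid R n i)) @[n --> \oo] -->
    ((`[< forall s, 0 <= s -> 0 <= y s >])%:R : R).
Proof.
have := @cvg_prod_nonneg_ind R `[0, +oo[ y (fun n => (4 ^ n).+1) (grid R) cy.
rewrite (_ : `[< _ >] = `[< forall s, 0 <= s -> 0 <= y s >]); last first.
  by apply/asboolP/asboolP => h s; have := h s; rewrite /= in_itv/= andbT.
apply=> // [n i _|s]; first by rewrite /= in_itv/= grid_ge0.
rewrite /= in_itv/= andbT => s0; exists (fun n => Num.truncn (s * 2 ^+ n)); split.
  have [N _ NP] := near_truncn_grid s; exists N => // n /NP /= h.
  by rewrite ltnS ltnW.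
split; first by move=> n; exact: grid_ge0.
by under eq_fun do rewrite grid_truncn; have := @cvg_dyadic_floor R s; rewrite max_r.
Qed.

Lemma cvg_first_neg_ever :
  \sum_(k < 4 ^ n) first_neg y n k @[n --> \oo] -->
    (1 - (`[< forall s, 0 <= s -> 0 <= y s >])%:R : R).
Proof.
under eq_fun do rewrite sum_first_neg.
apply: cvgB; first exact: cvg_cst.
have := @cvg_prod_nonneg_ind R `[0, +oo[ y (fun n => 4 ^ n)%N (grid R) cy.
rewrite (_ : `[< _ >] = `[< forall s, 0 <= s -> 0 <= y s >]); last first.
  by apply/asboolP/asboolP => h s; have := h s; rewrite /= in_itv/= andbT.
apply=> // [n i _|s]; first by rewrite /= in_itv/= grid_ge0.
rewrite /= in_itv/= andbT => s0; exists (fun n => Num.truncn (s * 2 ^+ n)); split.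
  exact: near_truncn_grid s.
split; first by move=> n; exact: grid_ge0.
by under eq_fun do rewrite grid_truncn; have := @cvg_dyadic_floor R s; rewrite max_r.
Qed.

Variable t : R.
Hypothesis t0 : 0 <= t.

Let past_index s n := Num.truncn (s / t * 2 ^+ n).

Let past_indexP s : 0 <= s <= t -> (forall n, (past_index s n < (2 ^ n).+1)%N) /\
  t * grid R n (past_index s n) @[n --> \oo] --> s.
Proof.
move=> /andP[s0 st]; have u0 : 0 <= s / t by rewrite divr_ge0.
have u1 : s / t <= 1.
  have [->|tn0] := eqVneq t 0; first by rewrite invr0 mulr0.
  by rewrite ler_pdivrMr ?mul1r// lt0r tn0.
split.
  move=> n; have := le_trans (dyadic_floor_le n u0) u1.
  rewrite /dyadic_floor ler_pdivrMr ?exprn_gt0// mul1r -[X in _ <= X -> _]natrX ler_nat => h.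
  rewrite ltnS; exact: h.
have sE : t * (s / t) = s.
  have [tz|tn0] := eqVneq t 0; last by rewrite mulrCA mulfV// mulr1.
  by rewrite tz mul0r; apply/eqP; rewrite eq_le s0 -tz st.
rewrite -[X in _ --> X]sE.
apply: cvgM; first exact: cvg_cst.
by have := @cvg_dyadic_floor R (s / t); rewrite max_r.
Qed.

Lemma cvg_stay_until :
  \prod_(i < (2 ^ n).+1) nonneg_ind (y (t * grid R n i)) @[n --> \oo] -->
    ((`[< forall s, 0 <= s <= t -> 0 <= y s >])%:R : R).
Proof.
have := @cvg_prod_nonneg_ind R `[0, t] y (fun n => (2 ^ n).+1) (fun n i => t * grid R n i) cy.
rewrite (_ : `[< _ >] = `[< forall s, 0 <= s <= t -> 0 <= y s >]); last first.
  by apply/asboolP/asboolP => h s; have := h s; rewrite /= in_itv.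
apply=> // [s|n i iN|s]; rewrite /= !in_itv/=.
- by case/andP => ->.
- rewrite mulr_ge0 ?grid_ge0//= ler_piMr// ler_pdivrMr ?exprn_gt0// mul1r -natrX ler_nat.
  by rewrite -ltnS.
- move=> /past_indexP[h1 h2]; exists (past_index s); split; first exact: nearW.
  by split=> // n; rewrite mulr_ge0// grid_ge0.
Qed.

(** A grid that contains the time [t] exactly, at the index [2 ^ n], is regular
after it, and becomes dense both before and after it. *)
Definition mixed_grid (t : R) (n i : nat) : R :=
  if (i <= 2 ^ n)%N then t * grid R n i else t + grid R n (i - 2 ^ n).

Lemma cvg_stay_mixed :
  \prod_(i < (2 ^ n + 4 ^ n).+1) nonneg_ind (y (mixed_grid t n i)) @[n --> \oo] -->
    ((`[< forall s, 0 <= s -> 0 <= y s >])%:R : R).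
Proof.
have mix0 n i : 0 <= mixed_grid t n i.
  by rewrite /mixed_grid; case: ifP => _; rewrite ?mulr_ge0 ?addr_ge0 ?grid_ge0.
have := @cvg_prod_nonneg_ind R `[0, +oo[ y (fun n => (2 ^ n + 4 ^ n).+1) (mixed_grid t) cy.
rewrite (_ : `[< _ >] = `[< forall s, 0 <= s -> 0 <= y s >]); last first.
  by apply/asboolP/asboolP => h s; have := h s; rewrite /= in_itv/= andbT.
apply=> // [n i _|s]; first by rewrite /= in_itv/= mix0.
rewrite /= in_itv/= andbT => s0; have [st|ts] := leP s t.
  have sst : 0 <= s <= t by rewrite s0 st.
  have [h1 h2] := past_indexP sst.
  exists (past_index s); split.
    apply: nearW => n; have := h1 n; rewrite !ltnS => /leq_trans; apply.
    exact: leq_addr.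
  split => //; rewrite (_ : (fun n => _) = fun n => t * grid R n (past_index s n))//.
  by apply/funext => n; rewrite /mixed_grid -ltnS h1.
pose j n := Num.truncn ((s - t) * 2 ^+ n).
exists (fun n => (2 ^ n + j n)%N); split.
  have [N _ NP] := near_truncn_grid (s - t); exists N => // n /NP /= h.
  by rewrite ltnS leq_add2l ltnW.
split => //; rewrite (_ : (fun n => _) = fun n => t + dyadic_floor n (s - t)).
  rewrite -[X in _ --> X](subrKC t); apply: cvgD; first exact: cvg_cst.
  by have := @cvg_dyadic_floor R (s - t); rewrite max_r// subr_ge0 ltW.
apply/funext => n; rewrite /mixed_grid -grid_truncn -/(j n) addKn.
case: ifPn => //; rewrite -[leqRHS]addn0 leq_add2l leqn0 => /eqP ->.
by rewrite addn0 /grid mul0r addr0 natrX divff ?mulr1// gt_eqF// exprn_gt0.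
Qed.

End GridLimits.

Section StrongMarkov.
Variables (R : realType) (W : process R).
Hypothesis hW : standard_brownian_motion W.
Local Notation P := (process_prob W).
Local Notation Omega := (process_space W).
Local Notation mu := (@lebesgue_measure R).
Variable m : R.

Local Notation path x w := (drifted_path m x W w).

Lemma continuous_path x w : continuous_on_time (path x w).
Proof.
have /subspace_continuousP h := @brownian_continuous _ _ hW w.
apply/subspace_continuousP => t tA; apply: cvgD; first exact: cvg_cst.
apply: cvgD; first exact: h.
by apply: cvg_within_filter; apply: cvgM; [exact: cvg_cst|exact: cvg_id].
Qed.

Lemma path0 x w : path x w 0 = x.
Proof. by rewrite /drifted_path brownian0// mulr0 !addr0. Qed.

Definition stay (x t : R) (w : Omega) : R :=
  (`[< forall s, 0 <= s <= t -> 0 <= path x w s >])%:R.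

Definition survive (x : R) (w : Omega) : R :=
  (`[< forall s, 0 <= s -> 0 <= path x w s >])%:R.

Lemma unit_nonneg_ind : unit_valued (@nonneg_ind R).
Proof.
split; last exact: nonneg_ind01.
rewrite (_ : @nonneg_ind R = \1_(`[(0 : R), +oo[%classic)); first exact: measurable_indic.
apply/funext => u; rewrite indicE /nonneg_ind; congr (nat_of_bool _)%:R.
by apply/idP/idP; rewrite inE/= in_itv/= andbT.
Qed.

Lemma unit_mul (f g : R -> R) : unit_valued f -> unit_valued g ->
  unit_valued (fun u => f u * g u).
Proof.
move=> [mf f01] [mg g01]; split; first exact: measurable_funM.
move=> u; have /andP[f0 f1] := f01 u; have /andP[g0 g1] := g01 u.
by rewrite mulr_ge0//= mulr_ile1.
Qed.

Lemma unit_cst1 : unit_valued (cst (1 : R)).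
Proof. by split => // u; rewrite ler01 lexx. Qed.

Lemma measurable_prod_nonneg x (N : nat) (tau : nat -> R) :
  measurable_fun [set: Omega] (fun w => \prod_(i < N) nonneg_ind (path x w (tau i))).
Proof. by apply: measurable_prod => i _; apply: measurable_unit_path; exact: unit_nonneg_ind. Qed.

Lemma prod_unit (N : nat) (u : nat -> R) : (forall i, 0 <= u i <= 1) ->
  0 <= \prod_(i < N) u i <= 1.
Proof.
move=> u01; apply/andP; split; first by apply: prodr_ge0 => i _; case/andP: (u01 i).
by apply: prodr_ile1 => i _.
Qed.

Lemma measurable_survive x : measurable_fun [set: Omega] (survive x).
Proof.
apply: (@measurable_fun_cvg _ _ _ _
  (fun n w => \prod_(i < (4 ^ n).+1) nonneg_ind (path x w (grid R n i)))).
  by move=> n; exact: (measurable_prod_nonneg x _ (fun i => grid R n i)).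
by move=> w _; exact: (cvg_stay_forever (@continuous_path x w)).
Qed.

Lemma measurable_stay x t : 0 <= t -> measurable_fun [set: Omega] (stay x t).
Proof.
move=> t0; apply: (@measurable_fun_cvg _ _ _ _
  (fun n w => \prod_(i < (2 ^ n).+1) nonneg_ind (path x w (t * grid R n i)))).
  by move=> n; exact: (measurable_prod_nonneg x _ (fun i => t * grid R n i)).
by move=> w _; exact: (cvg_stay_until (@continuous_path x w) t0).
Qed.

Lemma bool_unit (b : bool) : ((0 : R) <= b%:R) && (b%:R <= (1 : R)).
Proof. by case: b; rewrite /= lexx ler01. Qed.

Definition survival (x : R) : R := \int[P]_w survive x w.

Lemma survivalE x : (survival x)%:E = (\int[P]_w (survive x w)%:E)%E.
Proof.
rewrite /survival /Rintegral fineK//.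
have /andP[h0 h1] := @unit_integral_bound R _ _ P _ (measurable_survive x) (fun w => bool_unit _).
by rewrite ge0_fin_numE// (le_lt_trans h1)// ltry.
Qed.

Let survive_step (delta : R) (psi : R -> R) : R -> R :=
  heat W m delta (fun y => nonneg_ind y * psi y).

Let unit_iter k delta psi : unit_valued psi -> unit_valued (iter k (survive_step delta) psi).
Proof.
move=> upsi; elim: k => //= k IH; apply: unit_heat => //.
by apply: unit_mul => //; exact: unit_nonneg_ind.
Qed.

(** From the index [N] on, the times are equally spaced and the constraint is to
be nonnegative; integrating them out one after the other iterates one operator. *)
Lemma markov_iter (t : nat -> R) (N k : nat) (delta x : R) (phi : nat -> R -> R) (psi : R -> R) :
  t 0%N = 0 -> (forall i, t i <= t i.+1) ->
  (forall i, (N <= i)%N -> t i.+1 - t i = delta) ->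
  (forall i, unit_valued (phi i)) -> (forall i, (N < i)%N -> phi i = @nonneg_ind R) ->
  unit_valued psi ->
  (\int[P]_w ((\prod_(i < (N + k).+1) phi i (path x w (t i))) * psi (path x w (t (N + k)%N)))%:E =
   \int[P]_w ((\prod_(i < N.+1) phi i (path x w (t i))) *
     iter k (survive_step delta) psi (path x w (t N)))%:E)%E.
Proof.
move=> t0 tS td uphi phiE; elim: k psi => [|k IH] psi upsi; first by rewrite addn0.
rewrite iterSr -IH; last by apply: (@unit_iter 1).
rewrite addnS -(td (N + k)%N) ?leq_addr// -markov//; last first.
  by apply: unit_mul => //; exact: unit_nonneg_ind.
apply: eq_integral => w _; rewrite big_ord_recr/= phiE ?mulrA//.
by rewrite ltnS leq_addr.
Qed.

Lemma gridSB n i : grid R n i.+1 - grid R n i = 2 ^- n.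
Proof. by rewrite gridS addrAC subrr add0r. Qed.

Let survival_approx (n : nat) (y : R) : R :=
  nonneg_ind y * iter (4 ^ n) (survive_step (2 ^- n)) (cst 1) y.

Let unit_survival_approx n : unit_valued (survival_approx n).
Proof.
apply: unit_mul; first exact: unit_nonneg_ind.
by apply: unit_iter; exact: unit_cst1.
Qed.

Let cvg_survival_approx y : survival_approx n y @[n --> \oo] --> survival y.
Proof.
have E n : (survival_approx n y)%:E =
    (\int[P]_w (\prod_(i < (4 ^ n).+1) nonneg_ind (path y w (grid R n i)))%:E)%E.
  have g0 : grid R n 0 = 0 by rewrite /grid mul0r.
  have gS i : grid R n i <= grid R n i.+1 by exact: le_grid.
  have := @markov_iter (grid R n) 0 (4 ^ n) (2 ^- n) y (fun=> @nonneg_ind R) (cst 1) g0 gS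
    (fun i _ => gridSB n i) (fun=> unit_nonneg_ind) (fun _ _ => erefl) unit_cst1.
  rewrite add0n => h; apply/esym; apply: etrans (etrans h _).
    by apply: eq_integral => w _; rewrite mulr1.
  rewrite (eq_integral (cst (survival_approx n y)%:E)).
    by rewrite integral_cst// [X in (_ * X)%E](@probability_setT _ _ _ P) mule1.
  by move=> w _; rewrite big_ord1 g0 path0.
have := @cvg_bounded_integral _ _ R P 1
  (fun n w => \prod_(i < (4 ^ n).+1) nonneg_ind (path y w (grid R n i))) (survive y).
under eq_fun do rewrite -E.
rewrite -survivalE => /(_ _ _ _)/fine_cvgP[]//.
- by move=> n; exact: (measurable_prod_nonneg y _ (fun i => grid R n i)).
- move=> n w; apply: (prod_unit _ (u := fun i => nonneg_ind (path y w (grid R n i)))) => i.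
  exact: nonneg_ind01.
- by move=> w; exact: (cvg_stay_forever (@continuous_path y w)).
Qed.

Lemma unit_survival : unit_valued survival.
Proof.
split.
  apply: (@measurable_fun_cvg _ _ _ _ survival_approx); last by move=> y _; exact: cvg_survival_approx.
  by move=> n; have [] := unit_survival_approx n.
move=> y; rewrite -2!lee_fin survivalE.
exact: (@unit_integral_bound R _ _ P _ (measurable_survive y) (fun w => bool_unit _)).
Qed.

(** The Markov property at the time [t]: given a path that has stayed nonnegative
up to [t], it survives with the probability attached to its current position.
Both sides are limits of the same quantities along the grids [mixed_grid t n],
where [markov_iter] applies. *)
Lemma future_markov (x t : R) (f : R -> R) : 0 <= t -> unit_valued f ->
  (\int[P]_w (f (path x w t) * survive x w)%:E =
   \int[P]_w (f (path x w t) * survival (path x w t) * stay x t w)%:E)%E.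
Proof.
move=> t0 uf; have [mf f01] := uf.
pose prodN n w := \prod_(i < (2 ^ n).+1) nonneg_ind (path x w (t * grid R n i)).
have g1 n : grid R n (2 ^ n) = 1 by rewrite /grid natrX divff// gt_eqF// exprn_gt0.
have gt n : mixed_grid t n (2 ^ n) = t by rewrite /mixed_grid leqnn g1 mulr1.
have weight n M w : (2 ^ n < M)%N ->
    \prod_(i < M) (if i == (2 ^ n)%N :> nat then (fun u => nonneg_ind u * f u) else @nonneg_ind R)
      (path x w (mixed_grid t n i)) =
    (\prod_(i < M) nonneg_ind (path x w (mixed_grid t n i))) * f (path x w t).
  move=> nM; rewrite (bigD1 (Ordinal nM))//= eqxx [in RHS](bigD1 (Ordinal nM))//=.
  rewrite gt -!mulrA; congr (_ * _); rewrite mulrC; congr (_ * _).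
  by apply: eq_bigr => i /negbTE ine; rewrite ifF// -ine.
have E n : (\int[P]_w ((\prod_(i < (2 ^ n + 4 ^ n).+1) nonneg_ind (path x w (mixed_grid t n i))) *
       f (path x w t))%:E =
     \int[P]_w (f (path x w t) * survival_approx n (path x w t) * prodN n w)%:E)%E.
  pose phi i := if i == (2 ^ n)%N :> nat then (fun u => nonneg_ind u * f u) else @nonneg_ind R.
  have m0 : mixed_grid t n 0 = 0 by rewrite /mixed_grid leq0n /grid mul0r mulr0.
  have mdiff i : (2 ^ n <= i)%N -> mixed_grid t n i.+1 - mixed_grid t n i = 2 ^- n.
    rewrite leq_eqVlt => /predU1P[<-|ni].
      rewrite gt /mixed_grid ltnn subSnn /grid mul1r.
      by rewrite addrAC subrr add0r.
    have n1 : (i <= 2 ^ n)%N = false by rewrite leqNgt ni.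
    have n2 : (i < 2 ^ n)%N = false by rewrite ltnNge (ltnW ni).
    rewrite /mixed_grid n1 n2 subSn; last exact: ltnW.
    by rewrite opprD addrACA subrr add0r gridSB.
  have mS i : mixed_grid t n i <= mixed_grid t n i.+1.
    have [ni|ni] := leqP (2 ^ n)%N i.
      by rewrite -subr_ge0 mdiff// invr_ge0 exprn_ge0.
    by rewrite /mixed_grid ni (ltnW ni) ler_wpM2l// le_grid.
  have uphi i : unit_valued (phi i).
    by rewrite /phi; case: ifP => _; [apply: unit_mul => //|]; exact: unit_nonneg_ind.
  have phiE i : (2 ^ n < i)%N -> phi i = @nonneg_ind R.
    by rewrite /phi; case: eqP => // ->; rewrite ltnn.
  have := @markov_iter (mixed_grid t n) (2 ^ n) (4 ^ n) _ x _ _ m0 mS mdiff uphi phiE unit_cst1.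
  rewrite gt => h; apply: etrans (etrans h _).
    by apply: eq_integral => w _; rewrite mulr1 weight// ltnS leq_addr.
  apply: eq_integral => w _; rewrite weight// /survival_approx /prodN.
  congr (_%:E); rewrite big_ord_recr/= gt.
  rewrite [in RHS]big_ord_recr/= g1 mulr1 (eq_bigr (fun i : 'I_(2 ^ n) => nonneg_ind (path x w (t * grid R n i)))).
    by rewrite /nonneg_ind; case: (0 <= path x w t); rewrite /= ?mulr1 ?mul1r ?mulr0 ?mul0r//; ring.
  by move=> i _; rewrite /mixed_grid ltnW.
have lhs := @cvg_bounded_integral _ _ R P 1 (fun n w =>
   (\prod_(i < (2 ^ n + 4 ^ n).+1) nonneg_ind (path x w (mixed_grid t n i))) * f (path x w t))
   (fun w => f (path x w t) * survive x w).
have rhs := @cvg_bounded_integral _ _ R P 1 (fun n w =>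
   f (path x w t) * survival_approx n (path x w t) * prodN n w)
   (fun w => f (path x w t) * survival (path x w t) * stay x t w).
have mft : measurable_fun [set: Omega] (fun w => f (path x w t)) by exact: measurable_unit_path.
have L : ((\int[P]_w ((\prod_(i < (2 ^ n + 4 ^ n).+1) nonneg_ind (path x w (mixed_grid t n i))) *
    f (path x w t))%:E) @[n --> \oo] --> \int[P]_w (f (path x w t) * survive x w)%:E)%E.
  apply: lhs.
  - move=> n; apply: measurable_funM => //.
    exact: (measurable_prod_nonneg x _ (mixed_grid t n)).
  - move=> n w; have /andP[p0 p1] := prod_unit (2 ^ n + 4 ^ n).+1
      (fun i => nonneg_ind01 (path x w (mixed_grid t n i))).
    by have /andP[f0 f1] := f01 (path x w t); rewrite mulr_ge0//= mulr_ile1.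
  - move=> w; rewrite mulrC; apply: cvgM; last exact: cvg_cst.
    exact: (cvg_stay_mixed (@continuous_path x w) t0).
rewrite (_ : (fun n => _) = fun n => (\int[P]_w (f (path x w t) *
    survival_approx n (path x w t) * prodN n w)%:E)%E) in L; last by apply/funext => n; exact: E.
apply: (cvg_unique _ L) => //; apply: rhs.
- move=> n; apply: measurable_funM; last first.
    exact: (measurable_prod_nonneg x _ (fun i => t * grid R n i)).
  by apply: measurable_funM => //; exact: measurable_unit_path.
- move=> n w; have /andP[p0 p1] := prod_unit (2 ^ n).+1
    (fun i => nonneg_ind01 (path x w (t * grid R n i))).
  have /andP[f0 f1] := f01 (path x w t).
  have [_ /(_ (path x w t))/andP[s0 s1]] := unit_survival_approx n.
  have fs0 := mulr_ge0 f0 s0; have fs1 := mulr_ile1 f0 s0 f1 s1.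
  by rewrite mulr_ge0//= mulr_ile1.
- move=> w; apply: cvgM; last exact: (cvg_stay_until (@continuous_path x w) t0).
  by apply: cvgM; [exact: cvg_cst|exact: cvg_survival_approx].
Qed.

End StrongMarkov.

(** * The strong Markov property at the first negative time *)

Section Hitting.
Variables (R : realType) (W : process R).
Hypothesis hW : standard_brownian_motion W.
Local Notation P := (process_prob W).
Local Notation Omega := (process_space W).
Local Notation mu := (@lebesgue_measure R).
Local Notation times := (`[0%R, +oo[%classic : set R).
Variable m : R.

Local Notation path x w := (drifted_path m x W w).

Let clip (t : R) : R := Num.max 0 t.

Let clip_id t : times t -> clip t = t.
Proof. by rewrite /= in_itv/= andbT => t0; rewrite /clip max_r. Qed.

Let mtimes : measurable times.
Proof. exact: measurable_itv. Qed.

Lemma measurable_joint_path d (T : measurableType d) (a : T -> R) (b : T -> R) (c : T -> Omega) :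
  measurable_fun setT a -> measurable_fun setT b -> measurable_fun setT c ->
  measurable_fun [set: T] (fun z => path (a z) (c z) (clip (b z))).
Proof.
move=> ma mb mc; apply: measurable_funD => //; apply: measurable_funD.
  apply: (measurableT_comp (f := fun p : R * Omega => W (Num.max 0 p.1) p.2)
    (g := fun z => (b z, c z))); last exact: measurable_fun_pair.
  apply: (@measurable_fun_process R _ Omega (fun t w => W t w)).
    by move=> t; exact: measurable_funP.
  by move=> w; exact: (@brownian_continuous _ _ hW w).
apply: measurable_funM => //; apply: measurable_maxr => //.
Qed.

Lemma measurable_joint_heat (psi : R -> R) : unit_valued psi ->
  measurable_fun [set: R * R] (fun q : R * R => heat W m (clip q.1) psi q.2).
Proof.
move=> upsi; have [mpsi psi01] := upsi; apply/measurable_EFinP.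
rewrite (_ : _ \o _ = fun q : R * R => (\int[P]_w (psi (path q.2 w (clip q.1)))%:E)%E); last first.
  by apply/funext => q /=; rewrite heatE.
apply: (measurable_fun_fubini_tonelli_F
  (fun z : (R * R) * Omega => (psi (path z.1.2 z.2 (clip z.1.1)))%:E)).
  apply/measurable_EFinP; apply: measurableT_comp => //; apply: measurable_joint_path.
  - by apply: measurableT_comp; [exact: measurable_snd|exact: measurable_fst].
  - by apply: measurableT_comp; [exact: measurable_fst|exact: measurable_fst].
  - exact: measurable_snd.
by move=> z; rewrite lee_fin; case/andP: (psi01 (path z.1.2 z.2 (clip z.1.1))).
Qed.

Lemma heat_ge0 psi s y : unit_valued psi -> 0 <= heat W m s psi y.
Proof. by move=> /(unit_heat W m s)[_ /(_ y)/andP[]]. Qed.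

Lemma measurable_resolvent lam (psi : R -> R) : unit_valued psi ->
  measurable_fun [set: R] (resolvent W m lam psi).
Proof.
move=> upsi.
rewrite (_ : resolvent W m lam psi = fun y =>
    (\int[mu]_(t in times) (expR (- lam * t) * heat W m (clip t) psi y)%:E)%E); last first.
  by apply/funext => y; apply: eq_integral => t; rewrite inE => /clip_id ->.
apply: (measurable_tonelli_on2 mu mtimes
  (f := fun q : R * R => (expR (- lam * q.1) * heat W m (clip q.1) psi q.2)%:E)).
  apply/measurable_EFinP; apply: measurable_funM; last exact: measurable_joint_heat.
  apply: measurableT_comp; first exact: measurable_expR.
  by apply: measurable_funM => //; exact: measurable_fst.
by move=> q; rewrite lee_fin mulr_ge0 ?expR_ge0 ?heat_ge0.
Qed.

Lemma measurable_heat_time lam psi y : unit_valued psi ->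
  measurable_fun times (fun t => expR (- lam * t) * heat W m t psi y).
Proof.
move=> upsi; apply: (@eq_measurable_fun _ _ _ _ _ (fun t => expR (- lam * t) * heat W m (clip t) psi y)).
  by move=> t; rewrite inE => /clip_id ->.
apply: measurable_funTS; apply: measurable_funM.
  by apply: measurableT_comp; [exact: measurable_expR|exact: measurable_funM].
apply: (measurableT_comp (f := fun q : R * R => heat W m (clip q.1) psi q.2) (g := fun t => (t, y))).
  exact: measurable_joint_heat.
exact: measurable_fun_pair.
Qed.

Lemma resolvent_ge0 lam psi y : unit_valued psi -> (0 <= resolvent W m lam psi y)%E.
Proof.
by move=> upsi; apply: integral_ge0 => t _; rewrite lee_fin mulr_ge0 ?expR_ge0 ?heat_ge0.
Qed.

Lemma unit_neg_ind : unit_valued (@neg_ind R).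
Proof.
rewrite (_ : @neg_ind R = fun u => 1 - nonneg_ind u); last first.
  by apply/funext => u; rewrite /neg_ind /nonneg_ind ltNge; case: (0 <= u); rewrite /= ?subrr ?subr0.
have [mn n01] := unit_nonneg_ind R; split; first exact: measurable_funB.
by move=> u; have /andP[n0 n1] := n01 u; rewrite subr_ge0 n1 lerBlDr lerDl n0.
Qed.

Lemma measurable_first_neg x n k :
  measurable_fun [set: Omega] (fun w => first_neg (path x w) n k).
Proof.
apply: measurable_funM; first exact: (@measurable_prod_nonneg R W m x k (fun i => grid R n i)).
by apply: measurable_unit_path; exact: unit_neg_ind.
Qed.

Lemma first_neg01 (y : R -> R) n k : 0 <= first_neg y n k <= 1.
Proof.
rewrite /first_neg; have /andP[p0 p1] := prod_unit k (fun i => nonneg_ind01 (y (grid R n i))).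
have [_ /(_ (y (grid R n k)))/andP[n0 n1]] := unit_neg_ind.
by rewrite mulr_ge0//= mulr_ile1.
Qed.

Lemma markov_first_neg x n k t (psi : R -> R) : unit_valued psi -> grid R n k <= t ->
  (\int[P]_w (first_neg (path x w) n k * psi (path x w t))%:E =
   \int[P]_w (first_neg (path x w) n k *
     heat W m (t - grid R n k) psi (path x w (grid R n k)))%:E)%E.
Proof.
move=> upsi kt; pose tau i := if (i <= k)%N then grid R n i else t.
pose phi i := if (i < k)%N then @nonneg_ind R else @neg_ind R.
have tau0 : tau 0%N = 0 by rewrite /tau leq0n /grid mul0r.
have tauS i : tau i <= tau i.+1.
  rewrite /tau; case: (ltngtP i k) => ik; first by rewrite le_grid.
    by rewrite lexx.
  by rewrite ik.
have uphi i : unit_valued (phi i).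
  by rewrite /phi; case: ifP => _; [exact: unit_nonneg_ind|exact: unit_neg_ind].
have := markov hW m tau0 tauS x k uphi upsi.
have E w : \prod_(i < k.+1) phi i (path x w (tau i)) = first_neg (path x w) n k.
  rewrite big_ord_recr/= /first_neg /phi ltnn /tau leqnn; congr (_ * _).
  by apply: eq_bigr => i _; rewrite ltn_ord ltnW.
under eq_integral do rewrite E; under [in X in _ = X -> _]eq_integral do rewrite E.
by rewrite /tau leqnn ltnn.
Qed.

Section HitTerm.
Variables (x lam : R) (psi v : R -> R).
Hypotheses (upsi : unit_valued psi)
  (hv : forall y, resolvent W m lam psi y = (v y)%:E).

Let psi01 : forall y, 0 <= psi y <= 1. Proof. by have [] := upsi. Qed.

(** On the event that [grid R n k] is the first negative grid time, the discounted
occupation after this time is the resolvent at the position reached. *)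
Lemma resolvent_first_neg n k :
  (\int[mu]_(t in times) \int[P]_w ((grid R n k <= t)%R%:R *
     (expR (- lam * t) * (first_neg (path x w) n k * psi (path x w t))))%:E =
   \int[P]_w (first_neg (path x w) n k *
     (expR (- lam * grid R n k) * v (path x w (grid R n k))))%:E)%E.
Proof.
set a := grid R n k.
pose g (q : R * Omega) := (expR (- lam * (q.1 + a)) *
   (first_neg (path x q.2) n k * heat W m (clip q.1) psi (path x q.2 a)))%:E.
have mg : measurable_fun [set: R * Omega] g.
  apply/measurable_EFinP; apply: measurable_funM.
    apply: measurableT_comp; first exact: measurable_expR.
    by apply: measurable_funM => //; apply: measurable_funD => //; exact: measurable_fst.
  apply: measurable_funM.
    by apply: measurableT_comp (measurable_first_neg x n k) _; exact: measurable_snd.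
  apply: (measurableT_comp (f := fun q : R * R => heat W m (clip q.1) psi q.2)
    (g := fun q : R * Omega => (q.1, path x q.2 a))); first exact: measurable_joint_heat.
  apply: measurable_fun_pair; first exact: measurable_fst.
  by apply: (measurableT_comp (f := fun w => path x w a) (g := snd)); [exact: measurable_path|exact: measurable_snd].
have g0 q : (0 <= g q)%E.
  rewrite lee_fin mulr_ge0 ?expR_ge0// mulr_ge0 ?heat_ge0//.
  by case/andP: (first_neg01 (path x q.2) n k).
pose G s := (\int[P]_w g (s, w))%E.
have mG : measurable_fun [set: R] G by exact: measurable_fun_fubini_tonelli_F.
have G0 s : (0 <= G s)%E by exact: integral_ge0.
transitivity (\int[mu]_(t in [set t : R | times (t + - a)%R]) G (t + - a)%R)%E.
  rewrite integral_mkcond [RHS]integral_mkcond; apply: eq_integral => t _.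
  rewrite !patchE; have a0 : 0 <= a by exact: grid_ge0.
  have [at_|ta] := leP a t; last first.
    rewrite [in RHS]ifF; last first.
      by apply/negbTE; rewrite notin_setE/= in_itv/= andbT subr_ge0 leNgt ta.
    by case: ifP => // _; under eq_integral do rewrite mul0r; rewrite integral0.
  rewrite ifT; last by rewrite inE/= in_itv/= andbT (le_trans a0).
  rewrite ifT; last by rewrite inE/= in_itv/= andbT subr_ge0.
  rewrite /G /g /=; under [RHS]eq_integral => w _.
    rewrite subrK /clip max_r ?subr_ge0// EFinM; over.
  rewrite [RHS]ge0_integralZl//; last 2 first.
  - apply/measurable_EFinP; apply: measurable_funM; first exact: measurable_first_neg.
    by apply: measurable_unit_path; exact: unit_heat.
  - move=> w _; rewrite lee_fin mulr_ge0 ?heat_ge0//.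
    by case/andP: (first_neg01 (path x w) n k).
  rewrite -markov_first_neg// -ge0_integralZl//.
  - by apply: eq_integral => w _; rewrite mul1r -EFinM.
  - apply/measurable_EFinP; apply: measurable_funM; first exact: measurable_first_neg.
    exact: measurable_unit_path.
  - move=> w _; rewrite lee_fin mulr_ge0//; last by case/andP: (psi01 (path x w t)).
    by case/andP: (first_neg01 (path x w) n k).
rewrite (ge0_integral_shift (- a) mtimes mG G0) (tonelli_on mu P mtimes mg g0).
apply: eq_integral => w _.
transitivity (\int[mu]_(s in times) ((first_neg (path x w) n k * expR (- lam * a))%:E *
    (expR (- lam * s) * heat W m s psi (path x w a))%:E))%E.
  apply: eq_integral => s; rewrite inE => /clip_id sc; rewrite /g /= sc -EFinM.
  by congr (_%:E); rewrite mulrDr expRD; ring.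
rewrite ge0_integralZl//.
- by rewrite -/(resolvent W m lam psi _) hv -EFinM; congr (_%:E); ring.
- by apply/measurable_EFinP; exact: measurable_heat_time.
- by move=> s _; rewrite lee_fin mulr_ge0 ?expR_ge0 ?heat_ge0.
- by rewrite lee_fin mulr_ge0 ?expR_ge0//; case/andP: (first_neg01 (path x w) n k).
Qed.

End HitTerm.

Lemma measurable_joint_first_neg x n k lam psi : unit_valued psi ->
  measurable_fun [set: R * Omega] (fun q : R * Omega => (grid R n k <= q.1)%R%:R *
    (expR (- lam * q.1) * (first_neg (path x q.2) n k * psi (path x q.2 (clip q.1))))).
Proof.
move=> upsi; apply: measurable_funM.
  rewrite (_ : (fun _ => _) = (fun t : R => (grid R n k <= t)%R%:R) \o (@fst R Omega))//.
  apply: measurableT_comp; last exact: measurable_fst.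
  rewrite (_ : (fun _ => _) = \1_(`[grid R n k, +oo[%classic : set R)); first exact: measurable_indic.
  apply/funext => t; rewrite indicE; congr (nat_of_bool _)%:R.
  by apply/idP/idP; rewrite inE/= in_itv/= andbT.
apply: measurable_funM.
  apply: measurableT_comp; first exact: measurable_expR.
  by apply: measurable_funM => //; exact: measurable_fst.
apply: measurable_funM.
  apply: (measurableT_comp (f := fun w => first_neg (path x w) n k) (g := snd)).
    exact: measurable_first_neg.
  exact: measurable_snd.
apply: measurableT_comp; first by have [] := upsi.
exact: measurable_joint_path.
Qed.

(** At the hitting time of the negative half-line the path vanishes, so that what
it accumulates afterwards is [v 0], the value of the resolvent at [0]. The variable
[theta] is [expR (- lam * T)] for this hitting time [T], and [0] if [T] is infinite;
the identity is the limit of [resolvent_first_neg] summed over the grid. *)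
Lemma hitting_resolvent (x lam : R) : 0 <= x -> 0 <= lam ->
  exists theta : Omega -> R, [/\ measurable_fun setT theta,
    forall w, 0 <= theta w <= 1,
    lam = 0 -> forall w, theta w = 1 - survive m x w &
    forall (psi v : R -> R) (C : R), unit_valued psi ->
      (forall y, resolvent W m lam psi y = (v y)%:E) -> {for 0, continuous v} ->
      (forall y, v y <= C) ->
      (\int[mu]_(t in times) \int[P]_w
         (expR (- lam * t) * (psi (path x w t) * (1 - stay m x t w)))%:E =
       (v 0)%:E * \int[P]_w (theta w)%:E)%E].
Proof.
move=> x0 lam0.
have cp w : continuous_on_time (path x w) by exact: (@continuous_path _ _ hW m x w).
have p0 w : 0 <= path x w 0 by rewrite (path0 hW).
have /choice[theta thetaP] := fun w => cvg_first_neg_hit (cp w) (p0 w) lam.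
pose S n w (a : nat -> R) := \sum_(k < 4 ^ n) first_neg (path x w) n k * a k.
have S01 n w a C : (forall k, 0 <= a k <= C) -> 0 <= S n w a <= C.
  move=> a0C; have C0 : 0 <= C by have /andP[h1 h2] := a0C 0%N; exact: le_trans h2.
  apply/andP; split.
    apply: sumr_ge0 => k _; rewrite mulr_ge0//; last by case/andP: (a0C k).
    by case/andP: (first_neg01 (path x w) n k).
  apply: (@le_trans _ _ ((\sum_(k < 4 ^ n) first_neg (path x w) n k) * C)).
    rewrite mulr_suml; apply: ler_sum => k _; apply: ler_wpM2l; last by case/andP: (a0C k).
    by case/andP: (first_neg01 (path x w) n k).
  rewrite sum_first_neg ler_piMl// lerBlDr lerDl; apply: prodr_ge0 => i _.
  by case/andP: (nonneg_ind01 (path x w (grid R n i))).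
have e01 t : 0 <= t -> 0 <= expR (- lam * t) <= 1.
  move=> t0; rewrite expR_ge0/= -expR0 ler_expR mulNr oppr_le0.
  exact: mulr_ge0.
have Slim w : S n w (fun k => expR (- lam * grid R n k)) @[n --> \oo] --> theta w.
  have c1 : {for 0, continuous (cst 1 : R -> R)} by exact: cst_continuous.
  have := thetaP w (cst 1) c1; rewrite mulr1.
  by apply: cvg_trans; apply: near_eq_cvg; apply: nearW => n; apply: eq_bigr => k _; rewrite mulr1.
have mS n a : measurable_fun [set: Omega] (fun w => S n w a).
  apply: measurable_sum => k; apply: measurable_funM => //; exact: measurable_first_neg.
have mtheta : measurable_fun setT theta.
  by apply: (@measurable_fun_cvg _ _ _ _ (fun n w => S n w (fun k => expR (- lam * grid R n k)))).
have theta01 w : 0 <= theta w <= 1.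
  have h n := S01 n w (fun k => expR (- lam * grid R n k)) 1 (fun k => e01 _ (grid_ge0 _ n k)).
  rewrite -(cvg_lim _ (Slim w))//.
  have cv : cvgn (fun n => S n w (fun k => expR (- lam * grid R n k))).
    by apply/cvg_ex; exists (theta w); exact: Slim.
  apply/andP; split; [apply: limr_ge => //|apply: limr_le => //];
    by apply: nearW => n; case/andP: (h n).
exists theta; split => //.
- move=> lamE w; apply: (cvg_unique _ (Slim w)) => //.
  apply: cvg_trans (cvg_first_neg_ever (cp w)); apply: near_eq_cvg; apply: nearW => n.
  by apply: eq_bigr => k _; rewrite lamE oppr0 mul0r expR0 mulr1.
move=> psi v C upsi hv cv vC; have [mpsi psi01] := upsi.
have v0 y : 0 <= v y by rewrite -lee_fin -hv resolvent_ge0.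
pose A n t w := S n w (fun k => (grid R n k <= t)%R%:R).
have A01 n t w : 0 <= A n t w <= 1 by apply: S01 => k; case: (_ <= t); rewrite /= lexx ler01.
pose I n := (\int[mu]_(t in times) \int[P]_w (expR (- lam * t) * (psi (path x w t) * A n t w))%:E)%E.
pose tm n k (q : R * Omega) := (grid R n k <= q.1)%R%:R *
    (expR (- lam * q.1) * (first_neg (path x q.2) n k * psi (path x q.2 (clip q.1)))).
have mtm n k : measurable_fun setT (tm n k) by exact: measurable_joint_first_neg.
have tm0 n k q : (0 <= (tm n k q)%:E)%E.
  rewrite lee_fin mulr_ge0// mulr_ge0 ?expR_ge0// mulr_ge0//; last by case/andP: (psi01 (path x q.2 (clip q.1))).
  by case/andP: (first_neg01 (path x q.2) n k).
have mtmE n k : measurable_fun setT (fun q => (tm n k q)%:E) by exact/measurable_EFinP.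
have innerE n t : times t ->
    (\int[P]_w (expR (- lam * t) * (psi (path x w t) * A n t w))%:E =
     \sum_(k < 4 ^ n) \int[P]_w (tm n k (t, w))%:E)%E.
  move=> tt; rewrite -ge0_integral_sum//; last first.
    by move=> k; apply: (measurableT_comp (f := fun q => (tm n k q)%:E)); [exact: mtmE|exact: measurable_pair1].
  apply: eq_integral => w _; rewrite sumEFin; congr (_%:E).
  rewrite /A /S !mulr_sumr; apply: eq_bigr => k _; rewrite /tm /= (clip_id tt).
  by ring.
have IE n : I n = (\int[P]_w (S n w (fun k => expR (- lam * grid R n k) * v (path x w (grid R n k))))%:E)%E.
  transitivity (\sum_(k < 4 ^ n) \int[mu]_(t in times) \int[P]_w (tm n k (t, w))%:E)%E.
    rewrite -ge0_integral_sum//.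
    - by apply: eq_integral => t; rewrite inE => /innerE.
    - by move=> k; exact: (measurable_tonelli_on1 P mtimes (mtmE n k) (tm0 n k)).
    - by move=> k t _; exact: integral_ge0.
  transitivity (\sum_(k < 4 ^ n) \int[P]_w (first_neg (path x w) n k *
     (expR (- lam * grid R n k) * v (path x w (grid R n k))))%:E)%E.
    apply: eq_bigr => k _; rewrite -(resolvent_first_neg x upsi hv); apply: eq_integral => t.
    by rewrite inE => tt; apply: eq_integral => w _; rewrite /tm /= (clip_id tt).
  rewrite -ge0_integral_sum//.
  - by apply: eq_integral => w _; rewrite sumEFin.
  - move=> k; apply/measurable_EFinP; apply: measurable_funM; first exact: measurable_first_neg.
    apply: measurable_funM => //; apply: (measurableT_comp (f := v)); last exact: measurable_path.
    apply/measurable_EFinP; rewrite (_ : _ \o v = resolvent W m lam psi); first exact: measurable_resolvent.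
    by apply/funext => y; rewrite hv.
  - move=> k w _; rewrite lee_fin mulr_ge0//; first by case/andP: (first_neg01 (path x w) n k).
    by rewrite mulr_ge0 ?expR_ge0.
have mv : measurable_fun setT v.
  apply/measurable_EFinP; rewrite (_ : _ \o v = resolvent W m lam psi); first exact: measurable_resolvent.
  by apply/funext => y; rewrite hv.
have limR : (I n @[n --> \oo] --> (v 0)%:E * \int[P]_w (theta w)%:E)%E.
  rewrite -ge0_integralZl//; last 3 first.
  - exact/measurable_EFinP.
  - by move=> w _; rewrite lee_fin; case/andP: (theta01 w).
  - by rewrite lee_fin.
  rewrite (_ : I = fun n => (\int[P]_w (S n w (fun k => expR (- lam * grid R n k) * v (path x w (grid R n k))))%:E)%E); last first.
    by apply/funext.
  under eq_integral do rewrite -EFinM mulrC.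
  apply: (@cvg_bounded_integral _ _ R P C).
  - move=> n; apply: measurable_sum => k; apply: measurable_funM; first exact: measurable_first_neg.
    by apply: measurable_funM => //; apply: (measurableT_comp (f := v)) => //; exact: measurable_path.
  - move=> n w; apply: S01 => k; rewrite mulr_ge0 ?expR_ge0//=.
    have /andP[h0 h1] := e01 _ (grid_ge0 R n k).
    by apply: le_trans (vC (path x w (grid R n k))); rewrite ler_piMl.
  - by move=> w; exact: thetaP.
apply: (cvg_unique _ _ limR) => //.
have mI n : measurable_fun times (fun t => \int[P]_w (expR (- lam * t) * (psi (path x w t) * A n t w))%:E)%E.
  apply: (@eq_measurable_fun _ _ _ _ _ (fun t => \sum_(k < 4 ^ n) \int[P]_w (tm n k (t, w))%:E)%E).
    by move=> t; rewrite inE => /innerE ->.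
  apply: emeasurable_sum => k; exact: (measurable_tonelli_on1 P mtimes (mtmE n k) (tm0 n k)).
have ptw t : times t -> (\int[P]_w (expR (- lam * t) * (psi (path x w t) * A n t w))%:E @[n --> \oo] -->
    \int[P]_w (expR (- lam * t) * (psi (path x w t) * (1 - stay m x t w)))%:E)%E.
  rewrite /= in_itv/= andbT => t0.
  apply: (@cvg_bounded_integral _ _ R P 1).
  - move=> n; apply: measurable_funM => //; apply: measurable_funM; last exact: mS.
    exact: measurable_unit_path.
  - move=> n w; have /andP[a0 a1] := A01 n t w; have /andP[e0 e1] := e01 _ t0.
    have /andP[f0 f1] := psi01 (path x w t).
    have h0 := mulr_ge0 f0 a0; have h1 := mulr_ile1 f0 a0 f1 a1.
    by rewrite mulr_ge0//= mulr_ile1.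
  - move=> w; apply: cvgM; first exact: cvg_cst.
    apply: cvgM; first exact: cvg_cst.
    exact: (cvg_first_neg_until (cp w) (p0 w) t0).
pose D (t : R) := (expR (- lam * t) * heat W m t psi x)%:E.
have mD : measurable_fun times D by apply/measurable_EFinP; exact: measurable_heat_time.
have D0 t : (0 <= D t)%E by rewrite lee_fin mulr_ge0 ?expR_ge0 ?heat_ge0.
have iD : mu.-integrable times D.
  apply/integrableP; split => //.
  under eq_integral do rewrite gee0_abs//.
  by rewrite -/(resolvent W m lam psi x) hv ltry.
have [] // := @dominated_convergence _ _ R mu times mtimes
  (fun n t => \int[P]_w (expR (- lam * t) * (psi (path x w t) * A n t w))%:E)%E
  (fun t => \int[P]_w (expR (- lam * t) * (psi (path x w t) * (1 - stay m x t w)))%:E)%E D mI.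
- by apply: emeasurable_fun_cvg mI _ => t tt; exact: ptw.
- by apply/aeW => t; exact: ptw.
apply/aeW => t n tt; rewrite gee0_abs; last first.
  apply: integral_ge0 => w _; rewrite lee_fin mulr_ge0 ?expR_ge0// mulr_ge0//.
    by case/andP: (psi01 (path x w t)).
  by case/andP: (A01 n t w).
rewrite /D EFinM heatE// -ge0_integralZl//; last 2 first.
- by apply/measurable_EFinP; exact: measurable_unit_path.
- by move=> w _; rewrite lee_fin; case/andP: (psi01 (path x w t)).
apply: ge0_le_integral => //.
- move=> w _; rewrite lee_fin mulr_ge0 ?expR_ge0// mulr_ge0//.
    by case/andP: (psi01 (path x w t)).
  by case/andP: (A01 n t w).
- apply/measurable_EFinP; apply: measurable_funM => //; apply: measurable_funM; last exact: mS.
  exact: measurable_unit_path.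
- by apply/measurable_EFinP; apply: measurable_funM => //; exact: measurable_unit_path.
- move=> w _; rewrite -EFinM lee_fin ler_wpM2l ?expR_ge0// ler_piMr//.
    by case/andP: (psi01 (path x w t)).
  by case/andP: (A01 n t w).
Qed.

End Hitting.

(** * Green potentials *)

Section GreenFunction.
Variable R : realType.
Local Notation mu := (@lebesgue_measure R).
Variables (m k : R).
Hypotheses (m0 : 0 < m) (mk : m <= k).

Let k0 : 0 < k. Proof. exact: lt_le_trans mk. Qed.

Lemma green_ge0 z : 0 <= green m k z.
Proof.
by rewrite /green mulr_ge0 ?invr_ge0 ?(ltW k0)// mulr_ge0 ?expR_ge0// le_min ler01 expR_ge0.
Qed.

Lemma green_nonneg z : 0 <= z -> green m k z = k^-1 * expR ((m - k) * z).
Proof.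
move=> z0; rewrite /green min_l ?mulr1// -expR0 ler_expR.
by rewrite !mulr_ge0// ltW.
Qed.

Lemma green_nonpos z : z <= 0 -> green m k z = k^-1 * expR ((m + k) * z).
Proof.
move=> z0; rewrite /green min_r; last by rewrite -expR0 ler_expR pmulr_rle0 ?mulr_gt0.
by rewrite -expRD; congr (_ * expR _); ring.
Qed.

Lemma green_le z : green m k z <= k^-1.
Proof.
rewrite -[leRHS]mulr1; have [z0|/ltW z0] := leP 0 z.
  rewrite green_nonneg// ler_wpM2l ?invr_ge0 ?(ltW k0)// -expR0 ler_expR.
  by rewrite mulr_le0_ge0// subr_le0.
rewrite green_nonpos// ler_wpM2l ?invr_ge0 ?(ltW k0)// -expR0 ler_expR.
by rewrite mulr_ge0_le0// addr_ge0 ?(ltW k0) ?(ltW m0).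
Qed.

(** A Harnack-type bound: moving the pole of the Green function by [y] costs a
factor that tends to [1] with [y]. It makes all potentials continuous at once. *)
Lemma green_shift z y : green m k (z - y) <= expR ((3 * k - m) * `|y|) * green m k z.
Proof.
rewrite /green [leRHS]mulrCA ler_wpM2l ?invr_ge0 ?(ltW k0)//.
have -> : (3 * k - m) * `|y| = (k - m) * `|y| + 2 * k * `|y| by ring.
rewrite expRD mulrACA; apply: ler_pM; rewrite ?expR_ge0//.
- rewrite -expRD ler_expR mulrBr; have := ler_norm y.
  by move=> /(ler_wpM2l (_ : 0 <= k - m)); rewrite subr_ge0 => /(_ mk); lra.
- have e1 : 1 <= expR (2 * k * `|y|) by rewrite -expR0 ler_expR !mulr_ge0// ltW.
  rewrite minr_pMr ?expR_ge0// mulr1 le_min !ge_min e1/=; apply/orP; right.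
  rewrite -expRD ler_expR mulrBr; have := ler_norm (- y); rewrite normrN.
  have k20 : 0 <= 2 * k by rewrite mulr_ge0// ltW.
  by move=> /(ler_wpM2l k20); rewrite mulrN => h; lra.
Qed.

Lemma measurable_green y : measurable_fun [set: R] (fun z => green m k (z - y)).
Proof.
apply: measurable_funM => //; apply: measurable_funM.
  apply: measurableT_comp; first exact: measurable_expR.
  by apply: measurable_funM => //; exact: measurable_funB.
apply: measurable_minr => //; apply: measurableT_comp; first exact: measurable_expR.
by apply: measurable_funM => //; exact: measurable_funB.
Qed.

Definition green_potential (psi : R -> R) (y : R) : R :=
  \int[mu]_z (psi z * green m k (z - y)).

Variable psi : R -> R.
Hypotheses (upsi : unit_valued psi) (ipsi : (\int[mu]_z (psi z)%:E < +oo)%E).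

Let mpsi : measurable_fun setT psi. Proof. by have [] := upsi. Qed.
Let psi0 z : 0 <= psi z. Proof. by have [_ /(_ z)/andP[]] := upsi. Qed.
Let v := green_potential psi.

Let mint y : measurable_fun [set: R] (fun z => (psi z * green m k (z - y))%:E).
Proof. by apply/measurable_EFinP; apply: measurable_funM => //; exact: measurable_green. Qed.

Let int_le y : (\int[mu]_z (psi z * green m k (z - y))%:E <= (k^-1 * fine (\int[mu]_z (psi z)%:E))%:E)%E.
Proof.
rewrite EFinM fineK; last first.
  by rewrite ge0_fin_numE//; apply: integral_ge0 => z _; rewrite lee_fin.
rewrite -ge0_integralZl//; last 3 first.
- exact/measurable_EFinP.
- by move=> z _; rewrite lee_fin.
- by rewrite lee_fin invr_ge0 ltW.
apply: ge0_le_integral => //.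
- by move=> z _; rewrite lee_fin mulr_ge0// green_ge0.
- exact: mint.
- by apply: emeasurable_funM => //; exact/measurable_EFinP.
- by move=> z _; rewrite -EFinM lee_fin mulrC ler_wpM2r// green_le.
Qed.

Lemma green_potentialE y : (v y)%:E = (\int[mu]_z (psi z * green m k (z - y))%:E)%E.
Proof.
rewrite /v /green_potential /Rintegral fineK// ge0_fin_numE.
  by apply: le_lt_trans (int_le y) _; rewrite ltry.
by apply: integral_ge0 => z _; rewrite lee_fin mulr_ge0// green_ge0.
Qed.

Lemma green_potential_le y : v y <= k^-1 * fine (\int[mu]_z (psi z)%:E)%E.
Proof. by rewrite -lee_fin green_potentialE; exact: int_le. Qed.

Let green_shift_le x y : v (x + y) <= expR ((3 * k - m) * `|y|) * v x.
Proof.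
rewrite -lee_fin EFinM !green_potentialE -ge0_integralZl//; last 2 first.
- exact: mint.
- by move=> z _; rewrite lee_fin mulr_ge0// green_ge0.
apply: ge0_le_integral => //.
- by move=> z _; rewrite lee_fin mulr_ge0// green_ge0.
- exact: mint.
- by apply: emeasurable_funM => //; exact: mint.
- move=> z _; rewrite -EFinM lee_fin [leRHS]mulrCA ler_wpM2l// opprD addrA.
  exact: green_shift.
Qed.

Lemma continuous_green_potential : {for 0, continuous v}.
Proof.
have e1 (c : R) : expR (c * `|y|) @[y --> (0:R)] --> (1 : R).
  rewrite -[X in _ --> X]expR0; apply: (cvg_comp (fun y => c * `|y|) expR); last exact: continuous_expR.
  have lim : c * `|y| @[y --> (0:R)] --> c * `|0 : R|.
    by apply: cvgM; [exact: cvg_cst|apply: cvg_norm; exact: cvg_id].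
  by rewrite normr0 mulr0 in lim.
apply: (@squeeze_cvgr _ _ _ _ (fun y => expR (- (3 * k - m) * `|y|) * v 0)
   (fun y => expR ((3 * k - m) * `|y|) * v 0)).
- apply: nearW => y; apply/andP; split.
    have := green_shift_le y (- y); rewrite subrr normrN => h.
    by rewrite mulNr expRN mulrC ler_pdivrMr ?expR_gt0// mulrC.
  by have := green_shift_le 0 y; rewrite add0r.
- by rewrite -[X in _ --> X]mul1r; apply: cvgM; [exact: e1|exact: cvg_cst].
- by rewrite -[X in _ --> X]mul1r; apply: cvgM; [exact: e1|exact: cvg_cst].
Qed.

End GreenFunction.

(** * The survival probability *)

Section Survival.
Variables (R : realType) (W : process R).
Hypothesis hW : standard_brownian_motion W.
Local Notation P := (process_prob W).
Local Notation Omega := (process_space W).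
Local Notation mu := (@lebesgue_measure R).
Local Notation times := (`[0%R, +oo[%classic : set R).
Variables (m k : R).
Hypotheses (m0 : 0 < m) (mk : m <= k).
Local Notation path x w := (drifted_path m x W w).
Local Notation lam := ((k ^+ 2 - m ^+ 2) / 2).

Let k0 : 0 < k. Proof. exact: lt_le_trans mk. Qed.

Lemma rate_ge0 : 0 <= lam.
Proof. by rewrite divr_ge0// subr_ge0 ler_sqr ?nnegrE ?(ltW m0) ?(ltW k0). Qed.

Let bump : R -> R := \1_(`[(- 1 : R), 0[%classic).

Let unit_bump : unit_valued bump.
Proof.
split; first exact: measurable_indic.
by move=> y; rewrite /bump indicE; case: (_ \in _); rewrite /= lexx ler01.
Qed.

Let bump_integral : (\int[mu]_z (bump z)%:E = 1)%E.
Proof.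
rewrite integral_indic// setIT; apply: etrans (lebesgue_measure_itv _) _.
rewrite /= lte_fin ltrN10; by rewrite -EFinD sub0r opprK.
Qed.

Let bump_green y : 0 <= y -> green_potential m k bump y = expR (- (m + k) * y) * green_potential m k bump 0.
Proof.
move=> y0; rewrite /green_potential -RintegralZl//.
  apply: eq_Rintegral => z _; rewrite [RHS]mulrCA /bump indicE.
  have [|_] := boolP (z \in _); last by rewrite !mul0r.
  rewrite inE/= in_itv/= => /andP[_ /ltW z0]; congr (_ * _).
  have zy : z - y <= 0 by rewrite subr_le0 (le_trans z0).
  rewrite subr0 (green_nonpos m0 mk zy) (green_nonpos m0 mk z0) [RHS]mulrCA -expRD.
  by congr (_ * expR _); ring.
apply/integrableP; split.
  by apply/measurable_EFinP; apply: measurable_funM; [exact: measurable_indic|exact: measurable_green].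
apply: (@le_lt_trans _ _ (green_potential m k bump 0)%:E); last by rewrite ltry.
rewrite green_potentialE ?bump_integral ?ltry// le_eqVlt; apply/orP; left; apply/eqP.
apply: eq_integral => z _; rewrite gee0_abs// lee_fin mulr_ge0 ?green_ge0//.
Qed.

Let bump_green_gt0 : 0 < green_potential m k bump 0.
Proof.
rewrite -lte_fin green_potentialE//; last by rewrite bump_integral ltry.
apply: (@lt_le_trans _ _ (k^-1 * expR (- (m + k)))%:E).
  by rewrite lte_fin mulr_gt0 ?invr_gt0 ?expR_gt0.
rewrite -[leLHS]mule1 -bump_integral -ge0_integralZl//.
- apply: ge0_le_integral => //.
  + by move=> z _; rewrite -EFinM lee_fin !mulr_ge0 ?invr_ge0 ?(ltW k0) ?expR_ge0.
  + by apply: emeasurable_funM => //; apply/measurable_EFinP; exact: measurable_indic.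
  + apply/measurable_EFinP; apply: measurable_funM; first exact: measurable_indic.
    exact: measurable_green.
  + move=> z _; rewrite -EFinM lee_fin /bump indicE.
    have [|_] := boolP (z \in _); last by rewrite mulr0 mul0r.
    rewrite inE/= in_itv/= => /andP[z1 /ltW z0]; rewrite mulr1 mul1r subr0 green_nonpos//.
    rewrite ler_wpM2l ?invr_ge0 ?(ltW k0)// ler_expR -mulrN1 ler_wpM2l//.
    by rewrite addr_ge0 ?(ltW k0) ?(ltW m0).
- by apply/measurable_EFinP; exact: measurable_indic.
- by move=> z _; rewrite lee_fin; case/andP: ((proj2 unit_bump) z).
- by rewrite lee_fin mulr_ge0 ?invr_ge0 ?(ltW k0) ?expR_ge0.
Qed.

(** The Laplace transform of the hitting time is read off from the test function
[bump]: it is supported on the negative half-line, so that the path meets it only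
after that time, and its potential on the positive half-line is proportional to
[expR (- (m + k) * x)]. *)
Lemma hitting_theta x : 0 <= x ->
  exists theta : Omega -> R, [/\ (lam = 0 -> forall w, theta w = 1 - survive m x w),
    (\int[P]_w (theta w)%:E = (expR (- (m + k) * x))%:E)%E &
    forall psi : R -> R, unit_valued psi -> (\int[mu]_z (psi z)%:E < +oo)%E ->
      (\int[mu]_(t in times) \int[P]_w
         (expR (- lam * t) * (psi (path x w t) * (1 - stay m x t w)))%:E =
       (green_potential m k psi 0 * expR (- (m + k) * x))%:E)%E].
Proof.
move=> x0; have [theta [mth th01 th_lam thE]] := hitting_resolvent hW m x0 rate_ge0.
have resE psi : unit_valued psi -> (\int[mu]_z (psi z)%:E < +oo)%E ->
    forall y, resolvent W m lam psi y = (green_potential m k psi y)%:E.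
  by move=> upsi ipsi y; rewrite resolventE// green_potentialE.
have thE' psi (upsi : unit_valued psi) (ipsi : (\int[mu]_z (psi z)%:E < +oo)%E) :=
  thE psi (green_potential m k psi) _ upsi (resE _ upsi ipsi)
    (continuous_green_potential m0 mk upsi ipsi) (green_potential_le m0 mk upsi ipsi).
have ibump : (\int[mu]_z (bump z)%:E < +oo)%E by rewrite bump_integral ltry.
have rho : (\int[P]_w (theta w)%:E = (expR (- (m + k) * x))%:E)%E.
  have := thE' bump unit_bump ibump.
  have -> : (\int[mu]_(t in times) \int[P]_w
      (expR (- lam * t) * (bump (path x w t) * (1 - stay m x t w)))%:E)%E = resolvent W m lam bump x.
    apply: eq_integral => t; rewrite inE/= in_itv/= andbT => t0.
    rewrite EFinM heatE// -ge0_integralZl//; last 2 first.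
    - by apply/measurable_EFinP; exact: measurable_unit_path.
    - by move=> w _; rewrite lee_fin; case/andP: ((proj2 unit_bump) (path x w t)).
    apply: eq_integral => w _; rewrite -EFinM; congr (_ * _)%:E.
    rewrite /bump indicE; have [|_] := boolP (_ \in _); last by rewrite mul0r.
    rewrite inE/= in_itv/= => /andP[_ neg]; rewrite /stay asboolF ?subr0 ?mulr1//.
    by move/(_ t); rewrite t0 lexx leNgt neg => /(_ isT).
  rewrite resE// bump_green// => e.
  have /andP[h0 h1] := @unit_integral_bound R _ _ P _ mth th01.
  have fth : (\int[P]_w (theta w)%:E)%E \is a fin_num.
    by rewrite ge0_fin_numE// (le_lt_trans h1)// ltry.
  move: e; rewrite -(fineK fth) -EFinM => -[e]; congr (_%:E).
  by apply: (mulfI (lt0r_neq0 bump_green_gt0)); rewrite -e mulrC.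
exists theta; split => // psi upsi ipsi.
by rewrite thE'// rho EFinM.
Qed.

End Survival.

Section SurvivalProbability.
Variables (R : realType) (W : process R).
Hypothesis hW : standard_brownian_motion W.
Local Notation P := (process_prob W).
Local Notation Omega := (process_space W).
Local Notation mu := (@lebesgue_measure R).
Local Notation times := (`[0%R, +oo[%classic : set R).
Variable m : R.
Hypothesis m0 : 0 < m.
Local Notation path x w := (drifted_path m x W w).

(** Without discount, that is for [k = m], the variable [theta] of [hitting_theta]
is the indicator of the paths that do not survive. *)
Lemma survival_prob x : 0 <= x -> survival W m x = 1 - expR (- (2 * m) * x).
Proof.
move=> x0; have [theta [thE rho _]] := hitting_theta hW m0 (lexx m) x0.
have {}thE : forall w, theta w = 1 - survive m x w by apply: thE; rewrite subrr mul0r.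
have : ((survival W m x)%:E + (expR (- (2 * m) * x))%:E = 1)%E.
  have -> : - (2 * m) * x = - (m + m) * x by ring.
  rewrite -rho survivalE// -ge0_integralD//.
  - rewrite -[RHS](@probability_setT _ _ _ P) -[RHS]mul1e -integral_cst//.
    by apply: eq_integral => w _; rewrite thE -EFinD subrKC.
  - by move=> w _; rewrite lee_fin; case/andP: (bool_unit R `[< forall s, 0 <= s -> 0 <= path x w s >]).
  - by apply/measurable_EFinP; exact: measurable_survive.
  - move=> w _; rewrite lee_fin thE subr_ge0.
    by case/andP: (bool_unit R `[< forall s, 0 <= s -> 0 <= path x w s >]).
  - apply/measurable_EFinP; rewrite (_ : theta = fun w => 1 - survive m x w); last exact/funext.
    by apply: measurable_funB => //; exact: measurable_survive.
by move=> e; apply/esym/eqP; rewrite subr_eq; apply/eqP/EFin_inj; rewrite EFinD.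
Qed.

Lemma survival_gt0 x : 0 < x -> 0 < survival W m x.
Proof.
move=> x0; rewrite survival_prob ?ltW// subr_gt0 -expR0 ltr_expR mulNr oppr_lt0.
by rewrite !mulr_gt0.
Qed.

Lemma survival_le x : 0 <= x -> survival W m x <= 2 * m * x.
Proof.
move=> x0; rewrite survival_prob// lerBlDr -lerBlDl.
have := @expR_ge1Dx R (- (2 * m) * x); by rewrite mulNr.
Qed.

(** * Occupation of surviving paths started near the origin *)

Variable k : R.
Hypothesis mk : m <= k.
Local Notation lam := ((k ^+ 2 - m ^+ 2) / 2).
Let k0 : 0 < k. Proof. exact: lt_le_trans mk. Qed.

Variable f : R -> R.
Hypotheses (uf : unit_valued f) (intf : (\int[mu]_z (f z)%:E < +oo)%E).

Definition weighted_survival (z : R) : R := nonneg_ind z * (f z * survival W m z).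
Local Notation psi := weighted_survival.

Definition occupation_survive (x : R) : \bar R :=
  (\int[mu]_(t in times) \int[P]_w (expR (- lam * t) * (f (path x w t) * survive m x w))%:E)%E.

Let upsi : unit_valued psi.
Proof.
by apply: unit_mul; [exact: unit_nonneg_ind|apply: unit_mul => //; exact: unit_survival].
Qed.

Let psi_le z : psi z <= f z.
Proof.
have /andP[n0 n1] := nonneg_ind01 z; have [_ /(_ z)/andP[f0 f1]] := uf.
have [_ /(_ z)/andP[s0 s1]] := unit_survival hW m.
by rewrite /psi -[leRHS]mul1r ler_pM ?mulr_ge0// ler_piMr.
Qed.

Let ipsi : (\int[mu]_z (psi z)%:E < +oo)%E.
Proof.
apply: le_lt_trans intf; apply: ge0_le_integral => //.
- by move=> z _; rewrite lee_fin; case/andP: ((proj2 upsi) z).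
- by apply/measurable_EFinP; have [] := upsi.
- by apply/measurable_EFinP; have [] := uf.
- by move=> z _; rewrite lee_fin.
Qed.

(** The fixed-time Markov property turns the occupation of surviving paths into
the [weighted_survival] accumulated before the hitting time of the negative
half-line; what is accumulated after this time is given by [hitting_theta]. *)
Lemma occupation_surviveE x : 0 <= x ->
  ((green_potential m k psi x)%:E = occupation_survive x +
    (green_potential m k psi 0 * expR (- (m + k) * x))%:E)%E.
Proof.
move=> x0; have [theta [_ _ thE]] := hitting_theta hW m0 mk x0.
have [mf f01] := uf; have [mpsi psi01] := upsi.
rewrite -(thE _ upsi ipsi) green_potentialE// -(resolventE hW _ _ k0 upsi) /resolvent.
pose A t := (\int[P]_w (expR (- lam * t) * (f (path x w t) * survive m x w))%:E)%E.
pose B t := (\int[P]_w (expR (- lam * t) * (psi (path x w t) * (1 - stay m x t w)))%:E)%E.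
have mtimes : measurable times by exact: measurable_itv.
have s01 (w : Omega) : 0 <= survive m x w <= 1 by exact: bool_unit.
have st01 (t : R) (w : Omega) : 0 <= stay m x t w <= 1 by exact: bool_unit.
have Afin t : A t \is a fin_num.
  have h w : (0 <= (expR (- lam * t) * (f (path x w t) * survive m x w))%:E <= (expR (- lam * t))%:E)%E.
    rewrite !lee_fin; have /andP[s0 s1] := s01 w; have /andP[f0 f1] := f01 (path x w t).
    by rewrite !mulr_ge0 ?expR_ge0//= ler_piMr ?expR_ge0// mulr_ile1.
  rewrite ge0_fin_numE; last by apply: integral_ge0 => w _; case/andP: (h w).
  apply: (@le_lt_trans _ _ (\int[P]_w (cst (expR (- lam * t))%:E w))%E).
    apply: ge0_le_integral => //.
    - by move=> w _; case/andP: (h w).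
    - apply/measurable_EFinP; apply: measurable_funM => //; apply: measurable_funM.
        exact: measurable_unit_path.
      exact: measurable_survive.
    - by move=> w _; case/andP: (h w).
  by rewrite integral_cst// [X in (_ * X)%E](@probability_setT _ _ _ P) mule1 ltry.
have A0 t : (0 <= A t)%E.
  apply: integral_ge0 => w _; rewrite lee_fin mulr_ge0 ?expR_ge0// mulr_ge0//.
    by case/andP: (f01 (path x w t)).
have B0 t : (0 <= B t)%E.
  apply: integral_ge0 => w _; rewrite lee_fin mulr_ge0 ?expR_ge0// mulr_ge0//.
    by case/andP: (psi01 (path x w t)).
  by rewrite subr_ge0; case/andP: (st01 t w).
have AB t : times t -> (expR (- lam * t) * heat W m t psi x)%:E = (A t + B t)%E.
  rewrite /= in_itv/= andbT => t0; rewrite EFinM heatE//.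
  have -> : A t = ((expR (- lam * t))%:E * \int[P]_w (psi (path x w t) * stay m x t w)%:E)%E.
    rewrite /A; under eq_integral do rewrite EFinM.
    rewrite ge0_integralZl//; last 2 first.
    - apply/measurable_EFinP; apply: measurable_funM; first exact: measurable_unit_path.
      exact: measurable_survive.
    - by move=> w _; rewrite lee_fin mulr_ge0//; case/andP: (f01 (path x w t)).
    congr (_ * _)%E; rewrite future_markov//; apply: eq_integral => w _; congr (_%:E).
    rewrite /psi /stay; case: asboolP => h; last by rewrite !mulr0.
    by rewrite /nonneg_ind h ?t0 ?lexx// mul1r.
  rewrite /B; under [X in (_ + X)%E]eq_integral do rewrite EFinM.
  rewrite [X in (_ + X)%E]ge0_integralZl//; last 2 first.
  - apply/measurable_EFinP; apply: measurable_funM; first exact: measurable_unit_path.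
    by apply: measurable_funB => //; exact: measurable_stay.
  - move=> w _; rewrite lee_fin mulr_ge0//; first by case/andP: (psi01 (path x w t)).
    by rewrite subr_ge0; case/andP: (st01 t w).
  rewrite -ge0_muleDr; last 2 first.
  - by apply: integral_ge0 => w _; rewrite lee_fin mulr_ge0//; case/andP: (psi01 (path x w t)).
  - apply: integral_ge0 => w _; rewrite lee_fin mulr_ge0//; first by case/andP: (psi01 (path x w t)).
    by rewrite subr_ge0; case/andP: (st01 t w).
  congr (_ * _)%E; rewrite -ge0_integralD//.
  - by apply: eq_integral => w _; rewrite -EFinD -mulrDr subrKC mulr1.
  - by move=> w _; rewrite lee_fin mulr_ge0//; case/andP: (psi01 (path x w t)).
  - apply/measurable_EFinP; apply: measurable_funM; first exact: measurable_unit_path.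
    exact: measurable_stay.
  - move=> w _; rewrite lee_fin mulr_ge0//; first by case/andP: (psi01 (path x w t)).
    by rewrite subr_ge0; case/andP: (st01 t w).
  - apply/measurable_EFinP; apply: measurable_funM; first exact: measurable_unit_path.
    by apply: measurable_funB => //; exact: measurable_stay.
have mA : measurable_fun times A.
  pose g (q : R * Omega) := (expR (- lam * q.1) * (f (path x q.2 (Num.max 0 q.1)) * survive m x q.2))%:E.
  have mg : measurable_fun setT g.
    apply/measurable_EFinP; apply: measurable_funM.
      apply: measurableT_comp; first exact: measurable_expR.
      by apply: measurable_funM => //; exact: measurable_fst.
    apply: measurable_funM; first by apply: measurableT_comp => //; exact: measurable_joint_path.
    by apply: (measurableT_comp (f := survive m x) (g := snd)); [exact: measurable_survive|exact: measurable_snd].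
  have g0 q : (0 <= g q)%E.
    rewrite lee_fin mulr_ge0 ?expR_ge0// mulr_ge0//.
    by case/andP: (f01 (path x q.2 (Num.max 0 q.1))).
  apply: (@eq_measurable_fun _ _ _ _ _ (fun t => \int[P]_w g (t, w))%E); last first.
    exact: (measurable_tonelli_on1 P mtimes mg g0).
  move=> t; rewrite inE/= in_itv/= andbT => t0; apply: eq_integral => w _.
  by rewrite /g /= max_r.
have mB : measurable_fun times B.
  apply: (@eq_measurable_fun _ _ _ _ _ (fun t => (expR (- lam * t) * heat W m t psi x)%:E - A t)%E).
    by move=> t; rewrite inE => /AB ->; rewrite addeAC subee// add0e.
  apply: emeasurable_funB => //; apply/measurable_EFinP; exact: measurable_heat_time.
rewrite /occupation_survive -ge0_integralD//.
- by apply: eq_integral => t; rewrite inE => /AB.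
- by move=> t _; exact: A0.
- by move=> t _; exact: B0.
Qed.

Let J := \int[mu]_z (psi z * expR ((m - k) * z)).

Let psi_neg z : z < 0 -> psi z = 0.
Proof. by move=> z0; rewrite /psi /nonneg_ind leNgt z0 mul0r. Qed.

Let exp_le1 z : 0 <= z -> expR ((m - k) * z) <= 1.
Proof. by move=> z0; rewrite -expR0 ler_expR mulr_le0_ge0// subr_le0. Qed.

Let mJ : measurable_fun [set: R] (fun z => (psi z * expR ((m - k) * z))%:E).
Proof.
apply/measurable_EFinP; apply: measurable_funM; first by have [] := upsi.
by apply: measurableT_comp; [exact: measurable_expR|exact: measurable_funM].
Qed.

Let psi0 z : 0 <= psi z. Proof. by case/andP: ((proj2 upsi) z). Qed.

Lemma limit_occupationE : J%:E = (\int[mu]_z (psi z * expR ((m - k) * z))%:E)%E.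
Proof.
rewrite /J /Rintegral fineK// ge0_fin_numE; last first.
  by apply: integral_ge0 => z _; rewrite lee_fin mulr_ge0 ?expR_ge0.
apply: le_lt_trans ipsi; apply: ge0_le_integral => //.
- by move=> z _; rewrite lee_fin mulr_ge0 ?expR_ge0.
- by apply/measurable_EFinP; have [] := upsi.
- move=> z _; rewrite lee_fin; have [/exp_le1 z1|/psi_neg ->] := leP 0 z.
    by rewrite ler_piMr.
  by rewrite mul0r.
Qed.

Let v := green_potential m k psi.
Let vE y : (v y)%:E = (\int[mu]_z (psi z * green m k (z - y))%:E)%E.
Proof. exact: green_potentialE. Qed.

Let mv y : measurable_fun [set: R] (fun z => (psi z * green m k (z - y))%:E).
Proof.
by apply/measurable_EFinP; apply: measurable_funM; [have [] := upsi|exact: measurable_green].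
Qed.

Let v_at0 : v 0 = k^-1 * J.
Proof.
apply: EFin_inj; rewrite vE EFinM limit_occupationE -ge0_integralZl//.
- apply: eq_integral => z _; rewrite -EFinM; congr (_%:E).
  have [z0|/psi_neg ->] := leP 0 z; last by rewrite !mul0r mulr0.
  by rewrite subr0 green_nonneg// mulrCA.
- by move=> z _; rewrite lee_fin mulr_ge0 ?expR_ge0.
- by rewrite lee_fin invr_ge0 ltW.
Qed.

Let v_upper x : 0 <= x -> v x <= k^-1 * expR ((k - m) * x) * J.
Proof.
move=> x0; rewrite -lee_fin vE EFinM limit_occupationE -ge0_integralZl//; last 2 first.
- by move=> z _; rewrite lee_fin mulr_ge0 ?expR_ge0.
- by rewrite lee_fin mulr_ge0 ?expR_ge0// invr_ge0 ltW.
apply: ge0_le_integral => //.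
- by move=> z _; rewrite lee_fin mulr_ge0 ?green_ge0.
- exact: mv.
- by apply: emeasurable_funM.
- move=> z _; rewrite -EFinM lee_fin [leRHS]mulrCA ler_wpM2l// /green -[leRHS]mulrA.
  rewrite ler_wpM2l ?invr_ge0 ?(ltW k0)// -expRD.
  have -> : (k - m) * x + (m - k) * z = (m - k) * (z - x) by ring.
  by rewrite ler_piMr ?expR_ge0// ge_min lexx.
Qed.

(* For [z] above [x] the Green function has the same exponential form as in [J];
below [x] the weight is at most [2 * m * x], on an interval of length [x]. *)
Let v_lower x : 0 <= x ->
  k^-1 * expR ((k - m) * x) * (J - 2 * m * x ^+ 2) <= v x.
Proof.
move=> x0; rewrite mulrBr lerBlDr; set c := k^-1 * expR ((k - m) * x).
have c0 : 0 <= c by rewrite mulr_ge0 ?expR_ge0// invr_ge0 ltW.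
have box : ((c * (2 * m * x ^+ 2))%:E = \int[mu]_z ((c * (2 * m * x))%:E * (\1_(`[(0 : R), x]%classic) z)%:E))%E.
  rewrite ge0_integralZl//; last 2 first.
  - by apply/measurable_EFinP; exact: measurable_indic.
  - by rewrite lee_fin mulr_ge0// !mulr_ge0// ltW.
  rewrite integral_indic// setIT [X in (_ * X)%E](_ : _ = x%:E) ?expr2 -?EFinM ?mulrA//.
  apply: etrans (lebesgue_measure_itv _) _ => /=; rewrite lte_fin.
  by case: ltgtP x0 => // [_ _|<- _]; rewrite -?EFinD ?subr0.
rewrite -lee_fin EFinD vE box EFinM limit_occupationE -ge0_integralZl//; last first.
  by move=> z _; rewrite lee_fin mulr_ge0 ?expR_ge0.
rewrite -ge0_integralD//; last 3 first.
- exact: mv.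
- move=> z _; rewrite -EFinM lee_fin mulr_ge0//.
  by rewrite mulr_ge0// !mulr_ge0// ltW.
- by apply: emeasurable_funM => //; apply/measurable_EFinP; exact: measurable_indic.
apply: ge0_le_integral => //.
- by move=> z _; rewrite -EFinM lee_fin mulr_ge0// mulr_ge0 ?expR_ge0.
- by apply: emeasurable_funM.
- apply: emeasurable_funD; first exact: mv.
  by apply: emeasurable_funM => //; apply/measurable_EFinP; exact: measurable_indic.
- move=> z _; rewrite -EFinD -EFinM lee_fin.
  have i0 : 0 <= c * (2 * m * x) * \1_(`[(0 : R), x]%classic) z.
    by rewrite mulr_ge0// mulr_ge0// !mulr_ge0// ltW.
  have [z0|/psi_neg ->] := leP 0 z; last by rewrite !mul0r mulr0 add0r.
  have E : c * (psi z * expR ((m - k) * z)) = psi z * (k^-1 * expR ((m - k) * (z - x))).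
    by rewrite /c (_ : (m - k) * (z - x) = (k - m) * x + (m - k) * z) ?expRD; ring.
  have [zx|xz] := leP z x; last first.
    have zx0 : 0 <= z - x by rewrite subr_ge0 ltW.
    by rewrite (green_nonneg m0 mk zx0) -E lerDl.
  have -> : \1_(`[(0 : R), x]%classic) z = 1 :> R.
    by rewrite indicE mem_set//= in_itv/= z0 zx.
  rewrite mulr1 -[leLHS]add0r; apply: lerD; first by rewrite mulr_ge0 ?green_ge0.
  rewrite ler_wpM2l//; apply: (@le_trans _ _ (psi z)).
    by rewrite ler_piMr// exp_le1.
  have [_ /(_ z)/andP[f0 f1]] := uf; have [_ /(_ z)/andP[s0 s1]] := unit_survival hW m.
  have /andP[n0 n1] := nonneg_ind01 z.
  apply: (@le_trans _ _ (survival W m z)).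
    rewrite /psi; apply: (@le_trans _ _ (f z * survival W m z)).
      by rewrite ler_piMl// mulr_ge0.
    by rewrite ler_piMl.
  by apply: le_trans (survival_le z0) _; rewrite ler_wpM2l// mulr_ge0// ltW.
by move=> z _; rewrite lee_fin mulr_ge0 ?green_ge0.
Qed.

Let cvg_exp_quotient (a : R) : (expR (a * x) - 1) / x @[x --> 0^'+] --> a.
Proof.
have h : is_derive (0 : R) 1 (fun x : R => expR (a * x)) a.
  have d0 : is_derive (a * 0) 1 (@expR R) 1.
    by rewrite -[X in is_derive _ _ _ X]expR0 mulr0; exact: is_derive_expR.
  have d1 : is_derive (0 : R) 1 (fun x : R => a * x) a.
    have := @is_deriveZ R R R id a 0 1 1 (is_derive_id _ _).
    by rewrite /GRing.scale/= mulr1.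
  by have := is_derive1_comp d0 d1; rewrite mul1r.
have [d e] := h; move: d; rewrite /derivable -/('D_1 (fun x : R => expR (a * x)) 0) => d.
have {}d : h^-1 *: (((fun x : R => expR (a * x)) \o shift 0) (h *: 1) - expR (a * 0)) @[h --> (0 : R)^'] --> a.
  by rewrite -[X in _ --> X]e.
apply: cvg_dnbhs_at_right; apply: cvg_trans d.
apply: near_eq_cvg; near=> x.
by rewrite /= addr0 mulr0 expR0 /GRing.scale/= mulr1 mulrC.
Unshelve. all: by end_near. Qed.


Let cvg_id_at_right : (x : R) @[x --> (0 : R)^'+] --> 0.
Proof. by apply: cvg_at_right_filter; exact: cvg_id. Qed.

Let cvg_exp_at_right (a : R) : expR (a * x) @[x --> (0 : R)^'+] --> (1 : R).
Proof.
rewrite -[X in _ --> X]expR0; apply: (cvg_comp (fun y => a * y) expR); last exact: continuous_expR.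
rewrite (_ : nbhs 0 = nbhs (a * 0)); last by rewrite mulr0.
apply: cvgM; first exact: cvg_cst.
exact: cvg_id_at_right.
Qed.

Let survival_quotient : survival W m x / x @[x --> 0^'+] --> 2 * m.
Proof.
have : - ((expR (- (2 * m) * x) - 1) / x) @[x --> 0^'+] --> - - (2 * m).
  by apply: cvgN; exact: cvg_exp_quotient.
rewrite opprK; apply: cvg_trans; apply: near_eq_cvg; near=> x.
rewrite survival_prob; first by rewrite -mulNr opprB.
by near: x; exact: nbhs_right_ge.
Unshelve. all: by end_near. Qed.

(** The occupation [v x - v 0 * expR (- (m + k) * x)] and the survival probability
both vanish linearly at [0], with slopes [2 * J] and [2 * m]. *)
Lemma limit_occupation :
  fine (occupation_survive x) / survival W m x @[x --> 0^'+] --> m^-1 * J.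
Proof.
have m20 : 2 * m != 0 by rewrite mulf_neq0// gt_eqF.
pose theta (x : R) := (expR ((k - m) * x) - 1) / x - (expR (- (m + k) * x) - 1) / x.
pose upper x := k^-1 * J * (theta x * (survival W m x / x)^-1).
pose rest x := k^-1 * expR ((k - m) * x) * (2 * m) * x * (survival W m x / x)^-1.
have thetalim : theta x @[x --> 0^'+] --> 2 * k.
  rewrite (_ : 2 * k = (k - m) - - (m + k)); last by ring.
  by apply: cvgB; exact: cvg_exp_quotient.
have invlim : (survival W m x / x)^-1 @[x --> 0^'+] --> (2 * m)^-1.
  exact: cvgV.
have upperlim : upper x @[x --> 0^'+] --> m^-1 * J.
  rewrite (_ : m^-1 * J = k^-1 * J * (2 * k * (2 * m)^-1)); last first.
    by field; rewrite !gt_eqF.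
  by apply: cvgM; [exact: cvg_cst|exact: cvgM].
have restlim : rest x @[x --> 0^'+] --> 0.
  rewrite [X in _ --> X](_ : 0 = k^-1 * 1 * (2 * m) * 0 * (2 * m)^-1); last by rewrite mulr0 mul0r.
  apply: cvgM => //; apply: cvgM => //; apply: cvgM; last exact: cvg_cst.
  by apply: cvgM; [exact: cvg_cst|exact: cvg_exp_at_right].
apply: (@squeeze_cvgr _ _ _ _ (fun x => upper x - rest x) upper) => //; last first.
  by rewrite -[X in _ --> X]subr0; exact: cvgB.
near=> x.
have x0 : 0 < x by near: x; exact: nbhs_right_gt.
have h0 := survival_gt0 x0.
have occ : fine (occupation_survive x) = v x - v 0 * expR (- (m + k) * x).
  have := occupation_surviveE (ltW x0); move/(congr1 (fun e => (e - (v 0 * expR (- (m + k) * x))%:E)%E)).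
  by rewrite addeK// -EFinB => <-.
have thx : expR ((k - m) * x) - expR (- (m + k) * x) = x * theta x.
  by rewrite /theta; field; rewrite gt_eqF.
have upE : upper x = (k^-1 * expR ((k - m) * x) * J - v 0 * expR (- (m + k) * x)) / survival W m x.
  rewrite v_at0 (_ : _ - _ = k^-1 * J * (expR ((k - m) * x) - expR (- (m + k) * x))); last by ring.
  by rewrite thx /upper invf_div; ring.
apply/andP; split; last first.
  by rewrite upE occ ler_pM2r ?invr_gt0// lerB// v_upper// ltW.
have reE : rest x = k^-1 * expR ((k - m) * x) * (2 * m * x ^+ 2) / survival W m x.
  by rewrite /rest invf_div expr2; ring.
rewrite upE reE -mulrBl occ ler_pM2r ?invr_gt0// -addrAC lerB//.
by rewrite -mulrBr v_lower// ltW.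
Unshelve. all: by end_near. Qed.

End SurvivalProbability.

(** * The function I along exponentials *)

Section Profile.
Variable R : realType.
Local Notation mu := (@lebesgue_measure R).
Local Notation times := (`[0%R, +oo[%classic : set R).

Lemma integral_exp_decay (a : R) : 0 < a ->
  (\int[mu]_(t in times) (expR (- a * t))%:E = (a^-1)%:E)%E.
Proof.
move=> a0; have an0 : a != 0 by rewrite gt_eqF.
have := integral_exponential_pdf a0.
have -> : (\int[mu]_x (exponential_pdf a x)%:E = \int[mu]_(x in times) (a%:E * (expR (- a * x))%:E))%E.
  rewrite [RHS]integral_mkcond; apply: eq_integral => x _.
  by rewrite /exponential_pdf !patchE; case: ifP.
rewrite ge0_integralZl//; last 2 first.
- apply/measurable_EFinP; apply: measurableT_comp; first exact: measurable_expR.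
  exact: measurable_funM.
- by rewrite lee_fin ltW.
move=> e; have : ((a^-1)%:E * (a%:E * \int[mu]_(x in times) (expR (- a * x))%:E) = (a^-1)%:E)%E.
  by rewrite e mule1.
by rewrite muleA -EFinM mulVf// mul1e.
Qed.

Variable gamma : R.
Hypothesis gamma0 : 0 < gamma.

Definition profile (y : R) : R := I_fun (expR (gamma * y)).

Lemma I_fun01 (z : R) : 0 <= z -> 0 <= I_fun z <= 1.
Proof.
move=> z0; rewrite /I_fun mulr_ge0 ?expR_ge0//= expRN ler_pdivrMr ?expR_gt0// mul1r.
by apply: le_trans (expR_ge1Dx z); rewrite lerDr.
Qed.

Lemma continuous_I_fun : continuous (@I_fun R).
Proof.
move=> z; apply: cvgM; first exact: cvg_id.
by apply: (cvg_comp (fun x => - x) expR); [exact: cvgN cvg_id|exact: continuous_expR].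
Qed.

Lemma continuous_profile : continuous profile.
Proof.
move=> y; apply: (cvg_comp (fun y => expR (gamma * y)) (@I_fun R)); last exact: continuous_I_fun.
by apply: (cvg_comp (fun y => gamma * y) expR); [apply: cvgM; [exact: cvg_cst|exact: cvg_id]|exact: continuous_expR].
Qed.

Lemma unit_profile : unit_valued profile.
Proof.
split; first exact: continuous_measurable_fun continuous_profile.
by move=> y; apply: I_fun01; exact: expR_ge0.
Qed.

Let dexp (y : R) : is_derive y 1 (fun y : R => expR (gamma * y)) (gamma * expR (gamma * y)).
Proof.
have d1 : is_derive y 1 (fun x : R => gamma * x) gamma.
  have := @is_deriveZ R R R id gamma y 1 1 (is_derive_id _ _).
  by rewrite /GRing.scale/= mulr1.
have := is_derive1_comp (is_derive_expR (gamma * y)) d1.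
by rewrite mulrC.
Qed.

Let dexpN (z : R) : is_derive z 1 (fun z : R => expR (- z)) (- expR (- z)).
Proof.
have d1 : is_derive z 1 (fun x : R => - x) (- 1) by exact: is_deriveN.
by have := is_derive1_comp (is_derive_expR (- z)) d1; rewrite mulrN1.
Qed.

Let dprofile (y : R) : is_derive y 1 profile
  ((expR (- expR (gamma * y)) - expR (gamma * y) * expR (- expR (gamma * y))) * (gamma * expR (gamma * y))).
Proof.
set z := expR (gamma * y).
have dI : is_derive z 1 (@I_fun R) (expR (- z) - z * expR (- z)).
  have := @is_deriveM _ _ id (fun z : R => expR (- z)) z 1 1 _ (is_derive_id _ _) (dexpN z).
  by rewrite /GRing.scale/= mulr1 mulrN addrC.
by have := @is_derive1_comp R (@I_fun R) (fun y => expR (gamma * y)) y _ _ dI (dexp y).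
Qed.

Lemma profile_lipschitz x y : `|profile x - profile y| <= 4 * gamma * `|x - y|.
Proof.
wlog xy : x y / y <= x.
  by move=> h; have [/h//|/ltW/h] := leP y x; rewrite distrC [X in _ <= _ * X]distrC.
have [c _ ->] := MVT_segment xy (fun z _ => dprofile z) (continuous_subspaceT continuous_profile).
rewrite normrM ler_wpM2r//; set z := expR (gamma * c).
have z0 : 0 <= z by exact: expR_ge0.
have E : (expR (- z) - z * expR (- z)) * (gamma * z) = gamma * ((z - z ^+ 2) * expR (- z)) by ring.
rewrite E normrM (gtr0_norm gamma0) mulrC ler_wpM2r ?(ltW gamma0)// normrM (ger0_norm (expR_ge0 _)).
rewrite expRN ler_pdivrMr ?expR_gt0//.
(* This gives [z + z ^+ 2 <= 4 * expR z], hence the constant [4]. *)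
have h : (1 + z / 2) ^+ 2 <= expR z.
  rewrite (_ : expR z = expR (z / 2) ^+ 2); last by rewrite expr2 -expRD -splitr.
  rewrite ler_sqr ?nnegrE ?expR_ge0//; first exact: expR_ge1Dx.
  by rewrite addr_ge0// divr_ge0.
apply: (@le_trans _ _ (z + z ^+ 2)).
  by rewrite (le_trans (ler_normB _ _))// !ger0_norm ?exprn_ge0.
by have z20 := sqr_ge0 z; lra.
Qed.

Let primitive (y : R) := - (gamma^-1 * expR (- expR (gamma * y))).

Let dprimitive (y : R) : is_derive y 1 primitive (profile y).
Proof.
have d := @is_derive1_comp R (fun z => expR (- z)) (fun y => expR (gamma * y)) y _ _ (dexpN (expR (gamma * y))) (dexp y).
have := @is_deriveZ R R R _ (- gamma^-1) y 1 _ d.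
rewrite /GRing.scale/=.
have -> : - gamma^-1 * (- expR (- expR (gamma * y)) * (gamma * expR (gamma * y))) = profile y.
  by rewrite /profile /I_fun; field; rewrite gt_eqF.
congr is_derive; apply/funext => z.
by rewrite /primitive -mulNr.
Qed.

(** The function [profile] is the derivative of [- gamma^-1 * exp (- exp (gamma y))],
which increases from [- gamma^-1] to [0]. *)
Lemma integral_profile : (\int[mu]_y (profile y)%:E = (gamma^-1)%:E)%E.
Proof.
pose F (n : nat) : set R := `[- n%:R, +oo[%classic.
have FT : \bigcup_n F n = [set: R].
  apply/seteqP; split => // x _; have [n xn] : exists n : nat, - x <= n%:R.
    exists (Num.truncn `|x|).+1; apply: (le_trans _ (ltW (truncnS_gt _))).
    by rewrite -normrN ler_norm.
  by exists n => //; rewrite /F/= in_itv/= andbT lerNl.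
have FI n : (\int[mu]_(y in F n) (profile y)%:E = (gamma^-1 * expR (- expR (gamma * - n%:R)))%:E)%E.
  rewrite (@ge0_continuous_FTC2y _ profile primitive _ 0).
  - by rewrite /primitive EFinN sub0e oppeK.
  - by move=> x _; case/andP: ((proj2 unit_profile) x).
  - exact: continuous_subspaceT continuous_profile.
  - apply: (@squeeze_cvgr _ _ _ _ (fun y => - gamma^-1 * expR (- (gamma * y))) (fun=> 0)).
    + apply: nearW => y; rewrite /primitive mulNr oppr_le0 lerN2 mulr_ge0 ?invr_ge0 ?(ltW gamma0) ?expR_ge0// andbT.
      rewrite ler_wpM2l ?invr_ge0 ?(ltW gamma0)// ler_expR lerN2.
      by apply: le_trans (expR_ge1Dx _); rewrite lerDr.
    + rewrite [X in _ --> X](_ : 0 = - gamma^-1 * 0); last by rewrite mulr0.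
      apply: cvgM; first exact: cvg_cst.
      apply: (cvg_comp (fun y => gamma * y) (fun y => expR (- y))); last exact: cvgr_expR.
      exact: gt0_cvgMry.
    + exact: cvg_cst.
  - by move=> x _; have [] := dprimitive x.
  - apply: cvg_at_right_filter; apply: differentiable_continuous; apply/derivable1_diffP.
    by have [] := dprimitive (- n%:R).
  - by move=> x _; rewrite derive1E; have [_] := dprimitive x.
have : (\int[mu]_(y in F n) (profile y)%:E @[n --> \oo] --> \int[mu]_(y in \bigcup_n F n) (profile y)%:E)%E.
  apply: ge0_nondecreasing_set_cvg_integral => //.
  - by move=> a b ab; apply/subsetPset => x; rewrite /F/= !in_itv/= !andbT; apply: le_trans; rewrite lerN2 ler_nat.
  - by move=> n; exact: measurable_itv.
  - by move=> n; apply/measurable_EFinP; apply: measurable_funTS; have [] := unit_profile.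
  - by move=> n x _; rewrite lee_fin; case/andP: ((proj2 unit_profile) x).
rewrite FT => lim; apply: (cvg_unique _ lim) => //.
apply: cvg_EFin; first by apply: nearW => n; rewrite FI.
rewrite (_ : fine \o _ = fun n : nat => gamma^-1 * expR (- expR (gamma * - n%:R))); last first.
  by apply/funext => n /=; rewrite FI.
rewrite -[X in _ --> X](mulr1 gamma^-1); apply: cvgM; first exact: cvg_cst.
rewrite [X in _ --> X](_ : 1 = expR (- 0)); last by rewrite oppr0 expR0.
apply: (cvg_comp (fun n : nat => - expR (gamma * - n%:R)) expR); last exact: continuous_expR.
apply: cvgN; under eq_fun do rewrite mulrN.
apply: (cvg_comp (fun n : nat => gamma * n%:R) (fun y => expR (- y))); last exact: cvgr_expR.
apply: (cvg_comp (fun n : nat => n%:R : R) (fun r => gamma * r)); first exact: cvgr_idn.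
exact: gt0_cvgMry.
Qed.

End Profile.

(** * Discounted occupation as a continuous functional of the path *)

Section DiscountedFunctional.
Variable R : realType.
Local Notation mu := (@lebesgue_measure R).
Local Notation times := (`[0%R, +oo[%classic : set R).
Variables (lam L : R) (f : R -> R).
Hypotheses (lam0 : 0 < lam) (L0 : 0 < L) (uf : unit_valued f)
  (lipf : forall x y, `|f x - f y| <= L * `|x - y|).

Definition discounted (p : R -> R) : R := \int[mu]_(t in times) (expR (- lam * t) * f (p t)).

Let mtimes : measurable times. Proof. exact: measurable_itv. Qed.

Let mexp (a : R) : measurable_fun times (fun t => expR (- a * t)).
Proof. by apply: measurableT_comp; [exact: measurable_expR|exact: measurable_funM]. Qed.

Lemma measurable_discount p : continuous_on_time p ->
  measurable_fun times (fun t => expR (- lam * t) * f (p t)).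
Proof.
move=> cp; apply: measurable_funM; first exact: mexp.
apply: measurableT_comp; first by have [] := uf.
exact: subspace_continuous_measurable_fun.
Qed.

Let f01 y : 0 <= f y <= 1. Proof. exact: (proj2 uf). Qed.

Let integrable_discount p : continuous_on_time p ->
  mu.-integrable times (EFin \o (fun t => expR (- lam * t) * f (p t))).
Proof.
move=> cp; apply/integrableP; split; first by apply/measurable_EFinP; exact: measurable_discount.
apply: (@le_lt_trans _ _ (lam^-1)%:E); last by rewrite ltry.
rewrite -(integral_exp_decay lam0); apply: ge0_le_integral => //.
- apply: measurableT_comp => //; apply/measurable_EFinP; exact: measurable_discount.
- by apply/measurable_EFinP; exact: mexp.
- move=> t _; rewrite lee_fin ger0_norm; last by rewrite mulr_ge0 ?expR_ge0//; case/andP: (f01 (p t)).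
  by rewrite ler_piMr ?expR_ge0//; case/andP: (f01 (p t)).
Qed.

Lemma discountedE p : continuous_on_time p ->
  (discounted p)%:E = (\int[mu]_(t in times) (expR (- lam * t) * f (p t))%:E)%E.
Proof.
move=> cp; rewrite /discounted /Rintegral fineK//.
exact: integrable_fin_num (integrable_discount cp).
Qed.

(* The first term accounts for the times before [T]. For those after [T], half of the
discount pays for the factor [expR (- (lam / 2) * T)], the other half for the
integral. *)
Let discounted_near (T eps : R) p q : continuous_on_time p -> continuous_on_time q ->
  0 <= eps -> (forall t, 0 <= t <= T -> `|p t - q t| <= eps) ->
  `|discounted p - discounted q| <= L * eps * lam^-1 + expR (- (lam / 2) * T) * (lam / 2)^-1.
Proof.
move=> cp cq eps0 close; have ip := integrable_discount cp; have iq := integrable_discount cq.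
have l20 : 0 < lam / 2 by rewrite divr_gt0.
rewrite /discounted -RintegralB//.
have iD : mu.-integrable times (EFin \o (fun t => expR (- lam * t) * f (p t) - expR (- lam * t) * f (q t))).
  exact: (@integrableB _ _ R mu times mtimes _ _ ip iq).
pose g t := L * eps * expR (- lam * t) + expR (- (lam / 2) * T) * expR (- (lam / 2) * t).
have gE : (\int[mu]_(t in times) (g t)%:E = (L * eps * lam^-1 + expR (- (lam / 2) * T) * (lam / 2)^-1)%:E)%E.
  under eq_integral do rewrite /g EFinD.
  rewrite ge0_integralD//; last 3 first.
  - by move=> t _; rewrite lee_fin !mulr_ge0 ?expR_ge0// ltW.
  - by apply/measurable_EFinP; apply: measurable_funM => //; exact: mexp.
  - by apply/measurable_EFinP; apply: measurable_funM => //; exact: mexp.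
  under eq_integral do rewrite EFinM.
  under [X in (_ + X)%E]eq_integral do rewrite EFinM.
  rewrite !ge0_integralZl//.
  - by rewrite !integral_exp_decay// -!EFinM -EFinD.
  - by apply/measurable_EFinP; exact: mexp.
  - by apply/measurable_EFinP; exact: mexp.
  - by rewrite lee_fin mulr_ge0// ltW.
have g0 t : 0 <= g t by rewrite addr_ge0 ?mulr_ge0 ?expR_ge0// ltW.
rewrite -lee_fin EFin_normr_Rintegral// -gE.
apply: (@le_trans _ _ (\int[mu]_(t in times) `|(expR (- lam * t) * f (p t) - expR (- lam * t) * f (q t))%:E|)%E).
  by apply: le_abse_integral => //; have /integrableP[] := iD.
apply: ge0_le_integral => //.
- apply: measurableT_comp => //; by have /integrableP[] := iD.
- by apply/measurable_EFinP; apply: measurable_funD; apply: measurable_funM => //; exact: mexp.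
move=> t; rewrite /= in_itv/= andbT => t0; rewrite lee_fin -mulrBr normrM ger0_norm ?expR_ge0//.
have /andP[fp0 fp1] := f01 (p t); have /andP[fq0 fq1] := f01 (q t).
have e0 := expR_ge0 (- lam * t).
have [tT|/ltW Tt] := leP t T.
  apply: (@le_trans _ _ (L * eps * expR (- lam * t))); last first.
    by rewrite /g lerDl mulr_ge0 ?expR_ge0.
  rewrite mulrC ler_wpM2r//; apply: le_trans (lipf _ _) _.
  by rewrite ler_wpM2l ?(ltW L0)// close// t0.
apply: (@le_trans _ _ (expR (- lam * t))).
  by rewrite ler_piMr// ler_norml; apply/andP; split; lra.
apply: (@le_trans _ _ (expR (- (lam / 2) * T) * expR (- (lam / 2) * t))).
  rewrite -expRD ler_expR; have := ler_wpM2l (ltW l20) Tt; lra.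
by rewrite /g lerDr mulr_ge0// mulr_ge0// ltW.
Qed.

Lemma discounted_bounded p : continuous_on_time p -> `|discounted p| <= lam^-1.
Proof.
move=> cp; have d0 : 0 <= discounted p.
  by apply: Rintegral_ge0 => t _; rewrite mulr_ge0 ?expR_ge0//; case/andP: (f01 (p t)).
rewrite ger0_norm// -lee_fin discountedE// -(integral_exp_decay lam0).
apply: ge0_le_integral => //.
- by move=> t _; rewrite lee_fin mulr_ge0 ?expR_ge0//; case/andP: (f01 (p t)).
- by apply/measurable_EFinP; exact: measurable_discount.
- by apply/measurable_EFinP; exact: mexp.
- by move=> t _; rewrite lee_fin ler_piMr ?expR_ge0//; case/andP: (f01 (p t)).
Qed.

(** The discount makes the occupation functional continuous for uniform convergence
on compact sets: the times after a large [T] contribute little, and before [T] two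
close paths have close values of [f], which is Lipschitz. *)
Lemma discounted_functional :
  @bounded_continuous_functional R discounted.
Proof.
split; last by exists lam^-1 => p; exact: discounted_bounded.
apply/subspace_continuousP => p cp.
apply/cvgrPdist_le => /= eps eps0.
have l20 : 0 < lam / 2 by rewrite divr_gt0.
have [T T0 tail] : exists2 T, 0 <= T & expR (- (lam / 2) * T) * (lam / 2)^-1 <= eps / 2.
  have lim : expR (- (lam / 2 * T)) * (lam / 2)^-1 @[T --> +oo] --> 0 * (lam / 2)^-1.
    apply: cvgM; last exact: cvg_cst.
    by apply: (cvg_comp (fun T => lam / 2 * T) (fun y => expR (- y))); [exact: gt0_cvgMry|exact: cvgr_expR].
  rewrite mul0r in lim; near (pinfty_nbhs R) => T; exists T => //.
  rewrite mulNr; apply: (le_trans (ler_norm _)); near: T.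
  have e2 : 0 < eps / 2 by rewrite divr_gt0.
  move/cvgrPdist_le : lim => /(_ _ e2); apply: filterS => T.
  by rewrite sub0r normrN.
pose delta := eps / 2 * lam / L.
have delta0 : 0 < delta by rewrite !mulr_gt0 ?invr_gt0.
have close : \forall q \near nbhs p, forall t, 0 <= t <= T -> `|p t - q t| <= delta.
  have cT : compact_times (`[0, T]%classic : set R).
    split; first exact: segment_compact.
    by move=> t; rewrite /= !in_itv/= andbT => /andP[].
  have := (fam_cvgP (@compact_times R) p (nbhs_filter p)).1 (@cvg_id _ _) _ cT.
  apply; apply/uniform_nbhs; exists [set xy | `|xy.1 - xy.2| < delta]; split.
    exact: (entourage_ball _ (PosNum delta0)).
  by move=> q /= pq t t0T; apply/ltW/pq; rewrite /= in_itv.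
near=> q.
have cq : continuous_paths q by near: q; exact: withinT.
have pq : forall t, 0 <= t <= T -> `|p t - q t| <= delta by near: q; exact: cvg_within close.
apply: le_trans (discounted_near cp cq (ltW delta0) pq) _.
rewrite [leRHS]splitr lerD// /delta le_eqVlt; apply/orP; left; apply/eqP.
by field; rewrite !gt_eqF.
Unshelve. all: by end_near. Qed.

End DiscountedFunctional.

(** * Occupation of the conditioned process *)

Section ConditionalExpectation.
Variables (R : realType) (W : process R).
Hypothesis hW : standard_brownian_motion W.
Local Notation P := (process_prob W).
Local Notation Omega := (process_space W).
Local Notation mu := (@lebesgue_measure R).
Local Notation times := (`[0%R, +oo[%classic : set R).
Variables (m k : R) (f : R -> R).
Hypotheses (m0 : 0 < m) (mk : m < k) (uf : unit_valued f).
Local Notation path x w := (drifted_path m x W w).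
Local Notation lam := ((k ^+ 2 - m ^+ 2) / 2).

Lemma rate_gt0 : 0 < lam.
Proof.
have k0 : 0 < k by exact: lt_trans mk.
by rewrite divr_gt0// subr_gt0 ltr_sqr ?nnegrE ?(ltW m0) ?(ltW k0).
Qed.

Let mtimes : measurable times. Proof. exact: measurable_itv. Qed.
Let f01 y : 0 <= f y <= 1. Proof. exact: (proj2 uf). Qed.

Let surviveE x : survive m x = \1_(stays_nonnegative m x W) :> (Omega -> R).
Proof.
apply/funext => w; rewrite /survive indicE; by case: asboolP => h; [rewrite mem_set|rewrite memNset].
Qed.

Let measurable_stays x : measurable (stays_nonnegative m x W).
Proof.
have -> : stays_nonnegative m x W = (survive m x : Omega -> R) @^-1` [set 1].
  apply/seteqP; split => w; rewrite surviveE /= indicE.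
    by move=> /mem_set ->.
  by case: (boolP (_ \in _)) => [/set_mem//|_ /esym/eqP]; rewrite oner_eq0.
by rewrite -[X in measurable X]setTI; exact: measurable_survive.
Qed.

Let probability_stays x : fine (P (stays_nonnegative m x W)) = survival W m x.
Proof.
have -> : survival W m x = fine (survival W m x)%:E by [].
rewrite survivalE// surviveE integral_indic ?setIT//.
Qed.

(** Tonelli's theorem, once the path space integral over the event of survival is
written with the indicator [survive]. *)
Lemma conditional_discounted x :
  conditional_expectation P (stays_nonnegative m x W)
    (fun w => discounted lam f (path x w)) =
  fine (occupation_survive W m k f x) / survival W m x.
Proof.
rewrite /conditional_expectation probability_stays; congr (_ / _).
rewrite /Rintegral; congr fine.
pose g (q : R * Omega) := (expR (- lam * q.1) * (f (path x q.2 (Num.max 0 q.1)) * survive m x q.2))%:E.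
have s01 (w : Omega) : 0 <= survive m x w <= 1 by exact: bool_unit.
have mg : measurable_fun setT g.
  apply/measurable_EFinP; apply: measurable_funM.
    apply: measurableT_comp; first exact: measurable_expR.
    by apply: measurable_funM => //; exact: measurable_fst.
  apply: measurable_funM; first by apply: measurableT_comp; [have [] := uf|exact: measurable_joint_path].
  by apply: (measurableT_comp (f := survive m x) (g := snd)); [exact: measurable_survive|exact: measurable_snd].
have g0 q : (0 <= g q)%E.
  rewrite lee_fin mulr_ge0 ?expR_ge0// mulr_ge0//.
  by case/andP: (f01 (path x q.2 (Num.max 0 q.1))).
transitivity (\int[P]_w \int[mu]_(t in times) g (t, w))%E.
  rewrite integral_mkcond; apply: eq_integral => w _; rewrite patchE.
  have -> : (\int[mu]_(t in times) g (t, w) =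
      (survive m x w)%:E * \int[mu]_(t in times) (expR (- lam * t) * f (path x w t))%:E)%E.
    rewrite -ge0_integralZl//.
    - apply: eq_integral => t; rewrite inE/= in_itv/= andbT => t0.
      by rewrite /g /= max_r// -EFinM mulrA mulrC.
    - by apply/measurable_EFinP; apply: measurable_discount => //; exact: continuous_path.
    - by move=> t _; rewrite lee_fin mulr_ge0 ?expR_ge0//; case/andP: (f01 (path x w t)).
    - by rewrite lee_fin; case/andP: (s01 w).
  rewrite surviveE indicE; case: (_ \in _); last by rewrite mul0e.
  by rewrite mul1e discountedE//; [exact: rate_gt0|exact: continuous_path].
rewrite -(tonelli_on mu P mtimes mg g0); apply: eq_integral => t.
rewrite inE/= in_itv/= andbT => t0; apply: eq_integral => w _.
by rewrite /g /= max_r.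
Qed.

End ConditionalExpectation.

Section VanishingDiscount.
Context (R : realType) d (T : measurableType d) (nu : {measure set T -> \bar R}).
Variables (D : set T) (a : R^nat) (c h : T -> R).
Hypotheses (mD : measurable D) (a0 : a n @[n --> \oo] --> 0) (na : nonincreasing_seq a).
Hypotheses (mc : measurable_fun D c) (mh : measurable_fun D h).
Hypotheses (c0 : forall x, D x -> 0 <= c x) (h0 : forall x, D x -> 0 <= h x).

Let g n x := (expR (- a n * c x) * h x)%:E.

Let g_homo x : D x -> {homo g ^~ x : n p / (n <= p)%N >-> (n <= p)%E}.
Proof.
move=> Dx n p np; rewrite lee_fin ler_wpM2r ?h0// ler_expR.
by rewrite ler_wpM2r ?c0// lerN2; exact: na.
Qed.

Lemma vanishing_discount_homo :
  {homo (fun n => \int[nu]_(x in D) g n x)%E : n p / (n <= p)%N >-> (n <= p)%E}.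
Proof.
have mg n : measurable_fun D (g n).
  apply/measurable_EFinP; apply: measurable_funM => //.
  by apply: measurableT_comp; [exact: measurable_expR|exact: measurable_funM].
move=> n p np; apply: ge0_le_integral => //.
- by move=> x Dx; rewrite lee_fin mulr_ge0 ?expR_ge0 ?h0.
- by move=> x Dx; exact: g_homo.
Qed.

(** Monotone convergence as the discount rate decreases to [0]. *)
Lemma vanishing_discount :
  (\int[nu]_(x in D) (expR (- a n * c x) * h x)%:E @[n --> \oo] -->
   \int[nu]_(x in D) (h x)%:E)%E.
Proof.
have mg n : measurable_fun D (g n).
  apply/measurable_EFinP; apply: measurable_funM => //.
  by apply: measurableT_comp; [exact: measurable_expR|exact: measurable_funM].
have -> : (\int[nu]_(x in D) (h x)%:E = \int[nu]_(x in D) limn (g ^~ x))%E.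
  apply: eq_integral => x; rewrite inE => Dx; apply/esym/cvg_lim => //.
  apply: cvg_EFin; first exact: nearW.
  rewrite -[X in _ --> X]mul1r; apply: cvgM; last exact: cvg_cst.
  rewrite [X in _ --> X](_ : 1 = expR (- 0 * c x)); last by rewrite oppr0 mul0r expR0.
  apply: (cvg_comp (fun n => - a n * c x) expR); last exact: continuous_expR.
  by apply: cvgM; [exact: cvgN|exact: cvg_cst].
apply: (cvg_monotone_convergence mD mg).
- by move=> n x Dx; rewrite lee_fin mulr_ge0 ?expR_ge0 ?h0.
- by move=> x Dx; exact: g_homo.
Qed.

End VanishingDiscount.

Section ConditionedOccupation.
Variables (R : realType) (m : R) (X : process R) (f : R -> R) (L : R).
Hypotheses (m0 : 0 < m) (hX : conditioned_brownian_motion m X).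
Hypotheses (L0 : 0 < L) (uf : unit_valued f)
  (lipf : forall x y, `|f x - f y| <= L * `|x - y|).
Local Notation mu := (@lebesgue_measure R).
Hypothesis intf : (\int[mu]_z (f z)%:E < +oo)%E.
Local Notation P := (process_prob X).
Local Notation Omega := (process_space X).
Local Notation times := (`[0%R, +oo[%classic : set R).
Local Notation lam k := ((k ^+ 2 - m ^+ 2) / 2).

Let mtimes : measurable times. Proof. exact: measurable_itv. Qed.
Let f01 y : 0 <= f y <= 1. Proof. exact: (proj2 uf). Qed.
Let cX w : continuous_on_time (sample_path X w). Proof. by have [] := hX. Qed.

Let g (a : R) (q : R * Omega) := (expR (- a * q.1) * f (X (Num.max 0 q.1) q.2))%:E.

Let measurable_g a : measurable_fun [set: R * Omega] (g a).
Proof.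
apply/measurable_EFinP; apply: measurable_funM.
  apply: measurableT_comp; first exact: measurable_expR.
  by apply: measurable_funM => //; exact: measurable_fst.
apply: measurableT_comp; first by have [] := uf.
by apply: (@measurable_fun_process R _ Omega (fun t w => X t w)) => // t; exact: measurable_funPT.
Qed.

Let g_ge0 a q : (0 <= g a q)%E.
Proof. by rewrite lee_fin mulr_ge0 ?expR_ge0//; case/andP: (f01 (X (Num.max 0 q.1) q.2)). Qed.

Let occupation (a : R) (w : Omega) := (\int[mu]_(t in times) (expR (- a * t) * f (X t w))%:E)%E.

Let occupationE a w : occupation a w = (\int[mu]_(t in times) g a (t, w))%E.
Proof.
by apply: eq_integral => t; rewrite inE/= in_itv/= andbT => t0; rewrite /g /= max_r.
Qed.

Let measurable_occupation a : measurable_fun [set: Omega] (occupation a).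
Proof.
rewrite (_ : occupation a = fun w => \int[mu]_(t in times) g a (t, w))%E; last exact/funext/occupationE.
exact: (measurable_tonelli_on2 mu mtimes (measurable_g a) (g_ge0 a)).
Qed.

Let occupation_ge0 a w : (0 <= occupation a w)%E.
Proof.
by apply: integral_ge0 => t _; rewrite lee_fin mulr_ge0 ?expR_ge0//; case/andP: (f01 (X t w)).
Qed.

Definition conditioned_weight (z : R) : R := f z * (1 - expR (- (2 * m) * z)).

Let weightE W (hW : standard_brownian_motion W) k : (\int[mu]_z (weighted_survival W m f z * expR ((m - k) * z))%:E =
   \int[mu]_(z in times) (expR (- (k - m) * z) * conditioned_weight z)%:E)%E.
Proof.
rewrite [RHS]integral_mkcond; apply: eq_integral => z _; rewrite patchE.
rewrite /weighted_survival /nonneg_ind; case: ifPn.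
  rewrite inE/= in_itv/= andbT => z0; rewrite z0 mul1r (survival_prob hW m0 z0) opprB.
  by rewrite mulrC.
by rewrite notin_setE/= in_itv/= andbT => /negP/negbTE ->; rewrite !mul0r.
Qed.

(* The weak limit that defines [X], tested on the discounted occupation, against
[limit_occupation]. *)
Let discounted_occupation k : m < k ->
  (\int[P]_w occupation (lam k) w = (m^-1)%:E * \int[mu]_(z in times) (expR (- (k - m) * z) * conditioned_weight z)%:E)%E.
Proof.
move=> mk; have lam0 := rate_gt0 m0 mk.
have [_ [W hW lim]] := hX.
have {lim} := lim _ (discounted_functional lam0 L0 uf lipf).
under eq_fun do rewrite (conditional_discounted hW m0 mk uf).
move=> lim1; have lim2 := limit_occupation hW m0 (ltW mk) uf intf.
have e := cvg_unique _ lim1 lim2.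
rewrite -(weightE hW) -(limit_occupationE hW (ltW mk) uf intf) -EFinM -e//.
rewrite /Rintegral fineK.
  by apply: eq_integral => w _; rewrite discountedE//; exact: cX.
have discE w : (discounted (lam k) f (sample_path X w))%:E = occupation (lam k) w.
  by rewrite discountedE//; exact: cX.
under eq_integral do rewrite discE.
rewrite ge0_fin_numE; last by apply: integral_ge0.
apply: (@le_lt_trans _ _ (\int[P]_w (cst ((lam k)^-1)%:E w))%E).
  apply: ge0_le_integral => //.
  - move=> w _; rewrite -discE lee_fin; apply: le_trans (ler_norm _) _.
    by apply: discounted_bounded => //; exact: cX.
by rewrite integral_cst// [X in (_ * X)%E](@probability_setT _ _ _ P) mule1 ltry.
Qed.

(** The occupation density at [z >= 0] of the conditioned process is
[m^-1 * (1 - expR (- (2 * m) * z))]. Without discount the functional is in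
general neither bounded nor continuous, hence the limit of [k] to [m] from above. *)
Lemma conditioned_occupation :
  (\int[P]_w \int[mu]_(t in times) (f (X t w))%:E =
   (m^-1)%:E * \int[mu]_(z in times) (conditioned_weight z)%:E)%E.
Proof.
pose k n := m + harmonic n.
have mk n : m < k n by rewrite /k ltrDl harmonic_gt0.
have kn : nonincreasing_seq k.
  by move=> i j ij; rewrite /k lerD2l /harmonic/= lef_pV2 ?posrE// ler_nat ltnS.
have k0 n : 0 <= k n by rewrite ltW// (lt_trans m0).
have limk : k n @[n --> \oo] --> m.
  rewrite -[X in _ --> X]addr0; apply: cvgD; first exact: cvg_cst.
  exact: cvg_harmonic.
have limlam : lam (k n) @[n --> \oo] --> 0.
  rewrite [X in _ --> X](_ : 0 = (m ^+ 2 - m ^+ 2) / 2); last by rewrite subrr mul0r.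
  apply: cvgM; last exact: cvg_cst; apply: cvgB; last exact: cvg_cst.
  by rewrite !expr2; apply: cvgM.
have nlam : nonincreasing_seq (fun n => lam (k n)).
  move=> i j ij; rewrite ler_pM2r ?invr_gt0// lerD2r ler_sqr ?nnegrE//.
  exact: kn.
have mX w : measurable_fun times (fun t => f (X t w)).
  apply: measurableT_comp; first by have [] := uf.
  by apply: subspace_continuous_measurable_fun => //; exact: cX.
have left : (\int[P]_w occupation (lam (k n)) w @[n --> \oo] -->
    \int[P]_w \int[mu]_(t in times) (f (X t w))%:E)%E.
  have -> : (\int[P]_w \int[mu]_(t in times) (f (X t w))%:E =
      \int[P]_w limn (fun n => occupation (lam (k n)) w))%E.
    apply: eq_integral => w _; apply/esym/cvg_lim => //.
    apply: vanishing_discount => //.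
    - exact: mX.
    - by move=> t; rewrite /= in_itv/= andbT.
    - by move=> t _; case/andP: (f01 (X t w)).
  apply: cvg_monotone_convergence => //.
  - move=> w _; apply: vanishing_discount_homo => //.
    + exact: mX.
    + by move=> t; rewrite /= in_itv/= andbT.
    + by move=> t _; case/andP: (f01 (X t w)).
have mw : measurable_fun times conditioned_weight.
  apply: measurable_funTS; apply: measurable_funM; first by have [] := uf.
  apply: measurable_funB => //; apply: measurableT_comp; first exact: measurable_expR.
  exact: measurable_funM.
have right : ((m^-1)%:E * \int[mu]_(z in times) (expR (- (k n - m) * z) * conditioned_weight z)%:E @[n --> \oo] -->
   (m^-1)%:E * \int[mu]_(z in times) (conditioned_weight z)%:E)%E.
  apply: cvgeZl => //; apply: vanishing_discount => //.
  - by rewrite -[X in _ --> X](subrr m); apply: cvgB => //; exact: cvg_cst.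
  - by move=> i j ij; rewrite lerD2r; exact: kn.
  - by move=> t; rewrite /= in_itv/= andbT.
  - move=> t; rewrite /= in_itv/= andbT => t0; rewrite mulr_ge0//; first by case/andP: (f01 t).
    by rewrite subr_ge0 -expR0 ler_expR mulNr oppr_le0 !mulr_ge0// ltW.
apply: (cvg_unique _ left) => //.
rewrite (_ : (fun n => _) = fun n => ((m^-1)%:E * \int[mu]_(z in times) (expR (- (k n - m) * z) * conditioned_weight z)%:E)%E); first exact: right.
by apply/funext => n; exact: discounted_occupation.
Qed.

End ConditionedOccupation.

(** * The value of the constant *)

Section DriftedOccupation.
Variables (R : realType) (B : process R) (m : R) (f : R -> R).
Hypotheses (hB : standard_brownian_motion B) (m0 : 0 < m) (uf : unit_valued f).
Local Notation mu := (@lebesgue_measure R).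
Local Notation P := (process_prob B).
Local Notation Omega := (process_space B).
Local Notation times := (`[0%R, +oo[%classic : set R).

Let mtimes : measurable times. Proof. exact: measurable_itv. Qed.
Let f01 y : 0 <= f y <= 1. Proof. exact: (proj2 uf). Qed.

(** An instance of [resolventE] in which [k] is the opposite of the drift, so that
the discount rate vanishes. *)
Lemma drifted_occupation :
  (\int[P]_w \int[mu]_(t in times) (f (B t w - m * t))%:E =
   \int[mu]_z (f z * green (- m) m z)%:E)%E.
Proof.
pose g (q : R * Omega) := (f (drifted_path (- m) 0 B q.2 (Num.max 0 q.1)))%:E.
have mg : measurable_fun setT g.
  apply/measurable_EFinP; apply: measurableT_comp; first by have [] := uf.
  exact: measurable_joint_path.
have g0 q : (0 <= g q)%E by rewrite lee_fin; case/andP: (f01 (drifted_path (- m) 0 B q.2 (Num.max 0 q.1))).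
transitivity (\int[P]_w \int[mu]_(t in times) g (t, w))%E.
  apply: eq_integral => w _; apply: eq_integral => t; rewrite inE/= in_itv/= andbT => t0.
  by rewrite /g /drifted_path /= max_r// add0r mulNr.
rewrite -(tonelli_on mu P mtimes mg g0).
transitivity (resolvent B (- m) ((m ^+ 2 - (- m) ^+ 2) / 2) f 0).
  apply: eq_integral => t; rewrite inE/= in_itv/= andbT => t0.
  rewrite sqrrN subrr mul0r oppr0 mul0r expR0 mul1r heatE//.
  by apply: eq_integral => w _; rewrite /g /= max_r.
rewrite resolventE//; apply: eq_integral => z _.
by rewrite subr0.
Qed.

End DriftedOccupation.

Section TotalOccupation.
Variables (R : realType) (m : R) (f : R -> R).
Hypotheses (m0 : 0 < m) (uf : unit_valued f).
Local Notation mu := (@lebesgue_measure R).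
Local Notation times := (`[0%R, +oo[%classic : set R).

Let f01 y : 0 <= f y <= 1. Proof. exact: (proj2 uf). Qed.

(** The two occupation densities add up to the constant [m^-1]: above [0] they are
[m^-1 * expR (- (2 * m) * z)] and [m^-1 * (1 - expR (- (2 * m) * z))], and below [0]
the first one is [m^-1] while the conditioned process is never there. *)
Lemma total_occupation :
  (\int[mu]_z (f z * green (- m) m z)%:E +
   (m^-1)%:E * \int[mu]_(z in times) (conditioned_weight m f z)%:E =
   (m^-1)%:E * \int[mu]_z (f z)%:E)%E.
Proof.
have mf : measurable_fun [set: R] f by have [] := uf.
have mw : measurable_fun [set: R] (conditioned_weight m f).
  apply: measurable_funM => //; apply: measurable_funB => //.
  by apply: measurableT_comp; [exact: measurable_expR|exact: measurable_funM].
have mt : measurable times by exact: measurable_itv.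
have w0 z : times z -> (0 <= (conditioned_weight m f z)%:E)%E.
  rewrite /= in_itv/= andbT => z0; rewrite lee_fin mulr_ge0//; first by case/andP: (f01 z).
  by rewrite subr_ge0 -expR0 ler_expR mulNr oppr_le0 !mulr_ge0// ltW.
have mi : ((m^-1)%:E >= 0)%E by rewrite lee_fin invr_ge0 ltW.
rewrite -!ge0_integralZl//; last 3 first.
- exact/measurable_EFinP.
- by move=> z _; rewrite lee_fin; case/andP: (f01 z).
- by apply/measurable_EFinP; exact: measurable_funTS.
rewrite [X in (_ + X)%E]integral_mkcond -ge0_integralD//.
- apply: eq_integral => z _; rewrite patchE /green.
  rewrite (_ : - m - m = - (2 * m)); last by ring.
  case: ifPn => [|].
    rewrite inE/= in_itv/= andbT => z0; rewrite min_l; last first.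
      by rewrite -expR0 ler_expR !mulr_ge0// ltW.
    by rewrite -!EFinM -EFinD /conditioned_weight; congr (_%:E); ring.
  rewrite notin_setE/= in_itv/= andbT => /negP; rewrite -ltNge => /ltW z0.
  rewrite min_r; last by rewrite -expR0 ler_expR pmulr_rle0 ?mulr_gt0.
  by rewrite -expRD mulNr addNr expR0 mulr1 adde0 -EFinM mulrC.
- move=> z _; rewrite lee_fin mulr_ge0//; first by case/andP: (f01 z).
  by rewrite /green mulr_ge0 ?invr_ge0 ?(ltW m0)// mulr_ge0 ?expR_ge0// le_min ler01 expR_ge0.
- apply/measurable_EFinP; apply: measurable_funM => //.
  have -> : green (- m) m = (fun z => green (- m) m (z - 0)) by apply/funext => z; rewrite subr0.
  exact: measurable_green.
- by move=> z _; apply: erestrict_ge0 => {}z tz; rewrite mule_ge0// w0.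
- have h : measurable_fun times (fun z => (m^-1)%:E * (conditioned_weight m f z)%:E)%E.
    by apply: emeasurable_funM => //; apply/measurable_EFinP; exact: measurable_funTS.
  exact/(measurable_restrictT _ mt).
Qed.

End TotalOccupation.

Section Constants.
Variable R : realType.

Lemma drift_gt0 (gamma : R) : 0 < gamma < 2 -> 0 < Q_of gamma - gamma.
Proof.
move=> /andP[g0 g2]; rewrite /Q_of.
have -> : gamma / 2 + 2 / gamma - gamma = (4 - gamma ^+ 2) / (2 * gamma) by field; rewrite gt_eqF.
rewrite divr_gt0 ?mulr_gt0// subr_gt0.
by rewrite (_ : 4 = 2 ^+ 2) ?ltr_sqr ?nnegrE ?ltW//; rewrite -natrX.
Qed.

Lemma drift_mul (gamma : R) : 0 < gamma -> gamma * (Q_of gamma - gamma) = 2 - gamma ^+ 2 / 2.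
Proof. by move=> g0; rewrite /Q_of; field; rewrite gt_eqF. Qed.

Lemma constant_cvg : (pi * (2 - gamma ^+ 2 / 2))^-1 @[gamma --> (0 : R)^'+] --> c_zero R.
Proof.
rewrite /c_zero; apply: cvgV; first by rewrite mulf_neq0// gt_eqF// pi_gt0.
rewrite (_ : 2 * pi = pi * (2 - 0 ^+ 2 / 2)); last by rewrite expr0n/= mul0r subr0 mulrC.
apply: cvgM; first exact: cvg_cst.
apply: cvgB; first exact: cvg_cst.
apply: cvgM; last exact: cvg_cst.
by rewrite expr2; apply: cvgM; apply: cvg_at_right_filter; exact: cvg_id.
Qed.

Lemma constant_gt (gamma : R) : 0 < gamma < 2 -> c_zero R < (pi * (2 - gamma ^+ 2 / 2))^-1.
Proof.
move=> /andP[g0 g2]; have p0 := pi_gt0 R.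
have q2 : gamma ^+ 2 < 4.
  by rewrite (_ : 4 = 2 ^+ 2) ?ltr_sqr ?nnegrE ?ltW//; rewrite -natrX.
have q0 : 0 < gamma ^+ 2 by rewrite exprn_gt0.
rewrite /c_zero ltf_pV2 ?posrE ?mulr_gt0//; last by lra.
by rewrite [ltRHS]mulrC ltr_pM2l//; lra.
Qed.

End Constants.

Theorem theorem1p2 (R : realType)
    (B : process R) (X : R -> process R)
    (hB : standard_brownian_motion B)
    (hX : forall m : R, 0 < m -> conditioned_brownian_motion m (X m)) :
  [/\ forall gamma m : R, 0 < gamma < 2 -> 0 < m ->
        c_gamma_m B (X m) gamma m = ((pi * gamma * m)^-1)%:E,
      forall gamma : R, 0 < gamma < 2 ->
        c_gamma B X gamma = ((pi * (2 - gamma ^+ 2 / 2))^-1)%:E,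
      c_gamma B X gamma @[gamma --> 0^'+] --> (c_zero R)%:E &
      forall gamma : R, 0 < gamma < 2 ->
        ((c_zero R)%:E < c_gamma B X gamma)%E].
Proof.
have main (gamma m : R) : 0 < gamma < 2 -> 0 < m ->
    c_gamma_m B (X m) gamma m = ((pi * gamma * m)^-1)%:E.
  move=> /andP[g0 _] m0; rewrite /c_gamma_m.
  have uf := unit_profile gamma.
  have L0 : 0 < 4 * gamma by rewrite mulr_gt0.
  have intf : (\int[lebesgue_measure]_z (profile gamma z)%:E < +oo)%E.
    by rewrite integral_profile// ltry.
  have e1 := drifted_occupation hB m0 uf.
  have e2 := conditioned_occupation m0 (hX _ m0) L0 uf (profile_lipschitz g0) intf.
  rewrite e1 e2 total_occupation// integral_profile// -!EFinM; congr (_%:E).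
  by rewrite !invfM -mulrA [in RHS]mulrC; ring.
have gammaE (gamma : R) : 0 < gamma < 2 ->
    c_gamma B X gamma = ((pi * (2 - gamma ^+ 2 / 2))^-1)%:E.
  move=> g02; rewrite /c_gamma main ?drift_gt0// -mulrA drift_mul//.
  by case/andP: g02.
split => //.
- have lim : ((pi * (2 - gamma ^+ 2 / 2))^-1)%:E @[gamma --> 0^'+] --> (c_zero R)%:E.
    by apply: cvg_EFin; [exact: nearW|exact: constant_cvg].
  apply: cvg_trans lim; apply: near_eq_cvg; near=> gamma; rewrite gammaE//.
  by apply/andP; split; near: gamma; [exact: nbhs_right_gt|exact: nbhs_right_lt].
- by move=> gamma g02; rewrite gammaE// lte_fin constant_gt.
Unshelve. all: by end_near. Qed.
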